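(* Any $L^2(\mathbb{R}^2)$ solution $\phi$ of the equation $$\omega\phi=\mathcal{T}(\phi,\phi,\phi)$$ (with $\omega\in\mathbb{R}$) satisfies $$e^{\mu|\cdot|}\phi\in L^\infty(\mathbb{R}^2)\quad\text{and}\quad e^{\mu|\cdot|}\widehat\phi\in L^\infty(\mathbb{R}^2)$$ for some $\mu>0$.
   Context: For $x=(x_1,x_2)\in\mathbb{R}^2$, $x^\perp=(-x_2,x_1)$, and $$\mathcal{T}(f_1,f_2,f_3)(z)=\int_{\mathbb{R}}\int_{\mathbb{R}^2} f_1(x+z)\,f_2(\lambda x^\perp+z)\,\overline{f_3(x+\lambda x^\perp+z)}\,dx\,d\lambda,\qquad z\in\mathbb{R}^2,$$ which is bounded from $(L^2(\mathbb{R}^2))^3$ to $L^2(\mathbb{R}^2)$. The Fourier transform is $\widehat f(\xi)=\frac1{2\pi}\int_{\mathbb{R}^2}f(x)e^{-ix\cdot\xi}\,dx$. *)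

(* Defs.v *)
From HB Require Import structures.
From mathcomp Require Import all_boot all_order all_algebra.
From mathcomp Require Import complex.
From mathcomp Require Import all_classical all_reals all_analysis.
Import Order.TTheory GRing.Theory Num.Theory.
Import numFieldNormedType.Exports.

Set Implicit Arguments.
Unset Strict Implicit.
Unset Printing Implicit Defensive.

Local Open Scope classical_set_scope.
Local Open Scope ring_scope.
Local Open Scope complex_scope.

(* The norm that the library puts on pairs is the maximum norm. *)
Definition enorm {R : realType} (x : R * R) : R :=
  Num.sqrt (x.1 ^+ 2 + x.2 ^+ 2).

Definition edot {R : realType} (x y : R * R) : R := x.1 * y.1 + x.2 * y.2.

Definition perp {R : realType} (x : R * R) : R * R := (- x.2, x.1).

Definition smul {R : realType} (a : R) (x : R * R) : R * R :=
  (a * x.1, a * x.2).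

Definition leb {R : realType} : {measure set (measurableTypeR R) -> \bar R} :=
  @lebesgue_measure R.

Definition leb2 {R : realType} :
    {measure set (measurableTypeR R * measurableTypeR R)%type -> \bar R} :=
  (@lebesgue_measure R \x @lebesgue_measure R)%E.

Definition cmod {R : realType} (z : R[i]) : R := ComplexField.Normc.normc z.

Definition cintegral {d : measure_display} {T : measurableType d}
    {R : realType} (mu : {measure set T -> \bar R}) (f : T -> R[i]) : R[i] :=
  Rintegral mu setT (fun x => complex.Re (f x)) +i*
  Rintegral mu setT (fun x => complex.Im (f x)).

(* L^p classes are given by Borel representatives; identities between them are
   meant almost everywhere. *)
Definition cLp {d : measure_display} {T : measurableType d}
    {R : realType} (mu : {measure set T -> \bar R}) (p : \bar R)
    (f : T -> R[i]) : Prop :=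
  [/\ measurable_fun setT (fun x => complex.Re (f x)),
      measurable_fun setT (fun x => complex.Im (f x))
    & finite_norm mu p (fun x => cmod (f x))].

(* For [f1], [f2], [f3] in L^2 the double integral converges absolutely for
   almost every [z]; elsewhere the value is a convention of the library. *)
Definition trilinear {R : realType} (f1 f2 f3 : R * R -> R[i])
    (z : R * R) : R[i] :=
  cintegral leb (fun l : R =>
    cintegral leb2 (fun x : R * R =>
      f1 (x + z) * f2 (smul l (perp x) + z)
        * (f3 (x + smul l (perp x) + z))^*)).

Definition fourier1 {R : realType} (f : R * R -> R[i]) (xi : R * R) : R[i] :=
  ((2 * pi)^-1)%:C *
  cintegral leb2 (fun x : R * R =>
    f x * (cos (edot x xi) -i* sin (edot x xi))).

Definition ball_trunc {R : realType} (f : R * R -> R[i]) (n : nat)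
    (x : R * R) : R[i] :=
  if enorm x <= n%:R then f x else 0.

(* The Fourier-Plancherel transform on L^2: [g] is the L^2-limit of the
   transforms of the truncations of [f] to balls, which lie in L^1 when [f] is
   in L^2. Such a [g] is unique up to a null set. *)
Definition is_fourier {R : realType} (f g : R * R -> R[i]) : Prop :=
  cLp leb2 2%:E g /\
  (fun n : nat => Lnorm leb2 2%:E
     (fun xi : R * R => (cmod (fourier1 (ball_trunc f n) xi - g xi))%:E))
    @ \oo --> 0%E.

Definition exp_weight {R : realType} (mu : R) (f : R * R -> R[i])
    (x : R * R) : R[i] :=
  (expR (mu * enorm x))%:C * f x.

(* Main.v *)
(* The form <T(phi,phi,phi), h> is the integral, over all rectangles
   a = x+z, b = l x^perp + z, c = x + l x^perp + z, d = z, of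
   phi(a) phi(b) conj(phi(c) h(d)).  For a fixed shape l, Cauchy-Schwarz on the
   two diagonals bounds it by kern l = 1/(1+l^2) times the product of the L^2
   norms, and |d|^2 = |a|^2 + |b|^2 - |c|^2.

   If omega <> 0, testing against h = v phi bounds |omega| int v |phi|^2 by the
   form evaluated on moduli.  When d is far from the origin, a or b is far too.
   If exactly one of a, b, c is far, then the shape l is small or large, where
   kern has small mass; otherwise the tail norm of phi supplies a small factor.
   A bootstrap on truncated exponential weights then yields exp(mu |x|) phi in
   L^2.  The form is invariant under the Fourier transform
   (proved for integrable functions, the mollification by the Poisson kernel
   reducing the general case to it), so the transform of phi satisfies the same
   inequality and exp(mu |xi|) phi^ is in L^2.  Each of phi, phi^ is then the
   transform of a function with a first moment, hence Lipschitz, and a Lipschitz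
   function with exponentially weighted L^2 norm decays exponentially.

   If omega = 0, write F(m,r) = phi(m+r) phi(m-r).  Up to a constant,
   <T(phi,phi,phi), phi> is the squared L^2 norm of the average of F over the
   rotations of r, so this average vanishes and F is orthogonal to every
   rotation invariant function.  Testing with a Gaussian times exp(2i eta.m)
   gives that phi times a Gaussian has zero Fourier transform, so phi = 0. *)

From HB Require Import structures.
Require Import Defs.
From mathcomp Require Import all_boot all_order all_algebra.
From mathcomp Require Import complex ring lra.
From mathcomp Require Import all_classical all_reals all_analysis.
From mathcomp Require Import measurable_realfun ess_sup_inf.
Import Order.TTheory GRing.Theory Num.Theory.
Import numFieldNormedType.Exports.

Set Implicit Arguments.
Unset Strict Implicit.
Unset Printing Implicit Defensive.

Local Open Scope classical_set_scope.
Local Open Scope ring_scope.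
Local Open Scope complex_scope.

(** * Changes of variables for Lebesgue measure *)

(** The weighted norm is not known to be finite beforehand, so no term containing it can be
    absorbed. The weights are therefore cut at [2 ^ N], all constants are independent of [N], and an
    induction on [N] takes the place of absorption. It sees only moduli and one inequality, which
    lets [phi] and its transform share it. The two runs cannot be exchanged: the first makes [phi]
    integrable, so that its transform is an everywhere defined integral, and the second relies on
    this. The rate [mu] depends on the solution, through the radius outside which its L^2 norm is
    small. If [omega = 0] the equation gives no bound on [phi], only the vanishing of the form. The
    diagonals of a rectangle share midpoint and length and enclose the angle [2 * atan l], for which
    [kern l dl] is a multiple of the uniform measure; this turns the form into a mean of
    correlations of [F] with its rotates. Averages over the circle are written as planar integrals
    against a radial density, which keeps Lebesgue measure the only one in use. *)

Notation plane R := (measurableTypeR R * measurableTypeR R)%type.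

Ltac measurability :=
  repeat first
  [ assumption
  | exact: measurable_cst
  | exact: measurable_id
  | exact: measurable_fst
  | exact: measurable_snd
  | match goal with
    | H : measurable_fun setT ?f |- measurable_fun setT (fun x => ?f (@?e x)) =>
      refine (@measurableT_comp _ _ _ _ _ _ _ _ _ H _)
    end
  | refine (@measurableT_comp _ _ _ _ _ _ _ _ _ measurable_fst _)
  | refine (@measurableT_comp _ _ _ _ _ _ _ _ _ measurable_snd _)
  | apply: measurable_funD
  | apply: measurable_funM
  | apply: measurable_fun_pair
  | apply: measurableT_comp; [exact: oppr_measurable|]
  | apply: measurable_funX
  ].

Section affine.
Context {R : realType}.
Local Notation mR := (measurableTypeR R).

Lemma measurable_affine (a b : R) :
  measurable_fun setT (fun x : mR => a * x + b : mR).
Proof.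
by measurability.
Qed.

(** Uniqueness of Lebesgue measure: the scaled pushforward has the right value on the intervals []c,
    d]]. For negative [a] the preimage is reversed and closed on the other side, with the same
    length. *)
Lemma lebesgue_affine (a b : R) (A : set mR) : a != 0 -> measurable A ->
  lebesgue_measure A =
  (`|a|%:E * lebesgue_measure ((fun x : mR => (a * x + b)%R : mR) @^-1` A))%E.
Proof.
move=> a0 mA.
have ia : 0 < `|a| by rewrite normr_gt0.
pose k : {nonneg R} := NngNum (ltW ia).
pose f (x : mR) : mR := a * x + b.
have mf : measurable_fun setT f by exact: measurable_affine.
pose fM := isMeasurableFun.Build _ _ _ _ f mf.
pose f' : {mfun mR >-> mR} := HB.pack f fM.
rewrite (@lebesgue_measure_unique R (mscale k (pushforward lebesgue_measure f')))//.
move=> _ [[c d] _ <-] /=.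
rewrite /mscale/= /pushforward/=.
have [agt|alt] := ltP 0 a.
  rewrite (_ : f @^-1` _ = `](c - b) / a, (d - b) / a]%classic); last first.
    apply/seteqP; split => x /=; rewrite /f !in_itv/= ltr_pdivrMr// ler_pdivlMr//.
      by rewrite ltrBlDr lerBrDr mulrC.
    by rewrite ltrBlDr lerBrDr mulrC.
  rewrite !lebesgue_measure_itv/= !lte_fin ltr_pM2r ?invr_gt0// ltrD2r.
  case: ifPn => _; last by rewrite mule0.
  rewrite -!EFinD -EFinM gtr0_norm//; congr EFin; field.
  by rewrite gt_eqF.
have {}alt : a < 0 by rewrite lt_neqAle a0.
rewrite (_ : f @^-1` _ = `[(d - b) / a, (c - b) / a[%classic); last first.
  apply/seteqP; split => x /=; rewrite /f !in_itv/= ltr_ndivlMr// ler_ndivrMr//.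
    by rewrite ltrBlDr lerBrDr mulrC andbC.
  by rewrite ltrBlDr lerBrDr mulrC andbC.
rewrite !lebesgue_measure_itv/= !lte_fin ltr_nM2r ?invr_lt0// ltrD2r.
case: ifPn => _; last by rewrite mule0.
rewrite -!EFinD -EFinM ltr0_norm//; congr EFin; field.
by rewrite lt_eqF.
Qed.

Lemma integral_affine (a b : R) (f : mR -> \bar R) : a != 0 ->
  measurable_fun setT f -> (forall x, 0 <= f x)%E ->
  (\int[lebesgue_measure]_x f (a * x + b)%R =
   `|a|^-1%:E * \int[lebesgue_measure]_x f x)%E.
Proof.
move=> a0 mf f0.
have ia : 0 < `|a| by rewrite normr_gt0.
pose k : {nonneg R} := NngNum (ltW ia).
pose g (x : mR) : mR := a * x + b.
have mg : measurable_fun setT g by exact: measurable_affine.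
pose nu : {measure set mR -> \bar R} :=
  mscale k (pushforward lebesgue_measure g).
have -> : (\int[lebesgue_measure]_x f x = \int[nu mg]_x f x)%E.
  by apply: eq_measure_integral => A mA _; exact: lebesgue_affine.
rewrite ge0_integral_mscale//= ge0_integral_pushforward//.
by rewrite muleA -EFinM mulVf ?gt_eqF// mul1e preimage_setT.
Qed.

End affine.

(** * Product measures and linear substitutions in the plane *)

Lemma sigma_finite_prod d1 d2 (T1 : measurableType d1) (T2 : measurableType d2)
    (R : realType) (m1 : {measure set T1 -> \bar R})
    (m2 : {sigma_finite_measure set T2 -> \bar R}) :
  sigma_finite setT m1 -> sigma_finite setT (m1 \x m2)%E.
Proof.
move=> /sigma_finiteP[F [FT ndF Foo]].
have /sigma_finiteP[G [GT ndG Goo]] := sigma_finiteT m2.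
exists (fun n => F n `*` G n) => [|n].
  apply/seteqP; split => // -[x y] _.
  have [i _ Fx] : (\bigcup_n F n) x by rewrite -FT.
  have [j _ Gy] : (\bigcup_n G n) y by rewrite -GT.
  exists (maxn i j) => //; split => /=.
    by have /subsetPset := ndF _ _ (leq_maxl i j); apply.
  by have /subsetPset := ndG _ _ (leq_maxr i j); apply.
have [mF lF] := Foo n; have [mG lG] := Goo n.
split; first exact: measurableX.
by rewrite product_measure1E// lte_mul_pinfty// ge0_fin_numE.
Qed.

(** The measures [leb] and [leb2] are typed as plain measures. The alias turns a proof of
    sigma-finiteness into the structure that the Fubini theorems take as argument. *)
Definition sigma_finite_alias d (T : measurableType d) (R : realType)
  (m : {measure set T -> \bar R}) of sigma_finite setT m : set T -> \bar R := m.

Section sigma_finite_alias.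
Context d (T : measurableType d) (R : realType) (m : {measure set T -> \bar R}).
Context (s : sigma_finite setT m).

HB.instance Definition _ := Measure.on (sigma_finite_alias s).
HB.instance Definition _ :=
  Measure_isSigmaFinite.Build _ _ _ (sigma_finite_alias s) s.

End sigma_finite_alias.

Lemma tonelli d1 d2 (T1 : measurableType d1) (T2 : measurableType d2)
    (R : realType) (m1 : {measure set T1 -> \bar R})
    (m2 : {measure set T2 -> \bar R}) (f : T1 -> T2 -> \bar R) :
  sigma_finite setT m1 -> sigma_finite setT m2 ->
  measurable_fun setT (fun p : T1 * T2 => f p.1 p.2) ->
  (forall x y, 0 <= f x y)%E ->
  (\int[m1]_x \int[m2]_y f x y = \int[m2]_y \int[m1]_x f x y)%E.
Proof.
move=> s1 s2 mf f0.
exact: (@fubini_tonelli _ _ _ _ _ (sigma_finite_alias s1)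
  (sigma_finite_alias s2) _ mf).
Qed.

Section plane_measure.
Context {R : realType}.

Lemma sigma_finite_leb : sigma_finite setT (@leb R).
Proof. exact: (@sigma_finiteT _ _ _ (@lebesgue_measure R)). Qed.

Lemma sigma_finite_leb2 : sigma_finite setT (@leb2 R).
Proof. exact: sigma_finite_prod sigma_finite_leb. Qed.

Lemma integral_leb2E (f : plane R -> \bar R) :
  measurable_fun setT f -> (forall x, 0 <= f x)%E ->
  (\int[leb2]_x f x = \int[leb]_x \int[leb]_y f (x, y))%E.
Proof. by move=> mf f0; rewrite /leb2 fubini_tonelli1. Qed.

Definition linmap (a b c d : R) (x : plane R) : plane R :=
  (a * x.1 + b * x.2, c * x.1 + d * x.2).

Lemma measurable_linmap (a b c d : R) :
  measurable_fun setT (linmap a b c d : plane R -> plane R).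
Proof. rewrite /linmap; measurability. Qed.

(** Gaussian elimination with pivot [a]: substitute in the first coordinate for fixed second one,
    after which the second coordinate enters with coefficient [(a * d - b * c) / a]. The two
    one-dimensional Jacobians multiply to the determinant. *)
Lemma integral_linmap0 (a b c d : R) (f : plane R -> \bar R) :
  a != 0 -> a * d - b * c != 0 ->
  measurable_fun setT f -> (forall x, 0 <= f x)%E ->
  (\int[leb2]_x f (linmap a b c d x) =
   `|a * d - b * c|^-1%:E * \int[leb2]_x f x)%E.
Proof.
move=> a0 D0 mf f0.
have mfl : measurable_fun setT (fun x => f (linmap a b c d x)).
  exact: (measurableT_comp mf (measurable_linmap _ _ _ _)).
rewrite integral_leb2E//.
rewrite (tonelli (f := fun x y => f (linmap a b c d (x, y)))
  sigma_finite_leb sigma_finite_leb)//.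
pose g (y x : measurableTypeR R) := f (x, c / a * x + (a * d - b * c) / a * y)%R.
have mg : measurable_fun setT (fun p : plane R => g p.1 p.2).
  by apply: (measurableT_comp mf); measurability.
transitivity (\int[leb]_y (`|a|^-1%:E * \int[leb]_x g y x))%E.
  apply: eq_integral => y _.
  rewrite -(@integral_affine R a (b * y) (g y))//.
  - apply: eq_integral => x _; rewrite /g /linmap/=; congr (f (_, _)).
    by field.
  - by apply: (measurableT_comp mf); measurability.
  - by move=> x; exact: f0.
rewrite ge0_integralZl//; first last.
- by move=> y _; apply: integral_ge0 => x _; exact: f0.
- have := @measurable_fun_fubini_tonelli_F _ _ _ _ R (@lebesgue_measure R) _ mg.
  by apply => p; exact: f0.
rewrite (tonelli (f := g) sigma_finite_leb sigma_finite_leb)//; last by move=> y x; exact: f0.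
have Da0 : (a * d - b * c) / a != 0 by rewrite mulf_neq0// invr_eq0.
transitivity (`|a|^-1%:E * \int[leb]_x
    (`|(a * d - b * c) / a|^-1%:E * \int[leb]_y f (x, y)))%E.
  congr (_ * _)%E; apply: eq_integral => x _.
  rewrite -(@integral_affine R _ (c / a * x) (fun y => f (x, y)))//.
    by apply: eq_integral => y _; rewrite /g addrC.
  by apply: (measurableT_comp mf); measurability.
rewrite ge0_integralZl//; first last.
- by move=> y _; exact: integral_ge0.
- exact: (@measurable_fun_fubini_tonelli_F _ _ _ _ R (@lebesgue_measure R) _ mf).
rewrite -integral_leb2E// muleA -EFinM normf_div invf_div mulrA mulVf ?mul1r//.
by rewrite normr_eq0.
Qed.

Lemma integral_leb2_swap (f : plane R -> \bar R) :
  measurable_fun setT f -> (forall x, 0 <= f x)%E ->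
  (\int[leb2]_x f (x.2, x.1) = \int[leb2]_x f x)%E.
Proof.
move=> mf f0; rewrite (integral_leb2E mf f0).
have mfs : measurable_fun setT (fun x : plane R => f (x.2, x.1)).
  by apply: (measurableT_comp mf); measurability.
rewrite (integral_leb2E mfs (fun=> f0 _)).
rewrite (tonelli (f := fun x y => f (x, y)) sigma_finite_leb sigma_finite_leb)//.
by apply: (measurableT_comp mf); measurability.
Qed.

(** If the pivot [a] vanishes, exchanging the coordinates makes [b] the pivot. *)
Lemma integral_linmap (a b c d : R) (f : plane R -> \bar R) :
  a * d - b * c != 0 ->
  measurable_fun setT f -> (forall x, 0 <= f x)%E ->
  (\int[leb2]_x f (linmap a b c d x) =
   `|a * d - b * c|^-1%:E * \int[leb2]_x f x)%E.
Proof.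
have [->|a0 D0 mf f0] := eqVneq a 0; last exact: integral_linmap0.
move=> D0 mf f0; have b0 : b != 0.
  by apply: contra_neq D0 => ->; rewrite mul0r mul0r subrr.
have mfl : measurable_fun setT (fun x => f (linmap b 0 d c x)).
  exact: (measurableT_comp mf (measurable_linmap _ _ _ _)).
rewrite -[RHS](_ : \int[leb2]_x f (linmap b 0 d c x) = _)%E; last first.
  rewrite integral_linmap0//; first by rewrite !mul0r sub0r subr0 normrN.
  by rewrite mul0r subr0; move: D0; rewrite mul0r sub0r oppr_eq0.
rewrite -(integral_leb2_swap mfl)//; apply: eq_integral => x _.
by rewrite /linmap/= addrC [in X in (_, X)]addrC.
Qed.

Lemma integral_shift (z : plane R) (f : plane R -> \bar R) :
  measurable_fun setT f -> (forall x, 0 <= f x)%E ->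
  (\int[leb2]_x f (x + z)%R = \int[leb2]_x f x)%E.
Proof.
move=> mf f0; rewrite (integral_leb2E mf f0).
have mfs : measurable_fun setT (fun x : plane R => f (x + z)%R).
  by apply: (measurableT_comp mf); measurability.
rewrite (integral_leb2E mfs (fun=> f0 _)).
transitivity (\int[leb]_x \int[leb]_y f (x + z.1, y)%R)%E.
  apply: eq_integral => x _.
  transitivity (\int[leb]_y f (x + z.1, 1 * y + z.2)%R)%E.
    by apply: eq_integral => y _; rewrite mul1r.
  rewrite (@integral_affine R 1 z.2 (fun y => f (x + z.1, y)%R))// ?oner_eq0//.
    by rewrite normr1 invr1 mul1e.
  by apply: (measurableT_comp mf); measurability.
transitivity (\int[leb]_x (fun x => \int[leb]_y f (x, y)) (1 * x + z.1)%R)%E.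
  by apply: eq_integral => x _; rewrite mul1r.
rewrite (@integral_affine R 1 z.1 (fun x => \int[leb]_y f (x, y))%E)// ?oner_eq0//.
- by rewrite normr1 invr1 mul1e.
- exact: (@measurable_fun_fubini_tonelli_F _ _ _ _ R (@lebesgue_measure R) _ mf).
- by move=> x; exact: integral_ge0.
Qed.

End plane_measure.

Lemma measurable_integral d1 d2 (T1 : measurableType d1)
    (T2 : measurableType d2) (R : realType)
    (m2 : {measure set T2 -> \bar R}) (f : T1 -> T2 -> \bar R) :
  sigma_finite setT m2 ->
  measurable_fun setT (fun p : T1 * T2 => f p.1 p.2) ->
  (forall x y, 0 <= f x y)%E ->
  measurable_fun setT (fun x => \int[m2]_y f x y)%E.
Proof.
move=> s2 mf f0; have := @measurable_fun_fubini_tonelli_F _ _ _ _ R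
  (sigma_finite_alias s2) _ mf.
by apply => p; exact: f0.
Qed.

(** * Conformal maps, pairs of vertices, and the mass of the shape kernel *)

Section conformal.
Context {R : realType}.

(** Multiplication by the complex number [a + i b]. Every vertex of a rectangle has the form
    [conf a b x + z], so one substitution serves all pairs of vertices. *)
Definition conf (a b : R) (x : plane R) : plane R :=
  (a * x.1 - b * x.2, b * x.1 + a * x.2).

Lemma conf_linmap (a b : R) : conf a b = linmap a (- b) b a.
Proof. by apply/funext => x; rewrite /conf /linmap mulNr. Qed.

Lemma confB (a b a' b' : R) (x : plane R) :
  conf a' b' x - conf a b x = conf (a' - a) (b' - b) x.
Proof.
by rewrite /conf; congr (_, _); rewrite /=; ring.
Qed.

Lemma measurable_conf (d : measure_display) (T : measurableType d)
    (a b : T -> R) (x : T -> plane R) :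
  measurable_fun setT a -> measurable_fun setT b -> measurable_fun setT x ->
  measurable_fun setT (fun t => conf (a t) (b t) (x t)).
Proof. by move=> ma mb mx; rewrite /conf; measurability. Qed.

Lemma measurable_addV (d : measure_display) (T : measurableType d)
    (x y : T -> plane R) : measurable_fun setT x -> measurable_fun setT y ->
  measurable_fun setT (fun t => x t + y t : plane R).
Proof.
move=> mx my; rewrite (_ : (fun t => _) = fun t => ((x t).1 + (y t).1, (x t).2 + (y t).2))//.
measurability.
Qed.

Lemma integral_conf (a b : R) (z : plane R) (f : plane R -> \bar R) :
  a ^+ 2 + b ^+ 2 != 0 ->
  measurable_fun setT f -> (forall x, 0 <= f x)%E ->
  (\int[leb2]_x f (conf a b x + z)%R =
   (a ^+ 2 + b ^+ 2)^-1%:E * \int[leb2]_x f x)%E.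
Proof.
move=> D0 mf f0; rewrite conf_linmap.
rewrite (@integral_linmap R _ _ _ _ (fun x => f (x + z)%R))//.
- rewrite integral_shift//; congr (_^-1%:E * _)%E.
  rewrite (_ : _ - _ = a ^+ 2 + b ^+ 2); last by ring.
  by rewrite ger0_norm// addr_ge0// sqr_ge0.
- by rewrite (_ : _ - _ = a ^+ 2 + b ^+ 2); last by ring.
- by apply: (measurableT_comp mf); apply: measurable_addV; measurability.
Qed.

(** For fixed [x], translating [z] by the first vertex leaves only the difference of the two
    vertices, which is a conformal map of [x]; its Jacobian is the squared modulus of the
    multiplier. *)
Lemma integral_pair (a b a' b' : R) (H : plane R * plane R -> \bar R) :
  (a' - a) ^+ 2 + (b' - b) ^+ 2 != 0 ->
  measurable_fun setT H -> (forall x, 0 <= H x)%E ->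
  (\int[leb2]_z \int[leb2]_x H (conf a b x + z, conf a' b' x + z)%R =
   ((a' - a) ^+ 2 + (b' - b) ^+ 2)^-1%:E *
   \int[leb2]_z \int[leb2]_x H (z, x))%E.
Proof.
move=> D0 mH H0.
rewrite (tonelli (f := fun z x : plane R => H (conf a b x + z, conf a' b' x + z)%R)
  sigma_finite_leb2 sigma_finite_leb2)//; last first.
  apply: (measurableT_comp mH); apply: measurable_fun_pair;
  apply: measurable_addV; measurability; apply: measurable_conf; measurability.
transitivity (\int[leb2]_x \int[leb2]_z
    H (z, conf (a' - a) (b' - b) x + z)%R)%E.
  apply: eq_integral => x _.
  rewrite -(@integral_shift R (conf a b x)
    (fun z : plane R => H (z, conf (a' - a) (b' - b) x + z)%R))//.
    apply: eq_integral => z _; congr (H (_, _)); first by rewrite addrC.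
    by rewrite -confB [z + _]addrC addrA subrK.
  apply: (measurableT_comp mH); apply: measurable_fun_pair => //.
  by apply: measurable_addV; measurability.
rewrite -(tonelli (f := fun z x : plane R => H (z, conf (a' - a) (b' - b) x + z)%R)
  sigma_finite_leb2 sigma_finite_leb2)//; last first.
  apply: (measurableT_comp mH); apply: measurable_fun_pair => //.
  by apply: measurable_addV; measurability; apply: measurable_conf; measurability.
rewrite -ge0_integralZl//; first last.
- by rewrite lee_fin invr_ge0 addr_ge0// sqr_ge0.
- by move=> z _; exact: integral_ge0.
- apply: (measurable_integral (f := fun z x => H (z, x)) sigma_finite_leb2) => //.
  by apply: (measurableT_comp mH); measurability.
apply: eq_integral => z _.
rewrite (@integral_conf _ _ z (fun y => H (z, y)))//.
by apply: (measurableT_comp mH); measurability.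
Qed.

Lemma integral_prod2 (F G : plane R -> \bar R) :
  measurable_fun setT F -> measurable_fun setT G ->
  (forall x, 0 <= F x)%E -> (forall x, 0 <= G x)%E ->
  (\int[leb2]_z \int[leb2]_x (F z * G x) =
   \int[leb2]_z F z * \int[leb2]_x G x)%E.
Proof.
move=> mF mG F0 G0.
under eq_integral => z _ do rewrite ge0_integralZl//.
by rewrite ge0_integralZr//; exact: integral_ge0.
Qed.

Definition kern (l : R) : R := (1 + l ^+ 2)^-1.

Lemma kern_gt0 l : 0 < kern l.
Proof. by rewrite invr_gt0 ltr_wpDr// sqr_ge0. Qed.

Lemma kern_le1 l : kern l <= 1.
Proof. by rewrite invf_le1 ?ltr_wpDr ?sqr_ge0// lerDl sqr_ge0. Qed.

Lemma continuous_kern : continuous kern.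
Proof.
move=> x; apply: cvgV; first by rewrite gt_eqF// ltr_wpDr// sqr_ge0.
by apply: cvgD; [exact: cvg_cst|exact: exprn_continuous].
Qed.

Lemma measurable_kern : measurable_fun setT (kern : measurableTypeR R -> R).
Proof. by apply: continuous_measurable_fun; exact: continuous_kern. Qed.

Lemma integral_kern_ge (s : R) : 
  (\int[leb]_(l in `[s, +oo[) (kern l)%:E = (pi / 2 - atan s)%:E)%E.
Proof.
rewrite (@ge0_continuous_FTC2y _ kern (@atan R) s (pi / 2))//.
- by move=> x _; exact/ltW/kern_gt0.
- by apply: continuous_subspaceT; exact: continuous_kern.
- exact: cvgy_atan.
- by apply: cvg_at_right_filter; exact: continuous_atan.
- by move=> x _; rewrite derive1_atan.
Qed.

Lemma integral_kern_le (s : R) : 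
  (\int[leb]_(l in `]-oo, (- s)%R]) (kern l)%:E = (pi / 2 - atan s)%:E)%E.
Proof.
rewrite (@ge0_integration_by_substitutionNy R kern s).
- by under eq_integral do rewrite /= /kern sqrrN -/(kern _); exact: integral_kern_ge.
- by apply: continuous_subspaceT; exact: continuous_kern.
- by move=> x _; exact/ltW/kern_gt0.
Qed.

Lemma integral_kernT : (\int[leb]_l (kern l)%:E = (pi : R)%:E)%E.
Proof.
rewrite /leb ge0_symfun_integralT.
- rewrite (_ : [set x | _] = `[0, +oo[%classic); last first.
    by apply/seteqP; split => x/=; rewrite in_itv/= andbT.
  by rewrite integral_kern_ge atan0 subr0 -EFinM; congr EFin; field.
- by move=> x; exact/ltW/kern_gt0.
- exact: continuous_kern.
- by move=> x /=; rewrite /kern sqrrN.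
Qed.

Lemma kern_tail (e : R) : 0 < e -> exists2 s, 0 < s &
  (\int[leb]_(l in [set l : measurableTypeR R | (s <= `|l|)%R]) (kern l)%:E <= e%:E)%E.
Proof.
move=> e0.
have /cvgrPdist_lt /(_ (e / 2)) : atan x @[x --> +oo] --> (pi / 2 : R) by exact: cvgy_atan.
rewrite divr_gt0// => /(_ isT) [M [Mr HM]].
pose s := `|M| + 1.
have s0 : 0 < s by rewrite ltr_wpDl.
have {HM} Hs : pi / 2 - atan s < e / 2.
  apply: le_lt_trans (HM s _); first exact: ler_norm.
  by rewrite (le_lt_trans (ler_norm M))// ltrDl.
exists s => //.
rewrite (_ : [set l | _] = `]-oo, - s] `|` `[s, +oo[); last first.
  apply/seteqP; split => x /=; rewrite !in_itv/= andbT ler_normr.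
    by move=> /orP[->|h]; [right|left; rewrite lerNr].
  by move=> [h|->//]; rewrite lerNr h orbT.
rewrite ge0_integral_setU//=; first last.
- apply/disj_setPS => x /= []; rewrite !in_itv/= andbT => h1 h2.
  by have := le_trans h2 h1; rewrite leNgt => /negP; apply; lra.
- by move=> x _; rewrite lee_fin; exact/ltW/kern_gt0.
- by apply/measurable_EFinP; apply: measurable_funTS; exact: measurable_kern.
- by rewrite integral_kern_ge integral_kern_le -EFinD lee_fin; lra.
Qed.

Lemma kern_near0 (s : R) : 0 <= s -> 
  (\int[leb]_(l in [set l : measurableTypeR R | (`|l| <= s)%R]) (kern l)%:E <= (2 * s)%:E)%E.
Proof.
move=> s0; rewrite (_ : [set l | _] = `[- s, s]%classic); last first.
  by apply/seteqP; split => x /=; rewrite in_itv/= ler_norml.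
apply: (@le_trans _ _ (\int[leb]_(l in `[(- s)%R, s]) (cst 1%:E l))%E).
  apply: ge0_le_integral => //.
  - by move=> x _; rewrite lee_fin; exact/ltW/kern_gt0.
  - by apply/measurable_EFinP; apply: measurable_funTS; exact: measurable_kern.
  - by move=> x _; rewrite lee_fin; exact: kern_le1.
rewrite integral_cst// mul1e.
have -> : leb `[- s, s]%classic = @lebesgue_measure R `[- s, s]%classic by [].
rewrite lebesgue_measure_itv/= lte_fin.
by case: ifPn => _; rewrite -?EFinD lee_fin; lra.
Qed.

End conformal.

(** * The rectangle form on nonnegative functions *)

Ltac nonneg :=
  repeat first
  [ assumption
  | by apply: ltW
  | exact: ler01
  | exact: ler0n
  | exact: sqr_ge0
  | exact: expR_ge0
  | exact: pi_ge0
  | apply: addr_ge0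
  | apply: divr_ge0
  | apply: mulr_ge0
  | rewrite invr_ge0
  | apply: exprn_ge0
  | by [] ].

Lemma ge0_fatou_le d (T : measurableType d) (R : realType)
    (mu : {measure set T -> \bar R}) (f_ : nat -> T -> R) (f : T -> R)
    (M : \bar R) :
  (forall n, measurable_fun setT (f_ n)) -> (forall n x, 0 <= f_ n x) ->
  (forall x, f_ ^~ x @ \oo --> f x) ->
  (forall n, \int[mu]_x (f_ n x)%:E <= M)%E ->
  (\int[mu]_x (f x)%:E <= M)%E.
Proof.
move=> mf f0 cf fM.
have cE x : (fun n => (f_ n x)%:E) @ \oo --> (f x)%:E.
  by apply: cvg_EFin; [exact: nearW|exact: cf].
rewrite (eq_integral (fun x => limn_einf (fun n => (f_ n x)%:E))); last first.
  by move=> x _; have [-> _] := cvg_limn_einf_sup (cE x).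
apply: (le_trans (fatou mu measurableT _ _)).
- by move=> n; apply/measurable_EFinP.
- by move=> n x _; rewrite lee_fin.
rewrite limn_einf_lim; apply: lime_le; first exact: is_cvg_einfs.
apply: nearW => n; apply: le_trans (fM n).
by apply: ereal_inf_lbound; exists n => /=.
Qed.

(** * Euclidean norm and distances in a rectangle *)

Section euclid.
Context {R : realType}.
Implicit Types x y z : plane R.

Lemma enorm_ge0 x : 0 <= enorm x. Proof. exact: sqrtr_ge0. Qed.

Lemma enorm_sq x : enorm x ^+ 2 = x.1 ^+ 2 + x.2 ^+ 2.
Proof. by rewrite sqr_sqrtr// addr_ge0// sqr_ge0. Qed.

Lemma enormN x : enorm (- x) = enorm x.
Proof. by rewrite /enorm /= !sqrrN. Qed.

Lemma edot_le x y : edot x y <= enorm x * enorm y.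
Proof.
have [|xy0] := leP (edot x y) 0.
  by move=> /le_trans; apply; rewrite mulr_ge0// enorm_ge0.
rewrite -ler_sqr ?nnegrE ?mulr_ge0 ?enorm_ge0 ?(ltW xy0)//.
rewrite exprMn !enorm_sq /edot -subr_ge0.
rewrite (_ : _ - _ = (x.1 * y.2 - x.2 * y.1) ^+ 2); last by ring.
exact: sqr_ge0.
Qed.

Lemma enorm_triangle x y : enorm (x + y) <= enorm x + enorm y.
Proof.
rewrite -ler_sqr ?nnegrE ?addr_ge0 ?enorm_ge0// sqrrD !enorm_sq /=.
have := edot_le x y; rewrite /edot => h.
rewrite -subr_ge0; move: h; rewrite -subr_ge0 => h.
rewrite (_ : _ - _ = 2 * (enorm x * enorm y - (x.1 * y.1 + x.2 * y.2))).
  by rewrite mulr_ge0.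
by ring.
Qed.

Lemma measurable_enorm : measurable_fun setT (enorm : plane R -> R).
Proof.
apply: (@measurableT_comp _ _ _ _ _ _ (@Num.sqrt R)).
  by apply: continuous_measurable_fun; exact: sqrt_continuous.
by measurability.
Qed.

Lemma enorm_conf a b x : enorm (conf a b x) = Num.sqrt (a ^+ 2 + b ^+ 2) * enorm x.
Proof.
rewrite /enorm -sqrtrM ?addr_ge0 ?sqr_ge0//; congr Num.sqrt.
by rewrite /conf/=; ring.
Qed.

Lemma enorm_smul_perp (l : R) x : enorm (smul l (perp x)) = `|l| * enorm x.
Proof.
rewrite (_ : smul l (perp x) = conf 0 l x); last first.
  by rewrite /smul /perp /conf /=; congr (_, _); ring.
by rewrite enorm_conf expr0n add0r sqrtr_sqr.
Qed.

Lemma rectangle_enorm (l : R) (x z : plane R) :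
  enorm (x + z) ^+ 2 + enorm (smul l (perp x) + z) ^+ 2 =
  enorm (x + smul l (perp x) + z) ^+ 2 + enorm z ^+ 2.
Proof. by rewrite !enorm_sq /= ; ring. Qed.

(** This inequality distributes an exponential weight at the vertex [d] over [a] and [b]; the vertex
    [c] never carries any weight. *)
Lemma enorm_rect_le (l : R) (x z : plane R) :
  enorm z <= enorm (x + z) + enorm (smul l (perp x) + z).
Proof.
have h := rectangle_enorm l x z.
rewrite -ler_sqr ?nnegrE ?addr_ge0 ?enorm_ge0// sqrrD.
have h1 : 0 <= enorm (x + smul l (perp x) + z) ^+ 2 by exact: sqr_ge0.
have : 0 <= enorm (x + z) * enorm (smul l (perp x) + z).
  by rewrite mulr_ge0// enorm_ge0.
by lra.
Qed.

End euclid.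

(** * Integrals over all rectangles and their bound by L^2 norms *)

Section form.
Context {R : realType}.
Local Notation mR := (measurableTypeR R).
Implicit Types f : plane R -> R.

(** The factor [chi] weighs the shapes: it is constant 1 for the whole form and an indicator
    function for the parts of extreme shape in the bootstrap. *)
Definition quad (chi : mR -> R) f1 f2 f3 f4 (l : mR) (z x : plane R) : R :=
  chi l * (f1 (x + z) * f2 (smul l (perp x) + z) *
           f3 (x + smul l (perp x) + z) * f4 z).

Definition int3 (g : mR -> plane R -> plane R -> R) : \bar R :=
  (\int[leb]_l \int[leb2]_z \int[leb2]_x (g l z x)%:E)%E.

Definition meas3 (g : mR -> plane R -> plane R -> R) :=
  measurable_fun setT (fun p : (mR * plane R) * plane R => g p.1.1 p.1.2 p.2).

Lemma measurable_rectB : measurable_fun setT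
  (fun p : (mR * plane R) * plane R => smul p.1.1 (perp p.2) + p.1.2 : plane R).
Proof. by apply: measurable_addV; rewrite /smul /perp /=; measurability. Qed.

Lemma measurable_rectC : measurable_fun setT
  (fun p : (mR * plane R) * plane R => p.2 + smul p.1.1 (perp p.2) + p.1.2 : plane R).
Proof.
by apply: measurable_addV; [apply: measurable_addV|]; rewrite /smul /perp /=; measurability.
Qed.

Lemma measurable_rectA : measurable_fun setT
  (fun p : (mR * plane R) * plane R => p.2 + p.1.2 : plane R).
Proof. by apply: measurable_addV; measurability. Qed.

Lemma measurable_quad (chi : mR -> R) f1 f2 f3 f4 : measurable_fun setT chi ->
  measurable_fun setT f1 -> measurable_fun setT f2 ->
  measurable_fun setT f3 -> measurable_fun setT f4 ->
  meas3 (quad chi f1 f2 f3 f4).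
Proof.
move=> mchi m1 m2 m3 m4; rewrite /meas3 /quad.
have h1 := measurableT_comp m1 measurable_rectA.
have h2 := measurableT_comp m2 measurable_rectB.
have h3 := measurableT_comp m3 measurable_rectC.
apply: measurable_funM; first by measurability.
apply: measurable_funM; last by measurability.
apply: measurable_funM; last exact: h3.
by apply: measurable_funM; [exact: h1|exact: h2].
Qed.

Lemma quad_ge0 (chi : mR -> R) f1 f2 f3 f4 l z x : (forall l, 0 <= chi l) ->
  (forall x, 0 <= f1 x) -> (forall x, 0 <= f2 x) ->
  (forall x, 0 <= f3 x) -> (forall x, 0 <= f4 x) ->
  0 <= quad chi f1 f2 f3 f4 l z x.
Proof. by move=> *; rewrite /quad !mulr_ge0. Qed.

Lemma measurable_int_x g : meas3 g -> (forall l z x, 0 <= g l z x) ->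
  measurable_fun setT (fun p : mR * plane R => \int[leb2]_x (g p.1 p.2 x)%:E)%E.
Proof.
move=> mg g0; apply: (measurable_integral (f := fun (p : mR * plane R) x => (g p.1 p.2 x)%:E)).
- exact: sigma_finite_leb2.
- by apply/measurable_EFinP; exact: mg.
- by move=> *; rewrite lee_fin.
Qed.

Lemma measurable_int_zx g : meas3 g -> (forall l z x, 0 <= g l z x) ->
  measurable_fun setT (fun l : mR => \int[leb2]_z \int[leb2]_x (g l z x)%:E)%E.
Proof.
move=> mg g0; apply: (measurable_integral (f := fun (l : mR) z => \int[leb2]_x (g l z x)%:E)%E).
- exact: sigma_finite_leb2.
- exact: measurable_int_x.
- by move=> l z; apply: integral_ge0 => x _; rewrite lee_fin.
Qed.

Lemma meas3_slice_l g l : meas3 g ->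
  measurable_fun setT (fun p : plane R * plane R => g l p.1 p.2).
Proof.
move=> mg.
have h : measurable_fun setT (fun p : plane R * plane R => ((l : mR, p.1), p.2)).
  by measurability.
exact: (measurableT_comp mg h).
Qed.

Lemma meas3_slice g l z : meas3 g -> measurable_fun setT (g l z).
Proof.
move=> mg; have h : measurable_fun setT (fun x : plane R => ((l : mR, z), x)).
  by measurability.
exact: (measurableT_comp mg h).
Qed.

Lemma le_int3 g1 g2 : meas3 g1 -> meas3 g2 ->
  (forall l z x, 0 <= g1 l z x) -> (forall l z x, g1 l z x <= g2 l z x) ->
  (int3 g1 <= int3 g2)%E.
Proof.
move=> m1 m2 g10 g12.
have g20 l z x : 0 <= g2 l z x by exact: le_trans (g12 _ _ _).
apply: ge0_le_integral => //.
- by move=> l _; do 2!apply: integral_ge0 => ? _; rewrite lee_fin.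
- exact: measurable_int_zx.
- exact: measurable_int_zx.
move=> l _; apply: ge0_le_integral => //.
- by move=> z _; apply: integral_ge0 => ? _; rewrite lee_fin.
- exact: (measurable_fun_pair2 l (measurable_int_x m1 g10)).
- exact: (measurable_fun_pair2 l (measurable_int_x m2 g20)).
move=> z _; apply: ge0_le_integral => //.
- by move=> x _; rewrite lee_fin.
- by apply/measurable_EFinP; exact: meas3_slice.
- by apply/measurable_EFinP; exact: meas3_slice.
- by move=> x _; rewrite lee_fin.
Qed.

Lemma int3D g1 g2 : meas3 g1 -> meas3 g2 ->
  (forall l z x, 0 <= g1 l z x) -> (forall l z x, 0 <= g2 l z x) ->
  int3 (fun l z x => g1 l z x + g2 l z x) = (int3 g1 + int3 g2)%E.
Proof.
move=> m1 m2 g10 g20; rewrite /int3 -ge0_integralD//; first last.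
- exact: measurable_int_zx.
- by move=> l _; do 2!apply: integral_ge0 => ? _; rewrite lee_fin.
- exact: measurable_int_zx.
- by move=> l _; do 2!apply: integral_ge0 => ? _; rewrite lee_fin.
apply: eq_integral => l _; rewrite -ge0_integralD//; first last.
- exact: (measurable_fun_pair2 l (measurable_int_x m2 g20)).
- by move=> z _; apply: integral_ge0 => ? _; rewrite lee_fin.
- exact: (measurable_fun_pair2 l (measurable_int_x m1 g10)).
- by move=> z _; apply: integral_ge0 => ? _; rewrite lee_fin.
apply: eq_integral => z _; rewrite -ge0_integralD//.
- by move=> x _; rewrite lee_fin.
- by apply/measurable_EFinP; exact: meas3_slice.
- by move=> x _; rewrite lee_fin.
- by apply/measurable_EFinP; exact: meas3_slice.
Qed.

Lemma measD3 g1 g2 : meas3 g1 -> meas3 g2 ->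
  meas3 (fun l z x => g1 l z x + g2 l z x).
Proof. by move=> m1 m2; apply: measurable_funD. Qed.

Lemma rect_conf (l : R) (x z : plane R) :
  [/\ x + z = conf 1 0 x + z, smul l (perp x) + z = conf 0 l x + z,
      x + smul l (perp x) + z = conf 1 l x + z & z = conf 0 0 x + z].
Proof.
have e1 : x = conf 1 0 x by case: x => a b; rewrite /conf /=; congr (_, _); ring.
have e2 : smul l (perp x) = conf 0 l x.
  by rewrite /smul /perp /conf /=; congr (_, _); ring.
have e4 : conf 0 0 x = 0 by rewrite /conf; congr (_, _) => /=; ring.
have e3 : x + smul l (perp x) = conf 1 l x.
  by case: x {e1 e2 e4} => a b; rewrite /smul /perp /conf; congr (_, _) => /=; ring.
by split; rewrite -?e1 -?e2 -?e3 ?e4 ?add0r.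
Qed.

(* Cauchy-Schwarz pairs the two diagonals of the rectangle: both
   [(x, z) |-> (x + z, l x^perp + z)] and [(x, z) |-> (x + l x^perp + z, z)]
   have Jacobian [1 + l ^ 2]. *)
Lemma quad_slice_le (chi : mR -> R) f1 f2 f3 f4 (n1 n2 n3 n4 : R) l :
  0 < n1 -> 0 < n2 -> 0 < n3 -> 0 < n4 -> 0 <= chi l ->
  measurable_fun setT chi -> measurable_fun setT f1 -> measurable_fun setT f2 ->
  measurable_fun setT f3 -> measurable_fun setT f4 ->
  (forall x, 0 <= f1 x) -> (forall x, 0 <= f2 x) ->
  (forall x, 0 <= f3 x) -> (forall x, 0 <= f4 x) ->
  (\int[leb2]_x (f1 x ^+ 2)%:E <= (n1 ^+ 2)%:E)%E ->
  (\int[leb2]_x (f2 x ^+ 2)%:E <= (n2 ^+ 2)%:E)%E ->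
  (\int[leb2]_x (f3 x ^+ 2)%:E <= (n3 ^+ 2)%:E)%E ->
  (\int[leb2]_x (f4 x ^+ 2)%:E <= (n4 ^+ 2)%:E)%E ->
  (\int[leb2]_z \int[leb2]_x (quad chi f1 f2 f3 f4 l z x)%:E <=
   (chi l * kern l * (n1 * n2 * n3 * n4))%:E)%E.
Proof.
move=> n10 n20 n30 n40 chi0 mchi m1 m2 m3 m4 f10 f20 f30 f40 N1 N2 N3 N4.
(* Young's inequality [AB CD <= (t (AB)^2 + (CD)^2 / t) / 2] replaces Cauchy-Schwarz. This value of
   [t] gives both halves the same bound, so no loss occurs. *)
pose t := n3 * n4 / (n1 * n2).
have t0 : 0 < t by rewrite divr_gt0// mulr_gt0.
have t1 := ltW t0.
pose p (z x : plane R) : \bar R :=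
  ((chi l * t / 2)%:E * ((f1 (conf 1 0 x + z) ^+ 2)%:E * (f2 (conf 0 l x + z) ^+ 2)%:E))%E.
pose q (z x : plane R) : \bar R :=
  ((chi l / t / 2)%:E * ((f3 (conf 1 l x + z) ^+ 2)%:E * (f4 (conf 0 0 x + z) ^+ 2)%:E))%E.
have msq f a b : measurable_fun setT f -> measurable_fun setT
    (fun zx : plane R * plane R => (f (conf a b zx.2 + zx.1) ^+ 2)%:E).
  move=> mf; apply/measurable_EFinP; apply: measurable_funX; apply: (measurableT_comp mf).
  by apply: measurable_addV; measurability; apply: measurable_conf; measurability.
have mp : measurable_fun setT (fun zx : plane R * plane R => p zx.1 zx.2).
  by apply: measurable_funeM; apply: emeasurable_funM; exact: msq.
have mq : measurable_fun setT (fun zx : plane R * plane R => q zx.1 zx.2).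
  by apply: measurable_funeM; apply: emeasurable_funM; exact: msq.
have p0 z x : (0 <= p z x)%E.
  rewrite /p -!EFinM lee_fin; apply: mulr_ge0; last by rewrite mulr_ge0// sqr_ge0.
  by rewrite divr_ge0// mulr_ge0.
have q0 z x : (0 <= q z x)%E.
  rewrite /q -!EFinM lee_fin; apply: mulr_ge0; last by rewrite mulr_ge0// sqr_ge0.
  by rewrite divr_ge0// divr_ge0.
have ipair (c a b a' b' na nb : R) (f g : plane R -> R) : 0 <= c ->
   (a' - a) ^+ 2 + (b' - b) ^+ 2 = 1 + l ^+ 2 ->
   measurable_fun setT f -> measurable_fun setT g ->
   (\int[leb2]_x (f x ^+ 2)%:E <= (na ^+ 2)%:E)%E ->
   (\int[leb2]_x (g x ^+ 2)%:E <= (nb ^+ 2)%:E)%E ->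
   (\int[leb2]_z \int[leb2]_x (c%:E *
     ((f (conf a b x + z)%R ^+ 2)%:E * (g (conf a' b' x + z)%R ^+ 2)%:E)) <=
    (c * kern l * (na ^+ 2 * nb ^+ 2))%:E)%E.
  move=> c0 E mf mg fa gb.
  have D0 : (a' - a) ^+ 2 + (b' - b) ^+ 2 != 0.
    by rewrite E gt_eqF// ltr_wpDr// sqr_ge0.
  have mf2 : measurable_fun setT (fun x => (f x ^+ 2)%:E).
    by apply/measurable_EFinP; apply: measurable_funX.
  have mg2 : measurable_fun setT (fun x => (g x ^+ 2)%:E).
    by apply/measurable_EFinP; apply: measurable_funX.
  rewrite (@integral_pair _ a b a' b' (fun p => c%:E * ((f p.1 ^+ 2)%:E * (g p.2 ^+ 2)%:E))%E)//=.
  - rewrite E -/(kern l).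
    under eq_integral => z _ do under eq_integral => x _ do rewrite muleA.
    rewrite (@integral_prod2 _ (fun z => c%:E * (f z ^+ 2)%:E)%E)//.
    + rewrite ge0_integralZl//; last by move=> *; rewrite lee_fin sqr_ge0.
      have h : (\int[leb2]_z (f z ^+ 2)%:E * \int[leb2]_x (g x ^+ 2)%:E <=
          (na ^+ 2)%:E * (nb ^+ 2)%:E)%E.
        by apply: lee_pmul => //; apply: integral_ge0 => x _; rewrite lee_fin sqr_ge0.
      rewrite -(muleA c%:E) (muleA (kern l)%:E) -EFinM [leRHS]EFinM [X in (_ <= _ * X)%E]EFinM [kern l * c]mulrC.
      by apply: lee_wpmul2l => //; rewrite lee_fin mulr_ge0// ltW// kern_gt0.
    + exact: measurable_funeM.
    + by move=> x; rewrite -EFinM lee_fin mulr_ge0// sqr_ge0.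
    + by move=> x; rewrite lee_fin sqr_ge0.
  - apply: measurable_funeM; apply: emeasurable_funM.
      by apply: (measurableT_comp mf2); measurability.
    by apply: (measurableT_comp mg2); measurability.
  - by move=> x; rewrite -!EFinM lee_fin; apply: mulr_ge0 => //; rewrite mulr_ge0// sqr_ge0.
have mQ := measurable_quad mchi m1 m2 m3 m4.
have mQl : measurable_fun setT (fun zx : plane R * plane R =>
    (quad chi f1 f2 f3 f4 l zx.1 zx.2)%:E).
  by apply/measurable_EFinP; exact: meas3_slice_l.
have Q0 z x : (0 <= (quad chi f1 f2 f3 f4 l z x)%:E)%E.
  by rewrite lee_fin /quad !mulr_ge0.
have mpz z : measurable_fun setT (p z) by exact: (measurable_fun_pair2 z mp).
have mqz z : measurable_fun setT (q z) by exact: (measurable_fun_pair2 z mq).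
apply: (@le_trans _ _ (\int[leb2]_z \int[leb2]_x (p z x + q z x))%E).
  apply: ge0_le_integral => //.
  - by move=> z _; apply: integral_ge0.
  - exact: (measurable_integral sigma_finite_leb2 mQl).
  - apply: (measurable_integral (f := fun z x => p z x + q z x)%E sigma_finite_leb2).
      exact: emeasurable_funD.
    by move=> z x; rewrite adde_ge0.
  move=> z _; apply: ge0_le_integral => //.
  - exact: (measurable_fun_pair2 z mQl).
  - exact: emeasurable_funD.
  move=> x _; rewrite /p /q -!EFinM -EFinD lee_fin /quad.
  have [e1 e2 e3 e4] := rect_conf l x z; rewrite -e1 -e2 -e3 -e4.
  set A := f1 _; set B := f2 _; set C := f3 _; set D := f4 _.
  rewrite -subr_ge0.
  rewrite (_ : _ - _ = chi l / t / 2 * (t * (A * B) - C * D) ^+ 2).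
    by nonneg.
  by field; rewrite gt_eqF.
under eq_integral => z _ do rewrite ge0_integralD//.
rewrite ge0_integralD//; first last.
- exact: (measurable_integral sigma_finite_leb2 mq).
- by move=> z _; apply: integral_ge0.
- exact: (measurable_integral sigma_finite_leb2 mp).
- by move=> z _; apply: integral_ge0.
apply: (@le_trans _ _ ((chi l * t / 2 * kern l * (n1 ^+ 2 * n2 ^+ 2))%:E +
    (chi l / t / 2 * kern l * (n3 ^+ 2 * n4 ^+ 2))%:E)%E).
  apply: leeD; apply: ipair => //; try ring; by nonneg.
rewrite -EFinD lee_fin le_eqVlt; apply/orP; left; apply/eqP; rewrite /t; field.
by rewrite !gt_eqF.
Qed.

Lemma int3_quad_le (chi : mR -> R) f1 f2 f3 f4 (k n1 n2 n3 n4 : R) :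
  0 < n1 -> 0 < n2 -> 0 < n3 -> 0 < n4 -> (forall l, 0 <= chi l) ->
  measurable_fun setT chi -> measurable_fun setT f1 -> measurable_fun setT f2 ->
  measurable_fun setT f3 -> measurable_fun setT f4 ->
  (forall x, 0 <= f1 x) -> (forall x, 0 <= f2 x) ->
  (forall x, 0 <= f3 x) -> (forall x, 0 <= f4 x) ->
  (\int[leb2]_x (f1 x ^+ 2)%:E <= (n1 ^+ 2)%:E)%E ->
  (\int[leb2]_x (f2 x ^+ 2)%:E <= (n2 ^+ 2)%:E)%E ->
  (\int[leb2]_x (f3 x ^+ 2)%:E <= (n3 ^+ 2)%:E)%E ->
  (\int[leb2]_x (f4 x ^+ 2)%:E <= (n4 ^+ 2)%:E)%E ->
  (\int[leb]_l (chi l * kern l)%:E <= k%:E)%E ->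
  (int3 (quad chi f1 f2 f3 f4) <= (k * (n1 * n2 * n3 * n4))%:E)%E.
Proof.
move=> n10 n20 n30 n40 chi0 mchi m1 m2 m3 m4 f10 f20 f30 f40 N1 N2 N3 N4 hk.
have N0 : 0 <= n1 * n2 * n3 * n4 by rewrite !mulr_ge0// ltW.
have mck : measurable_fun setT (fun l : mR => (chi l * kern l)%:E).
  by apply/measurable_EFinP; apply: measurable_funM => //; exact: measurable_kern.
apply: (@le_trans _ _ (\int[leb]_l ((chi l * kern l)%:E * (n1 * n2 * n3 * n4)%:E))%E).
  apply: ge0_le_integral => //.
  - by move=> l _; do 2!apply: integral_ge0 => ? _; rewrite lee_fin quad_ge0.
  - apply: measurable_int_zx; first exact: measurable_quad.
    by move=> *; exact: quad_ge0.
  - by apply: emeasurable_funM.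
  by move=> l _; exact: quad_slice_le.
rewrite ge0_integralZr//; last first.
  by move=> l _; rewrite lee_fin mulr_ge0// ltW// kern_gt0.
by rewrite [leRHS]EFinM lee_wpmul2r.
Qed.

End form.

(** * Exponential bootstrap *)

Lemma dominated_to0 d (T : measurableType d) (R : realType)
    (mu : {measure set T -> \bar R}) (f_ : nat -> T -> R) (g : T -> R) (e : R) :
  (forall n, measurable_fun setT (f_ n)) -> measurable_fun setT g ->
  (forall x, f_ ^~ x @ \oo --> 0) ->
  (forall n x, 0 <= f_ n x <= g x) -> (\int[mu]_x (g x)%:E < +oo)%E -> 0 < e ->
  \forall n \near \oo, (\int[mu]_x (f_ n x)%:E <= e%:E)%E.
Proof.
move=> mf mg f0 fg gi e0.
have g0 x : 0 <= g x by have /andP[h1 h2] := fg 0%N x; exact: le_trans h2.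
have iu2 : mu.-integrable setT (fun x => (g x)%:E).
  apply/integrableP; split; first by apply/measurable_EFinP.
  by under eq_integral do rewrite gee0_abs ?lee_fin//.
have /fine_cvgP[fH /cvgrPdist_le cH] : (\int[mu]_x (f_ n x)%:E)%E @[n --> \oo] --> 0%:E.
  have -> : 0%:E = (\int[mu]_x cst 0%:E x)%E by rewrite integral0.
  apply: (@dominated_cvg _ _ _ mu setT measurableT (fun n x => (f_ n x)%:E)
    (cst 0%:E) (fun x => (g x)%:E)) => //.
  - by move=> n; apply/measurable_EFinP.
  - by move=> x _; apply: cvg_EFin; [exact: nearW|exact: f0].
  - by move=> n x _; have /andP[h1 h2] := fg n x; rewrite gee0_abs lee_fin.
near=> n.
have hf : (\int[mu]_x (f_ n x)%:E)%E \is a fin_num by near: n.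
rewrite -(fineK hf) lee_fin.
have : `|0 - fine (\int[mu]_x (f_ n x)%:E)| <= e by near: n; exact: cH.
by rewrite sub0r normrN; apply: le_trans; exact: ler_norm.
Unshelve. all: by end_near. Qed.

(** * Consequences of having two vertices near the origin and [d] far from it *)

Section rectangle.
Context {R : realType}.
Variables (sigma m l : R) (x z : plane R).
Hypotheses (sigma0 : 0 < sigma) (m0 : 0 < m).
Local Notation a := (x + z).
Local Notation b := (smul l (perp x) + z).
Local Notation c := (x + smul l (perp x) + z).

Lemma rect_near_ab : enorm a < sigma -> enorm b < sigma ->
  enorm z < 3 * sigma.
Proof.
move=> na nb; rewrite ltNge; apply/negP => hz.
have := rectangle_enorm l x z.
have : enorm a ^+ 2 < sigma ^+ 2 by rewrite ltrXn2r ?nnegrE ?enorm_ge0// ltW.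
have : enorm b ^+ 2 < sigma ^+ 2 by rewrite ltrXn2r ?nnegrE ?enorm_ge0// ltW.
have : (3 * sigma) ^+ 2 <= enorm z ^+ 2.
  by rewrite lerXn2r ?nnegrE ?enorm_ge0 ?mulr_ge0 ?(ltW sigma0).
have := sqr_ge0 (enorm c); have := sqr_ge0 sigma.
by rewrite exprMn; lra.
Qed.

(** The side [c - a = l x^perp] has length at most [2 * sigma], while the side [a - d = x] has
    length at least [2 * sigma * m]. The quotient of the two lengths is [|l|]. *)
Lemma rect_near_ac : enorm a < sigma -> enorm c < sigma ->
  sigma + 2 * sigma * m <= enorm z -> `|l| <= m^-1.
Proof.
move=> na nc hz.
have hx : 2 * sigma * m <= enorm x.
  have := enorm_triangle a (- x); rewrite enormN [x + z]addrC addrK addrC; lra.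
have : enorm (smul l (perp x)) <= 2 * sigma.
  have := enorm_triangle c (- a); rewrite enormN.
  rewrite (_ : c - a = smul l (perp x)); last first.
    by rewrite [x + smul _ _]addrC -[_ + _ + z]addrA addrK.
  by lra.
rewrite enorm_smul_perp => hl.
rewrite -[leRHS]mul1r ler_pdivlMr// -(@ler_pM2r _ (2 * sigma)) ?mulr_gt0// mul1r.
by rewrite -mulrA [m * _]mulrC (le_trans _ hl)// ler_wpM2l.
Qed.

(** Here the roles of the sides are exchanged: [c - b = x] is short and [b - d = l x^perp] is
    long. *)
Lemma rect_near_bc : enorm b < sigma -> enorm c < sigma ->
  sigma + 2 * sigma * m <= enorm z -> m <= `|l|.
Proof.
move=> nb nc hz.
have : 2 * sigma * m <= enorm (smul l (perp x)).
  have := enorm_triangle b (- smul l (perp x)).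
  by rewrite enormN [smul _ _ + z]addrC addrK [z + _]addrC; lra.
have hx : enorm x <= 2 * sigma.
  have := enorm_triangle c (- b); rewrite enormN.
  by rewrite -[_ + _ + z]addrA addrK addrA; lra.
rewrite enorm_smul_perp => hl.
rewrite -(@ler_pM2r _ (2 * sigma)) ?mulr_gt0// [m * _]mulrC.
by apply: (le_trans hl); apply: ler_wpM2l.
Qed.

End rectangle.

(** * Truncated exponential weights and the induction on the truncation *)

Section bootstrap.
Context {R : realType}.
Local Notation mR := (measurableTypeR R).

Definition far (s : R) (x : plane R) : R := (s <= enorm x)%R%:R.
Definition near0 (s : R) (x : plane R) : R := (enorm x < s)%R%:R.

Lemma measurable_bool d (T : measurableType d) (b : T -> bool) :
  measurable_fun setT b -> measurable_fun setT (fun x => (b x)%:R : R).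
Proof.
move=> mb; rewrite (_ : (fun x => _) = (fun x => if b x then 1 else 0 : R)).
  exact: measurable_fun_ifT.
by apply/funext => x; case: (b x).
Qed.

Lemma measurable_far s : measurable_fun setT (far s).
Proof.
apply: measurable_bool; apply: measurable_fun_ler => //.
exact: measurable_enorm.
Qed.

Lemma measurable_near0 s : measurable_fun setT (near0 s).
Proof.
apply: measurable_bool; apply: measurable_fun_ltr => //.
exact: measurable_enorm.
Qed.

Lemma far01 s x : 0 <= far s x. Proof. exact: ler0n. Qed.

Lemma near01 s x : 0 <= near0 s x. Proof. exact: ler0n. Qed.

Lemma far_le1 s x : far s x <= 1. Proof. by rewrite /far lern1 leq_b1. Qed.

Lemma far_sq s x : far s x ^+ 2 = far s x.
Proof. by rewrite /far; case: (_ <= _)%R; rewrite ?expr1n ?expr0n. Qed.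

Lemma sq_tail (u : plane R -> R) (eta : R) : measurable_fun setT u ->
  (\int[leb2]_x (u x ^+ 2)%:E < +oo)%E -> 0 < eta ->
  exists2 s, 0 < s & (\int[leb2]_x ((u x * far s x) ^+ 2)%:E <= (eta ^+ 2)%:E)%E.
Proof.
move=> mu u2 eta0.
have e2 : 0 < eta ^+ 2 by rewrite exprn_gt0.
(* The radii are taken as [n.+1] so that the one obtained is positive. *)
have [] := @dominated_to0 _ _ R leb2 (fun n x => (u x * far n.+1%:R x) ^+ 2)
  (fun x => u x ^+ 2) (eta ^+ 2) _ _ _ _ u2 e2.
- move=> n; apply: measurable_funX; apply: measurable_funM => //.
  exact: measurable_far.
- exact: measurable_funX.
- move=> x; apply: cvg_near_cst.
  exists (Num.bound (enorm x)) => // n /= hn.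
  rewrite /far leNgt (_ : enorm x < n.+1%:R)%R ?mulr0 ?expr0n//.
  rewrite (lt_le_trans (archi_boundP (enorm_ge0 x)))// ler_nat.
  exact: leqW.
- move=> n x; rewrite sqr_ge0 exprMn far_sq ler_piMr ?sqr_ge0//.
  exact: far_le1.
by move=> n _ /(_ n (leqnn _)) hn; exists n.+1%:R; rewrite ?ltr0n.
Qed.

(** The truncation keeps the weight bounded, so that it may enter a test function before any
    weighted norm is known to be finite. At [N = 0] the weight is trivial, which starts the
    induction. *)
Definition wt (mu : R) (N : nat) (x : plane R) : R :=
  Num.min (expR (mu * enorm x)) (2 ^+ N).

Lemma measurable_expw (mu : R) : measurable_fun setT (fun x : plane R => expR (mu * enorm x)).
Proof.
apply: (measurableT_comp (@measurable_expR R)).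
by apply: measurable_funM => //; exact: measurable_enorm.
Qed.

Lemma measurable_wt mu N : measurable_fun setT (wt mu N).
Proof. by apply: measurable_minr => //; exact: measurable_expw. Qed.

Lemma wt_ge1 mu N x : 0 <= mu -> 1 <= wt mu N x.
Proof.
move=> mu0; rewrite /wt le_min; apply/andP; split.
  by rewrite -expR0 ler_expR mulr_ge0// enorm_ge0.
by rewrite exprn_ege1// ler1n.
Qed.

Lemma wt_le mu N x : wt mu N x <= 2 ^+ N.
Proof. by rewrite /wt ge_min lexx orbT. Qed.

Lemma wt_le_exp mu N x : wt mu N x <= expR (mu * enorm x).
Proof. by rewrite /wt ge_min lexx. Qed.

Lemma wt0 mu x : 0 <= mu -> wt mu 0 x = 1.
Proof.
move=> mu0; apply/le_anti; rewrite wt_ge1// andbT.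
exact: (wt_le mu 0).
Qed.

Lemma wtS mu N x : 0 <= mu -> wt mu N.+1 x <= 2 * wt mu N x.
Proof.
move=> mu0; rewrite {2}/wt minr_pMr ?ler0n// le_min -exprS wt_le andbT.
rewrite (le_trans (wt_le_exp _ _ _))// ler_peMl ?expR_ge0// ler1n//.
Qed.

(** Truncation preserves submultiplicativity: if one factor sits at the ceiling [2 ^ N], the other
    one, being at least 1, keeps the product above the ceiling. Otherwise both factors are plain
    exponentials. *)
Lemma wt_submul mu N x y z : 0 <= mu -> enorm z <= enorm x + enorm y ->
  wt mu N z <= wt mu N x * wt mu N y.
Proof.
move=> mu0 h.
have x1 := wt_ge1 N x mu0; have y1 := wt_ge1 N y mu0.
have x0 := le_trans ler01 x1; have y0 := le_trans ler01 y1.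
have [hx|hx] := leP (expR (mu * enorm x)) (2 ^+ N); last first.
  apply: (le_trans (wt_le _ _ _)).
  by rewrite {1}/wt min_r ?(ltW hx)// ler_peMr// exprn_ge0.
have [hy|hy] := leP (expR (mu * enorm y)) (2 ^+ N); last first.
  apply: (le_trans (wt_le _ _ _)).
  by rewrite {2}/wt min_r ?(ltW hy)// ler_peMl// exprn_ge0.
apply: (le_trans (wt_le_exp _ _ _)).
rewrite /wt !min_l// -expRD ler_expR -mulrDr.
by rewrite ler_wpM2l.
Qed.

Lemma wt_near mu x : \forall N \near \oo, wt mu N x = expR (mu * enorm x).
Proof.
exists (Num.bound (expR (mu * enorm x))) => // n /= hn.
by rewrite /wt min_l// ltW// upper_nthrootP.
Qed.

Variables (u : plane R -> R) (c U : R).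
Hypotheses (mu : measurable_fun setT u) (u0 : forall x, 0 <= u x).
Hypotheses (c0 : 0 < c) (U0 : 0 < U).
Hypothesis (uU : (\int[leb2]_x (u x ^+ 2)%:E <= (U ^+ 2)%:E)%E).
Hypothesis (H : forall v : plane R -> R, measurable_fun setT v ->
  (forall x, 0 <= v x) -> (exists M, forall x, v x <= M) ->
  (c%:E * \int[leb2]_x (v x * u x ^+ 2)%:E <=
   int3 (quad (cst 1%R) u u u (fun x => (v x * u x)%R)))%E).

Let chis (m : R) (l : mR) : R := (`|l| <= m^-1)%R%:R.
Let chib (m : R) (l : mR) : R := (m <= `|l|)%R%:R.

(* Passing from [N] to [N.+1] at most doubles the weight, hence the norm to at
   most [2 * kappa]; the smallness condition on [eta] and [delta] brings it back
   below [kappa]. *)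
Lemma bootstrap_step (sigma m delta eta : R) (N : nat) :
  let tau := sigma + 2 * sigma * m in
  let e := expR 1 in
  let kappa := e * eta in
  0 < sigma -> 1 <= m -> 0 < delta -> 0 < eta ->
  measurable_fun setT (chis m) -> measurable_fun setT (chib m) ->
  (\int[leb]_l (chis m l * kern l)%:E <= delta%:E)%E ->
  (\int[leb]_l (chib m l * kern l)%:E <= delta%:E)%E ->
  (\int[leb2]_x ((u x * far sigma x) ^+ 2)%:E <= (eta ^+ 2)%:E)%E ->
  18 * pi * U * kappa + 12 * pi * e * U * eta + 12 * delta * e * U ^+ 2 <= c ->
  (\int[leb2]_x ((wt tau^-1 N x * u x * far tau x) ^+ 2)%:E <= (kappa ^+ 2)%:E)%E ->
  (\int[leb2]_x ((wt tau^-1 N.+1 x * u x * far tau x) ^+ 2)%:E <= (kappa ^+ 2)%:E)%E.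
Proof.
move=> tau e kappa sigma0 m1 delta0 eta0 mchis mchib ks kb ueta cbound IH.
have m0 : 0 < m by exact: lt_le_trans m1.
have tau3 : 3 * sigma <= tau.
  rewrite /tau -subr_ge0 (_ : _ - _ = 2 * sigma * (m - 1)); last by ring.
  by rewrite mulr_ge0 ?mulr_ge0 ?subr_ge0// ltW.
have tau0 : 0 < tau by rewrite (lt_le_trans _ tau3)// mulr_gt0.
have e0 : 0 < e by exact: expR_gt0.
have kappa0 : 0 < kappa by rewrite mulr_gt0.
have itau0 : 0 <= tau^-1 by rewrite invr_ge0 ltW.
pose w := wt tau^-1 N.+1.
have mw : measurable_fun setT w by exact: measurable_wt.
have w1 x : 1 <= w x by exact: wt_ge1.
have w0 x : 0 <= w x by exact: le_trans (w1 x).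
(* The rate [1 / tau] is chosen so that the weight stays below [e] on the ball of radius [tau],
   whatever the truncation. *)
have we x : enorm x <= tau -> w x <= e.
  move=> hx; rewrite (le_trans (wt_le_exp _ _ _))// ler_expR.
  by rewrite mulrC ler_pdivrMr// mul1r.
pose h x := w x * u x.
pose h1 x := h x * near0 sigma x.
pose k x := h x * far sigma x.
pose ug x := u x * far sigma x.
pose h3 x := h x * far tau x.
have h_ge0 x : 0 <= h x by exact: mulr_ge0.
have h1_ge0 x : 0 <= h1 x by rewrite mulr_ge0// near01.
have k_ge0 x : 0 <= k x by rewrite mulr_ge0// far01.
have ug_ge0 x : 0 <= ug x by rewrite mulr_ge0// far01.
have h3_ge0 x : 0 <= h3 x by rewrite mulr_ge0// far01.
have mh : measurable_fun setT h by exact: measurable_funM.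
have mh1 : measurable_fun setT h1 by apply: measurable_funM => //; exact: measurable_near0.
have mk : measurable_fun setT k by apply: measurable_funM => //; exact: measurable_far.
have mug : measurable_fun setT ug by apply: measurable_funM => //; exact: measurable_far.
have mh3 : measurable_fun setT h3 by apply: measurable_funM => //; exact: measurable_far.
have msq (f : plane R -> R) : measurable_fun setT f -> measurable_fun setT (fun x => (f x ^+ 2)%:E).
  by move=> mf; apply/measurable_EFinP; apply: measurable_funX.
have scale2 (a b : R) (f g : plane R -> R) : 0 <= a -> measurable_fun setT f ->
    measurable_fun setT g -> (forall x, 0 <= f x) -> (forall x, f x <= a * g x) ->
    (\int[leb2]_x (g x ^+ 2)%:E <= (b ^+ 2)%:E)%E ->
    (\int[leb2]_x (f x ^+ 2)%:E <= ((a * b) ^+ 2)%:E)%E.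
  move=> a0 mf mg f0 fg gb.
  apply: (@le_trans _ _ (\int[leb2]_x ((a ^+ 2)%:E * (g x ^+ 2)%:E))%E).
    apply: ge0_le_integral => //.
    - by move=> x _; rewrite lee_fin sqr_ge0.
    - exact: msq.
    - by apply: measurable_funeM; exact: msq.
    move=> x _; rewrite -EFinM lee_fin -exprMn lerXn2r ?nnegrE//.
    exact: le_trans (fg x).
  rewrite ge0_integralZl//; first last.
  - by rewrite lee_fin sqr_ge0.
  - by move=> x _; rewrite lee_fin sqr_ge0.
  - exact: msq.
  by rewrite exprMn [leRHS]EFinM lee_wpmul2l// lee_fin sqr_ge0.
have Nh3 : (\int[leb2]_x (h3 x ^+ 2)%:E <= ((2 * kappa) ^+ 2)%:E)%E.
  apply: (scale2 2 kappa _ (fun x => wt tau^-1 N x * u x * far tau x)) => //.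
    apply: measurable_funM; last exact: measurable_far.
    by apply: measurable_funM => //; exact: measurable_wt.
  move=> x; rewrite /h3 /h !mulrA; apply: ler_wpM2r; first exact: far01.
  by apply: ler_wpM2r => //; exact: wtS.
have Nh1 : (\int[leb2]_x (h1 x ^+ 2)%:E <= ((e * U) ^+ 2)%:E)%E.
  apply: (scale2 e U _ u) => //; first exact: ltW.
  move=> x; rewrite /h1 /h /near0; case: ltP => hx; last first.
    by rewrite mulr0 mulr_ge0// ltW.
  by rewrite mulr1 ler_wpM2r// we// (le_trans (ltW hx))// (le_trans _ tau3)//; lra.
have Neug : (\int[leb2]_x ((e * ug x) ^+ 2)%:E <= (kappa ^+ 2)%:E)%E.
  apply: (scale2 e eta _ ug) => //; first exact: ltW.
    by apply: measurable_funM.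
  by move=> x; rewrite mulr_ge0// ltW.
(* Up to radius [tau] the weight is at most [e], so [k] is dominated by [e * ug], of norm at most
   [kappa]; beyond [tau] it is dominated by [h3], of norm at most [2 * kappa]. The sum of the
   squares is below [9 * kappa ^ 2]. *)
have Nk : (\int[leb2]_x (k x ^+ 2)%:E <= ((3 * kappa) ^+ 2)%:E)%E.
  apply: (@le_trans _ _ (\int[leb2]_x (((e * ug x) ^+ 2)%:E + (h3 x ^+ 2)%:E))%E).
    apply: ge0_le_integral => //.
    - by move=> x _; rewrite lee_fin sqr_ge0.
    - exact: msq.
    - by apply: emeasurable_funD; apply: msq => //; apply: measurable_funM.
    move=> x _; rewrite -EFinD lee_fin /k /h3 /ug.
    have [hx|hx] := leP (enorm x) tau; last first.
      rewrite [far tau x]/far (ltW hx) mulr1 ler_wpDl ?sqr_ge0//.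
      by rewrite exprMn far_sq ler_piMr ?sqr_ge0// far_le1.
    rewrite ler_wpDr ?sqr_ge0// lerXn2r ?nnegrE ?mulr_ge0 ?far01 ?(ltW e0)//.
    by rewrite /h !mulrA ler_wpM2r ?far01// ler_wpM2r// we.
  rewrite ge0_integralD//; first last.
  - exact: msq.
  - by move=> x _; rewrite lee_fin sqr_ge0.
  - by apply: msq => //; apply: measurable_funM.
  - by move=> x _; rewrite lee_fin sqr_ge0.
  apply: (le_trans (leeD Neug Nh3)); rewrite -EFinD lee_fin.
  rewrite !exprMn -subr_ge0 (_ : _ - _ = 4 * (e ^+ 2 * eta ^+ 2)); last by rewrite /kappa; ring.
  by nonneg.
have Nug : (\int[leb2]_x (ug x ^+ 2)%:E <= (eta ^+ 2)%:E)%E by [].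
(* The weight enters squared: one factor stays with [u] at the vertex [d] and forms [h3], the other
   is distributed over [a] and [b]. *)
pose v x := w x ^+ 2 * far tau x.
have mv : measurable_fun setT v.
  by apply: measurable_funM; [exact: measurable_funX|exact: measurable_far].
have v0 x : 0 <= v x by rewrite mulr_ge0 ?sqr_ge0// far01.
have vbd : exists M, forall x, v x <= M.
  exists ((2 ^+ N.+1) ^+ 2) => x; apply: (@le_trans _ _ (w x ^+ 2)).
    by rewrite ler_piMr ?sqr_ge0// far_le1.
  by rewrite lerXn2r ?nnegrE ?exprn_ge0//; exact: wt_le.
have := H mv v0 vbd.
have -> : (\int[leb2]_x (v x * u x ^+ 2)%:E = \int[leb2]_x (h3 x ^+ 2)%:E)%E.
  apply: eq_integral => x _; congr EFin; rewrite /v /h3 /h !exprMn far_sq.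
  by rewrite mulrAC.
move=> HH.
pose one : mR -> R := cst 1.
(* In [q1] both [a] and [b] are far. In [q2] and [q4] one of them is near and [c] is far. In [q3]
   and [q5] one of them is near and [c] is near too, which confines the shape. Both near is excluded
   by [rect_near_ab]. *)
pose q1 := quad one k k u h3.
pose q2 := quad one h1 k ug h3.
pose q3 := quad (chis m) h1 k u h3.
pose q4 := quad one k h1 ug h3.
pose q5 := quad (chib m) k h1 u h3.
have m_one : measurable_fun setT one by exact: measurable_cst.
have cs0 l : 0 <= chis m l by exact: ler0n.
have cb0 l : 0 <= chib m l by exact: ler0n.
have one0 l : 0 <= one l by exact: ler01.
have [mq1 mq2 mq3 mq4 mq5] : [/\ meas3 q1, meas3 q2, meas3 q3, meas3 q4 & meas3 q5].
  by split; exact: measurable_quad.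
have q1_ge0 l z x : 0 <= q1 l z x by exact: quad_ge0.
have q2_ge0 l z x : 0 <= q2 l z x by exact: quad_ge0.
have q3_ge0 l z x : 0 <= q3 l z x by exact: quad_ge0.
have q4_ge0 l z x : 0 <= q4 l z x by exact: quad_ge0.
have q5_ge0 l z x : 0 <= q5 l z x by exact: quad_ge0.
have dom : (int3 (quad (cst 1%R) u u u (fun x => (v x * u x)%R)) <=
    int3 (fun l z x => (q1 l z x + (q2 l z x + (q3 l z x + (q4 l z x + q5 l z x))))%R))%E.
  apply: le_int3.
  - by apply: measurable_quad => //; exact: measurable_funM.
  - by do 4!apply: measD3 => //.
  - by move=> l z x; apply: quad_ge0 => // y; exact: mulr_ge0.
  move=> l z x.
  have [hd|hd] := ltP (enorm z) tau.
    have vz : v z = 0 by rewrite /v /far leNgt hd mulr0.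
    by rewrite {1}/quad vz mul0r !mulr0 !addr_ge0.
  have tri := enorm_rect_le l x z.
  have rect := rectangle_enorm l x z.
  set a := x + z; set b := smul l (perp x) + z; set cc := x + smul l (perp x) + z.
  have wd : w z <= w a * w b by exact: wt_submul.
  apply: (@le_trans _ _ (h a * h b * u cc * h3 z)).
    rewrite /quad mul1r -/a -/b -/cc /v /h3 /h /far hd !mulr1.
    rewrite (_ : u a * u b * u cc * _ = w z * (u a * u b * u cc * w z * u z)); last by ring.
    rewrite [leRHS](_ : _ = (w a * w b) * (u a * u b * u cc * w z * u z)); last by ring.
    by apply: ler_wpM2r => //; rewrite !mulr_ge0.
  rewrite /q1 /q2 /q3 /q4 /q5 /quad !mul1r -/a -/b -/cc /k /h1 /ug /near0 /far.
  have H3 := h3_ge0 z.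
  have ha := h_ge0 a; have hb := h_ge0 b; have hc := u0 cc.
  have P : 0 <= h a * h b * u cc * h3 z by rewrite !mulr_ge0.
  have [na|fa] := ltP (enorm a) sigma; have [nb|fb] := ltP (enorm b) sigma.
  - exfalso; have := rect_near_ab sigma0 na nb.
    by rewrite ltNge (le_trans tau3 hd).
  - have [nc|fc] := ltP (enorm cc) sigma; last first.
      rewrite !(mulr0, mulr1, mul0r, add0r, addr0) lerDl.
      by rewrite !mulr_ge0.
    rewrite !(mulr0, mulr1, mul0r, add0r, addr0).
    by rewrite /chis (rect_near_ac sigma0 m0 na nc hd) mul1r.
  - have [nc|fc] := ltP (enorm cc) sigma; last first.
      rewrite !(mulr0, mulr1, mul0r, add0r, addr0) lerDl.
      by rewrite !mulr_ge0.
    rewrite !(mulr0, mulr1, mul0r, add0r, addr0).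
    by rewrite /chib (rect_near_bc sigma0 nb nc hd) mul1r.
  - rewrite !(mulr0, mulr1, mul0r, add0r, addr0).
    by [].
have e2 : 0 < 2 * kappa by rewrite mulr_gt0.
have e3 : 0 < 3 * kappa by rewrite mulr_gt0.
have eU : 0 < e * U by rewrite mulr_gt0.
have kone : (\int[leb]_l (one l * kern l)%:E <= (pi : R)%:E)%E.
  by under eq_integral do rewrite mul1r; rewrite integral_kernT.
have B1 := int3_quad_le e3 e3 U0 e2 one0 m_one mk mk mu mh3 k_ge0 k_ge0 u0 h3_ge0 Nk Nk uU Nh3 kone.
have B2 := int3_quad_le eU e3 eta0 e2 one0 m_one mh1 mk mug mh3 h1_ge0 k_ge0 ug_ge0 h3_ge0 Nh1 Nk Nug Nh3 kone.
have B3 := int3_quad_le eU e3 U0 e2 cs0 mchis mh1 mk mu mh3 h1_ge0 k_ge0 u0 h3_ge0 Nh1 Nk uU Nh3 ks.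
have B4 := int3_quad_le e3 eU eta0 e2 one0 m_one mk mh1 mug mh3 k_ge0 h1_ge0 ug_ge0 h3_ge0 Nk Nh1 Nug Nh3 kone.
have B5 := int3_quad_le e3 eU U0 e2 cb0 mchib mk mh1 mu mh3 k_ge0 h1_ge0 u0 h3_ge0 Nk Nh1 uU Nh3 kb.
have fin : (c%:E * \int[leb2]_x (h3 x ^+ 2)%:E <= c%:E * (kappa ^+ 2)%:E)%E.
  apply: (le_trans HH); apply: (le_trans dom).
  rewrite int3D//; [|by do 3!apply: measD3 => //|by move=> *; rewrite !addr_ge0].
  rewrite int3D//; [|by do 2!apply: measD3 => //|by move=> *; rewrite !addr_ge0].
  rewrite int3D//; [|by do 1!apply: measD3 => //|by move=> *; rewrite !addr_ge0].
  rewrite int3D//.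
  apply: (le_trans (leeD B1 (leeD B2 (leeD B3 (leeD B4 B5))))).
  rewrite -!EFinD -EFinM lee_fin.
  (* Each of the five bounds has at least two factors [kappa], one from [h3] and one from a far
     vertex among [a] and [b]. What is left over is the constant assumed to be at most [c]. *)
  rewrite [leLHS](_ : _ = (18 * pi * U * kappa + 12 * pi * e * U * eta + 12 * delta * e * U ^+ 2)
    * kappa ^+ 2); last by ring.
  by rewrite ler_wpM2r// sqr_ge0.
by rewrite lee_pmul2l// in fin; rewrite lte_fin.
Qed.

Lemma integral_kern_indic (b : mR -> bool) :
  (\int[leb]_l ((b l)%:R * kern l)%:E =
   \int[leb]_(l in [set l | b l]) (kern l)%:E)%E.
Proof.
rewrite [RHS]integral_mkcond; apply: eq_integral => l _; rewrite patchE.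
case: ifPn => [/set_mem/= -> | /negP bl]; first by rewrite mul1r.
by rewrite (_ : b l = false) ?mul0r//; apply/negP => h; apply: bl; rewrite inE.
Qed.

Lemma measurable_chis m : measurable_fun setT (chis m).
Proof.
by apply: measurable_bool; apply: measurable_fun_ler.
Qed.

Lemma measurable_chib m : measurable_fun setT (chib m).
Proof.
by apply: measurable_bool; apply: measurable_fun_ler.
Qed.

Lemma weighted_bootstrap : exists2 mu, 0 < mu &
  (\int[leb2]_x ((expR (mu * enorm x) * u x) ^+ 2)%:E < +oo)%E.
Proof.
pose e : R := expR 1.
have e0 : 0 < e by exact: expR_gt0.
have e1 : 1 <= e by rewrite -expR0 ler_expR.
have pi0 := pi_gt0 R.
(* With [kappa = e * eta], the two terms containing [eta] add up to [30 * pi * e * U * eta], which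
   is [c / 2] for this choice; [delta] makes the third term the other half. *)
pose eta := c / (60 * pi * e * U).
have eta0 : 0 < eta by rewrite divr_gt0 ?mulr_gt0.
pose delta := c / (24 * e * U ^+ 2).
have delta0 : 0 < delta by rewrite divr_gt0 ?mulr_gt0 ?exprn_gt0.
have uoo : (\int[leb2]_x (u x ^+ 2)%:E < +oo)%E by rewrite (le_lt_trans uU)// ltry.
have [sigma sigma0 usigma] := sq_tail mu uoo eta0.
have [s1 s10 ks1] := kern_tail delta0.
have ks0 := @kern_near0 R (delta / 2) (ltW (divr_gt0 delta0 (ltr0n R 2))).
(* Being above [s1] and above [2 / delta], this [m] leaves mass at most [delta] to the large and to
   the small shapes; being above 1, it gives [3 * sigma <= tau]. *)
pose m := 1 + s1 + (delta / 2)^-1.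
have id0 : 0 < (delta / 2)^-1 by rewrite invr_gt0 divr_gt0.
have m1 : 1 <= m by rewrite /m; lra.
have m0 : 0 < m by lra.
have kk l : 0 <= kern l :> R by exact/ltW/kern_gt0.
have mono (b b' : mR -> R) (k : \bar R) : measurable_fun setT b -> measurable_fun setT b' ->
    (forall l, 0 <= b l <= b' l) ->
    (\int[leb]_l (b' l * kern l)%:E <= k)%E -> (\int[leb]_l (b l * kern l)%:E <= k)%E.
  move=> mb mb' bb; apply: le_trans; apply: ge0_le_integral => //.
  - by move=> l _; have /andP[? ?] := bb l; rewrite lee_fin mulr_ge0.
  - by apply/measurable_EFinP; apply: measurable_funM => //; exact: measurable_kern.
  - by apply/measurable_EFinP; apply: measurable_funM => //; exact: measurable_kern.
  - by move=> l _; have /andP[? ?] := bb l; rewrite lee_fin ler_wpM2r.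
have bs : (\int[leb]_l (chis m l * kern l)%:E <= delta%:E)%E.
  apply: (mono _ (chis (delta / 2)^-1)) => //; try exact: measurable_chis.
    move=> l; rewrite /chis ler0n ler_nat; case: (leP `|l| m^-1) => // h.
    rewrite (le_trans h)// lef_pV2 ?posrE// /m; lra.
  rewrite /chis (integral_kern_indic (fun l => (`|l| <= (delta / 2)^-1^-1)%R)) invrK.
  by apply: (le_trans ks0); rewrite lee_fin mulrC divfK.
have bb : (\int[leb]_l (chib m l * kern l)%:E <= delta%:E)%E.
  apply: (mono _ (chib s1)) => //; try exact: measurable_chib.
    move=> l; rewrite /chib ler0n ler_nat; case: (leP m `|l|) => // h.
    by rewrite (le_trans _ h)// /m; lra.
  by rewrite /chib (integral_kern_indic (fun l => (s1 <= `|l|)%R)).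
pose tau := sigma + 2 * sigma * m.
pose kappa := e * eta.
have tausigma : sigma <= tau by rewrite /tau lerDl !mulr_ge0// ltW.
have tau0 : 0 < tau by exact: lt_le_trans tausigma.
have itau0 : 0 <= tau^-1 by rewrite invr_ge0 ltW.
have cb : 18 * pi * U * kappa + 12 * pi * e * U * eta + 12 * delta * e * U ^+ 2 <= c.
  have aux (p : R) : 0 < p -> 18 * p * U * (e * (c / (60 * p * e * U))) +
      12 * p * e * U * (c / (60 * p * e * U)) + 12 * (c / (24 * e * U ^+ 2)) * e * U ^+ 2 = c.
    by move=> p0; field; rewrite !gt_eqF.
  by rewrite /kappa /eta /delta aux.
have X N : (\int[leb2]_x ((wt tau^-1 N x * u x * far tau x) ^+ 2)%:E <= (kappa ^+ 2)%:E)%E.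
  elim: N => [|N IH]; last first.
    by apply: (bootstrap_step sigma0 m1 delta0 eta0 _ _ bs bb usigma cb IH);
      [exact: measurable_chis|exact: measurable_chib].
  apply: (@le_trans _ _ (\int[leb2]_x ((u x * far sigma x) ^+ 2)%:E)%E).
    apply: ge0_le_integral => //.
    - by move=> x _; rewrite lee_fin sqr_ge0.
    - apply/measurable_EFinP; apply: measurable_funX; apply: measurable_funM; last exact: measurable_far.
      by apply: measurable_funM => //; exact: measurable_wt.
    - by apply/measurable_EFinP; apply: measurable_funX; apply: measurable_funM => //; exact: measurable_far.
    move=> x _; rewrite lee_fin wt0// mul1r !exprMn !far_sq ler_wpM2l ?sqr_ge0//.
    by rewrite /far ler_nat; case: (leP tau) => // h; rewrite (le_trans tausigma h).
  have etak : eta <= kappa by rewrite /kappa ler_peMl// ltW.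
  have eta0' := ltW eta0.
  apply: (le_trans usigma); rewrite lee_fin lerXn2r// nnegrE.
  exact: le_trans etak.
exists tau^-1; first by rewrite invr_gt0.
have mexp := measurable_expw tau^-1.
(* The bounds are uniform in [N], so Fatou's lemma removes the truncation. *)
have L : (\int[leb2]_x ((expR (tau^-1 * enorm x) * u x * far tau x) ^+ 2)%:E <= (kappa ^+ 2)%:E)%E.
  apply: (ge0_fatou_le _ _ _ X).
  - move=> n; apply: measurable_funX; apply: measurable_funM; last exact: measurable_far.
    by apply: measurable_funM => //; exact: measurable_wt.
  - by move=> n x; exact: sqr_ge0.
  - move=> x; apply: cvg_near_cst; have [n0 _ hn] := @wt_near tau^-1 x.
    by exists n0 => // n /= /hn /= ->.
apply: (@le_lt_trans _ _ (\int[leb2]_x (((expR (tau^-1 * enorm x) * u x * far tau x) ^+ 2)%:E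
    + (e ^+ 2)%:E * (u x ^+ 2)%:E))%E).
  apply: ge0_le_integral => //.
  - by move=> x _; rewrite lee_fin sqr_ge0.
  - by apply/measurable_EFinP; apply: measurable_funX; apply: measurable_funM.
  - apply: emeasurable_funD.
      apply/measurable_EFinP; apply: measurable_funX; apply: measurable_funM; last exact: measurable_far.
      exact: measurable_funM.
    by apply: measurable_funeM; apply/measurable_EFinP; apply: measurable_funX.
  move=> x _; rewrite -EFinM -EFinD lee_fin.
  have [h|h] := leP (enorm x) tau; last first.
    by rewrite [far tau x]/far (ltW h) mulr1 lerDl mulr_ge0// sqr_ge0.
  rewrite ler_wpDl ?sqr_ge0// exprMn ler_wpM2r ?sqr_ge0// lerXn2r ?nnegrE ?expR_ge0//.
  by rewrite ler_expR mulrC ler_pdivrMr// mul1r.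
rewrite ge0_integralD//; first last.
- by apply: measurable_funeM; apply/measurable_EFinP; apply: measurable_funX.
- by move=> x _; rewrite -EFinM lee_fin mulr_ge0// sqr_ge0.
- apply/measurable_EFinP; apply: measurable_funX; apply: measurable_funM; last exact: measurable_far.
  exact: measurable_funM.
- by move=> x _; rewrite lee_fin sqr_ge0.
rewrite ge0_integralZl//; first last.
- by rewrite lee_fin sqr_ge0.
- by move=> x _; rewrite lee_fin sqr_ge0.
- by apply/measurable_EFinP; apply: measurable_funX.
apply: (@le_lt_trans _ _ ((kappa ^+ 2)%:E + (e ^+ 2)%:E * (U ^+ 2)%:E)%E).
  by apply: leeD => //; rewrite lee_wpmul2l// lee_fin sqr_ge0.
by rewrite -EFinM -EFinD ltry.
Qed.

End bootstrap.

(** * Complex integrals *)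

Definition cj {R : realType} (x : R[i]) : R[i] := conjc x.

Section cmod.
Context {R : realType}.
Implicit Types x y : R[i].

Lemma cmodE x : cmod x = Num.sqrt (complex.Re x ^+ 2 + complex.Im x ^+ 2).
Proof. by case: x. Qed.

Lemma cmod_sq x : cmod x ^+ 2 = complex.Re x ^+ 2 + complex.Im x ^+ 2.
Proof. by rewrite cmodE sqr_sqrtr// addr_ge0// sqr_ge0. Qed.

Lemma cmod_ge0 x : 0 <= cmod x. Proof. by rewrite cmodE sqrtr_ge0. Qed.

Lemma cmodM x y : cmod (x * y) = cmod x * cmod y.
Proof. exact: ComplexField.Normc.normcM. Qed.

Lemma cmodJ x : cmod (cj x) = cmod x.
Proof. by case: x => a b; rewrite /cj !cmodE /= sqrrN. Qed.

Lemma cmodN x : cmod (- x) = cmod x.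
Proof. by case: x => a b; rewrite !cmodE /= !sqrrN. Qed.

Lemma cmod0 : cmod (0 : R[i]) = 0.
Proof. exact: ComplexField.Normc.normc0. Qed.

Lemma cmod_eq0 x : cmod x = 0 -> x = 0.
Proof. exact: ComplexField.Normc.eq0_normc. Qed.

Lemma cmod_real (r : R) : cmod r%:C = `|r|.
Proof. by rewrite cmodE /= expr0n addr0 sqrtr_sqr. Qed.

Lemma cmod_triangle x y : cmod (x + y) <= cmod x + cmod y.
Proof. exact: le_normcD. Qed.

Lemma normr_Re x : `|complex.Re x| <= cmod x.
Proof.
rewrite cmodE -sqrtr_sqr ler_wsqrtr// lerDl sqr_ge0//.
Qed.

Lemma normr_Im x : `|complex.Im x| <= cmod x.
Proof.
rewrite cmodE -sqrtr_sqr ler_wsqrtr// lerDr sqr_ge0//.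
Qed.

Lemma ReM x y : complex.Re (x * y) =
  complex.Re x * complex.Re y - complex.Im x * complex.Im y.
Proof. by case: x => a b; case: y => c d. Qed.

Lemma ImM x y : complex.Im (x * y) =
  complex.Re x * complex.Im y + complex.Im x * complex.Re y.
Proof. by case: x => a b; case: y => c d. Qed.

Lemma ReD x y : complex.Re (x + y) = complex.Re x + complex.Re y.
Proof. by case: x => a b; case: y => c d. Qed.

Lemma ImD x y : complex.Im (x + y) = complex.Im x + complex.Im y.
Proof. by case: x => a b; case: y => c d. Qed.

Lemma ReN x : complex.Re (- x) = - complex.Re x. Proof. by case: x. Qed.
Lemma ImN x : complex.Im (- x) = - complex.Im x. Proof. by case: x. Qed.
Lemma ReJ x : complex.Re (cj x) = complex.Re x. Proof. by case: x. Qed.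
Lemma ImJ x : complex.Im (cj x) = - complex.Im x. Proof. by case: x. Qed.

Lemma cjM x y : cj (x * y) = cj x * cj y.
Proof. exact: rmorphM. Qed.

Lemma cjD x y : cj (x + y) = cj x + cj y.
Proof. exact: rmorphD. Qed.

Lemma cjK x : cj (cj x) = x.
Proof. by case: x => a b; rewrite /cj /= opprK. Qed.

Lemma complex_ext x y : complex.Re x = complex.Re y ->
  complex.Im x = complex.Im y -> x = y.
Proof. by case: x => a b; case: y => c d /= -> ->. Qed.

Definition expi (t : R) : R[i] := cos t +i* sin t.

Lemma expiD s t : expi (s + t) = expi s * expi t.
Proof.
apply: complex_ext; rewrite /expi ?ReM ?ImM /= ?cosD ?sinD//.
by rewrite addrC.
Qed.

Lemma expiN t : expi (- t) = (cj (expi t)).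
Proof. by rewrite /expi cosN sinN. Qed.

Lemma cj0 : cj (0 : R[i]) = 0.
Proof. by rewrite /cj /conjc /= oppr0. Qed.

Lemma cj_real (r : R) : cj r%:C = r%:C.
Proof. by rewrite /cj /conjc /= oppr0. Qed.

Lemma mul_cj x : x * cj x = (cmod x ^+ 2)%:C.
Proof.
apply: complex_ext; rewrite ?ReM ?ImM ReJ ImJ /= ?cmod_sq; first by ring.
by ring.
Qed.

Lemma cmod_expi t : cmod (expi t) = 1.
Proof. by rewrite cmodE /= cos2Dsin2 sqrtr1. Qed.

End cmod.

Section cmeas.
Context d (T : measurableType d) {R : realType}.
Implicit Types f g : T -> R[i].

Definition cmeas f := measurable_fun setT (fun x => complex.Re (f x)) /\
  measurable_fun setT (fun x => complex.Im (f x)).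

Lemma cmeas_cst c : cmeas (cst c). Proof. by split; exact: measurable_cst. Qed.

Lemma cmeasD f g : cmeas f -> cmeas g -> cmeas (fun x => f x + g x).
Proof.
move=> [rf imf] [rg ig]; split.
  by under eq_fun do rewrite ReD; exact: measurable_funD.
by under eq_fun do rewrite ImD; exact: measurable_funD.
Qed.

Lemma cmeasM f g : cmeas f -> cmeas g -> cmeas (fun x => f x * g x).
Proof.
move=> [rf imf] [rg ig]; split.
  by under eq_fun do rewrite ReM; apply: measurable_funB; exact: measurable_funM.
by under eq_fun do rewrite ImM; apply: measurable_funD; exact: measurable_funM.
Qed.

Lemma cmeasN f : cmeas f -> cmeas (fun x => - f x).
Proof.
move=> [rf imf]; split.
  by under eq_fun do rewrite ReN; apply: measurableT_comp.
by under eq_fun do rewrite ImN; apply: measurableT_comp.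
Qed.

Lemma cmeasB f g : cmeas f -> cmeas g -> cmeas (fun x => f x - g x).
Proof. by move=> mf mg; apply: cmeasD => //; exact: cmeasN. Qed.

Lemma cmeasJ f : cmeas f -> cmeas (fun x => (cj (f x))).
Proof.
move=> [rf imf]; split; first by under eq_fun do rewrite ReJ.
by under eq_fun do rewrite ImJ; apply: measurableT_comp.
Qed.

Lemma cmeas_real (h : T -> R) : measurable_fun setT h -> cmeas (fun x => (h x)%:C).
Proof. by move=> mh; split => //; exact: measurable_cst. Qed.

Lemma cmeas_expi (h : T -> R) : measurable_fun setT h -> cmeas (fun x => expi (h x)).
Proof.
move=> mh; split => /=.
  by apply: measurableT_comp => //; apply: continuous_measurable_fun; exact: continuous_cos.
by apply: measurableT_comp => //; apply: continuous_measurable_fun; exact: continuous_sin.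
Qed.

Lemma measurable_cmod f : cmeas f -> measurable_fun setT (fun x => cmod (f x)).
Proof.
move=> [rf imf]; under eq_fun do rewrite cmodE.
apply: (@measurableT_comp _ _ _ _ _ _ (@Num.sqrt R)).
  by apply: continuous_measurable_fun; exact: sqrt_continuous.
by apply: measurable_funD; exact: measurable_funX.
Qed.

End cmeas.

Lemma cmeas_comp d d' (T : measurableType d) (T' : measurableType d')
    (R : realType) (f : T -> R[i]) (g : T' -> T) :
  cmeas f -> measurable_fun setT g -> cmeas (f \o g).
Proof.
by move=> [rf imf] mg; split; [exact: (measurableT_comp rf)|exact: (measurableT_comp imf)].
Qed.

Section cintegral.
Context d (T : measurableType d) {R : realType} (mu : {measure set T -> \bar R}).
Implicit Types f g : T -> R[i].

Definition cL1 f := cmeas f /\ (\int[mu]_x (cmod (f x))%:E < +oo)%E.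

Lemma cL1_Re f : cL1 f -> mu.-integrable setT (fun x => (complex.Re (f x))%:E).
Proof.
move=> [mf fi]; have [rf imf] := mf; apply/integrableP; split; first exact/measurable_EFinP.
apply: le_lt_trans fi; apply: ge0_le_integral => //.
- by apply/measurable_EFinP; apply: measurableT_comp => //.
- by apply/measurable_EFinP; exact: measurable_cmod.
- by move=> x _; rewrite lee_fin normr_Re.
Qed.

Lemma cL1_Im f : cL1 f -> mu.-integrable setT (fun x => (complex.Im (f x))%:E).
Proof.
move=> [mf fi]; have [rf imf] := mf; apply/integrableP; split; first exact/measurable_EFinP.
apply: le_lt_trans fi; apply: ge0_le_integral => //.
- by apply/measurable_EFinP; apply: measurableT_comp => //.
- by apply/measurable_EFinP; exact: measurable_cmod.
- by move=> x _; rewrite lee_fin normr_Im.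
Qed.

Lemma cL1_le f (g : T -> R) : cmeas f -> measurable_fun setT g ->
  (forall x, cmod (f x) <= g x) -> (\int[mu]_x (g x)%:E < +oo)%E -> cL1 f.
Proof.
move=> mf mg fg gi; split => //; apply: le_lt_trans gi; apply: ge0_le_integral => //.
- by move=> x _; rewrite lee_fin cmod_ge0.
- by apply/measurable_EFinP; exact: measurable_cmod.
- by apply/measurable_EFinP.
- by move=> x _; rewrite lee_fin.
Qed.

Lemma eq_cintegral f g : f =1 g -> cintegral mu f = cintegral mu g.
Proof. by move=> /funext ->. Qed.

Lemma ae_eq_cintegral f g : cmeas f -> cmeas g ->
  {ae mu, forall x, f x = g x} -> cintegral mu f = cintegral mu g.
Proof.
move=> [rf imf] [rg ig] fg; rewrite /cintegral /Rintegral; congr (fine _ +i* fine _).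
- apply: ae_eq_integral => //; try exact/measurable_EFinP.
  by apply: filterS fg => x -> _.
- apply: ae_eq_integral => //; try exact/measurable_EFinP.
  by apply: filterS fg => x -> _.
Qed.

Lemma cintegralD f g : cL1 f -> cL1 g ->
  cintegral mu (fun x => f x + g x) = cintegral mu f + cintegral mu g.
Proof.
move=> lf lg; rewrite /cintegral; apply: complex_ext; rewrite ?ReD ?ImD /=.
  under eq_Rintegral do rewrite ReD.
  by rewrite RintegralD//; exact: cL1_Re.
under eq_Rintegral do rewrite ImD.
by rewrite RintegralD//; exact: cL1_Im.
Qed.

Lemma cintegralZl c f : cL1 f ->
  cintegral mu (fun x => c * f x) = c * cintegral mu f.
Proof.
move=> lf; have iR := cL1_Re lf; have iI := cL1_Im lf.
have iZ (a : R) (h : T -> R) : mu.-integrable setT (fun x => (h x)%:E) ->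
    mu.-integrable setT (fun x => (a * h x)%:E).
  by move=> ih; under eq_fun do rewrite EFinM; exact: integrableZl.
rewrite /cintegral; apply: complex_ext; rewrite ?ReM ?ImM /=.
  under eq_Rintegral do rewrite ReM.
  by rewrite RintegralB ?RintegralZl//; exact: iZ.
under eq_Rintegral do rewrite ImM.
by rewrite RintegralD ?RintegralZl//; exact: iZ.
Qed.

Lemma cintegralZr c f : cL1 f ->
  cintegral mu (fun x => f x * c) = cintegral mu f * c.
Proof. by move=> lf; under eq_cintegral do rewrite mulrC; rewrite cintegralZl// mulrC. Qed.

Lemma cintegralJ f : cL1 f ->
  cintegral mu (fun x => (cj (f x))) = (cj (cintegral mu f)).
Proof.
move=> lf; rewrite /cintegral; apply: complex_ext; rewrite ?ReJ ?ImJ /=.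
  by under eq_Rintegral do rewrite ReJ.
under eq_Rintegral do rewrite ImJ -mulN1r.
by rewrite RintegralZl ?mulN1r//; exact: cL1_Im.
Qed.

Lemma cL1Z c f : cL1 f -> cL1 (fun x => c * f x).
Proof.
move=> [mf fi]; split; first by apply: cmeasM => //; exact: cmeas_cst.
under eq_integral do rewrite cmodM EFinM.
rewrite ge0_integralZl//.
- by rewrite lte_mul_pinfty// lee_fin cmod_ge0.
- by apply/measurable_EFinP; exact: measurable_cmod.
- by move=> x _; rewrite lee_fin cmod_ge0.
- by rewrite lee_fin cmod_ge0.
Qed.

Lemma cL1D f g : cL1 f -> cL1 g -> cL1 (fun x => f x + g x).
Proof.
move=> [mf fi] [mg gi]; apply: (@cL1_le _ (fun x => cmod (f x) + cmod (g x))).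
- exact: cmeasD.
- by apply: measurable_funD; exact: measurable_cmod.
- by move=> x; exact: cmod_triangle.
under eq_integral do rewrite EFinD.
rewrite ge0_integralD//; try by [move=> x _; rewrite lee_fin cmod_ge0|apply/measurable_EFinP; exact: measurable_cmod].
exact: lte_add_pinfty.
Qed.

Lemma cL1J f : cL1 f -> cL1 (fun x => (cj (f x))).
Proof.
move=> [mf fi]; split; first exact: cmeasJ.
by under eq_integral do rewrite cmodJ.
Qed.

(* Rotating the integral onto the positive axis keeps the constant 1. *)
Lemma cmod_cintegral_le f : cmeas f ->
  ((cmod (cintegral mu f))%:E <= \int[mu]_x (cmod (f x))%:E)%E.
Proof.
move=> mf; have [fi|] := ltP (\int[mu]_x (cmod (f x))%:E)%E +oo%E; last first.
  by rewrite leye_eq => /eqP ->; rewrite leey.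
have lf : cL1 f by [].
set I := cintegral mu f.
have [->|I0] := eqVneq (cmod I) 0.
  by apply: integral_ge0 => x _; rewrite lee_fin cmod_ge0.
have Igt : 0 < cmod I by rewrite lt_neqAle eq_sym I0 cmod_ge0.
pose k := (cmod I)^-1; pose u : R[i] := k%:C * (cj I).
have uE : complex.Re (u * I) = cmod I.
  rewrite /u -mulrA ReM (_ : complex.Re k%:C = k)// (_ : complex.Im k%:C = 0)//.
  rewrite mul0r subr0 ReM ReJ ImJ mulNr opprK -!expr2 -cmod_sq.
  by rewrite expr2 mulrA mulVf// mul1r.
have u1 : cmod u = 1 by rewrite /u cmodM cmod_real cmodJ gtr0_norm ?invr_gt0// mulVf.
rewrite -uE -cintegralZl// /cintegral /=.
have luf := cL1Z u lf.
have [[muf _] _] := luf.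
rewrite /Rintegral fineK; last exact: integrable_fin_num (cL1_Re luf).
apply: le_integral => //; first exact: cL1_Re.
- apply/integrableP; split; first by apply/measurable_EFinP; exact: measurable_cmod.
  by under eq_integral do rewrite gee0_abs ?lee_fin ?cmod_ge0//.
- move=> x _; rewrite lee_fin (le_trans (ler_norm _))// (le_trans (normr_Re _))//.
  by rewrite cmodM u1 mul1r.
Qed.

End cintegral.

(** * Fubini's theorem for complex integrals *)

Section cfubini.
Context d1 d2 (T1 : measurableType d1) (T2 : measurableType d2) {R : realType}.
Context (m1 : {measure set T1 -> \bar R}) (m2 : {measure set T2 -> \bar R}).
Hypotheses (s1 : sigma_finite setT m1) (s2 : sigma_finite setT m2).

Let M1 : {sigma_finite_measure set T1 -> \bar R} := sigma_finite_alias s1.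
Let M2 : {sigma_finite_measure set T2 -> \bar R} := sigma_finite_alias s2.

Definition prodm : {measure set (T1 * T2) -> \bar R} := (M1 \x M2)%E.

Lemma sigma_finite_prodm : sigma_finite setT prodm.
Proof. exact: sigma_finite_prod. Qed.

Lemma integral_prodm (f : T1 * T2 -> \bar R) : measurable_fun setT f ->
  (forall x, 0 <= f x)%E ->
  (\int[prodm]_p f p = \int[m1]_x \int[m2]_y f (x, y))%E.
Proof. by move=> mf f0; exact: (@fubini_tonelli1 _ _ _ _ _ M1 M2 _ mf). Qed.

Lemma integral_prodm2 (f : T1 * T2 -> \bar R) : measurable_fun setT f ->
  (forall x, 0 <= f x)%E ->
  (\int[prodm]_p f p = \int[m2]_y \int[m1]_x f (x, y))%E.
Proof. by move=> mf f0; exact: (@fubini_tonelli2 _ _ _ _ _ M1 M2 _ mf). Qed.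

(** The inner real integral gives an infinite slice a default value. By integrability on the product
    this concerns only a null set of [x]. *)
Lemma Rintegral_prodm (f : T1 * T2 -> R) :
  prodm.-integrable setT (fun p => (f p)%:E) ->
  Rintegral prodm setT f = Rintegral m1 setT (fun x => Rintegral m2 setT (fun y => f (x, y))).
Proof.
move=> fi; have h := @integral12_prod_meas1 _ _ _ _ R M1 M2 _ fi.
rewrite /Rintegral -h; congr fine; apply: ae_eq_integral => //.
- exact: (@measurable_fubini_F _ _ _ _ R M1 M2 _ fi).
- apply/measurable_EFinP; apply: (measurableT_comp (@fine_measurable R setT measurableT)).
  exact: (@measurable_fubini_F _ _ _ _ R M1 M2 _ fi).
have := @ae_integrable1 _ _ _ _ R M1 M2 _ fi.
apply: filterS => x ix _.
by rewrite fineK//; exact: integrable_fin_num ix.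
Qed.

Lemma Rintegral_prodm2 (f : T1 * T2 -> R) :
  prodm.-integrable setT (fun p => (f p)%:E) ->
  Rintegral prodm setT f = Rintegral m2 setT (fun y => Rintegral m1 setT (fun x => f (x, y))).
Proof.
move=> fi; have h := @integral21_prod_meas1 _ _ _ _ R M1 M2 _ fi.
rewrite /Rintegral -h; congr fine; apply: ae_eq_integral => //.
- exact: (@measurable_fubini_G _ _ _ _ R M1 M2 _ fi).
- apply/measurable_EFinP; apply: (measurableT_comp (@fine_measurable R setT measurableT)).
  exact: (@measurable_fubini_G _ _ _ _ R M1 M2 _ fi).
have := @ae_integrable2 _ _ _ _ R M1 M2 _ fi.
apply: filterS => x ix _.
by rewrite fineK//; exact: integrable_fin_num ix.
Qed.

Lemma cintegral_prodm (f : T1 * T2 -> R[i]) : cL1 prodm f ->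
  cintegral prodm f = cintegral m1 (fun x => cintegral m2 (fun y => f (x, y))).
Proof.
move=> lf; rewrite /cintegral; congr (_ +i* _).
  exact: Rintegral_prodm (cL1_Re lf).
exact: Rintegral_prodm (cL1_Im lf).
Qed.

Lemma cintegral_prodm2 (f : T1 * T2 -> R[i]) : cL1 prodm f ->
  cintegral prodm f = cintegral m2 (fun y => cintegral m1 (fun x => f (x, y))).
Proof.
move=> lf; rewrite /cintegral; congr (_ +i* _).
  exact: Rintegral_prodm2 (cL1_Re lf).
exact: Rintegral_prodm2 (cL1_Im lf).
Qed.

Lemma cL1_prodm (f : T1 * T2 -> R[i]) : cmeas f ->
  (\int[m1]_x \int[m2]_y (cmod (f (x, y)))%:E < +oo)%E -> cL1 prodm f.
Proof.
move=> mf fi; split => //; rewrite integral_prodm//.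
- by apply/measurable_EFinP; exact: measurable_cmod.
- by move=> x; rewrite lee_fin cmod_ge0.
Qed.

Lemma cL1_prodm_tensor (f : T1 -> R[i]) (g : T2 -> R[i]) :
  cL1 m1 f -> cL1 m2 g -> cL1 prodm (fun p => f p.1 * g p.2).
Proof.
move=> [mf fi] [mg gi]; apply: cL1_prodm.
  by apply: cmeasM; [exact: (cmeas_comp mf)|exact: (cmeas_comp mg)].
have -> : (\int[m1]_x \int[m2]_y (cmod (f (x, y).1 * g (x, y).2))%:E =
    \int[m1]_x ((cmod (f x))%:E * \int[m2]_y (cmod (g y))%:E))%E.
  apply: eq_integral => x _; rewrite -ge0_integralZl//=.
  - by apply: eq_integral => y _; rewrite cmodM EFinM.
  - by apply/measurable_EFinP; exact: measurable_cmod.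
  - by move=> y _; rewrite lee_fin cmod_ge0.
  - by rewrite lee_fin cmod_ge0.
rewrite ge0_integralZr//.
- rewrite -(@fineK _ (\int[m1]_x (cmod (f x))%:E)%E) ?ge0_fin_numE//; last first.
    by apply: integral_ge0 => x _; rewrite lee_fin cmod_ge0.
  by rewrite lte_mul_pinfty// lee_fin fine_ge0//; apply: integral_ge0 => x _; rewrite lee_fin cmod_ge0.
- by apply/measurable_EFinP; exact: measurable_cmod.
- by move=> x _; rewrite lee_fin cmod_ge0.
- by apply: integral_ge0 => x _; rewrite lee_fin cmod_ge0.
Qed.

Lemma cintegral_prodm_tensor (f : T1 -> R[i]) (g : T2 -> R[i]) :
  cL1 m1 f -> cL1 m2 g ->
  cintegral prodm (fun p => f p.1 * g p.2) = cintegral m1 f * cintegral m2 g.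
Proof.
move=> lf lg; rewrite cintegral_prodm; last exact: cL1_prodm_tensor.
under eq_cintegral do rewrite /= cintegralZl//.
by rewrite cintegralZr.
Qed.

Lemma cfubini (f : T1 -> T2 -> R[i]) :
  cmeas (fun p : T1 * T2 => f p.1 p.2) ->
  (\int[m1]_x \int[m2]_y (cmod (f x y))%:E < +oo)%E ->
  cintegral m1 (fun x => cintegral m2 (fun y => f x y)) =
  cintegral m2 (fun y => cintegral m1 (fun x => f x y)).
Proof.
move=> mf fi; have lf := cL1_prodm (f := fun p => f p.1 p.2) mf fi.
by rewrite -(cintegral_prodm lf) (cintegral_prodm2 lf).
Qed.

(** The integrals of the positive and the negative part are measurable by Tonelli, and [fine] is a
    Borel function, so slices of infinite integral do no harm. *)
Lemma cmeas_cintegral (f : T1 -> T2 -> R[i]) :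
  cmeas (fun p : T1 * T2 => f p.1 p.2) ->
  cmeas (fun x => cintegral m2 (f x)).
Proof.
move=> [rf imf].
have aux (h : T1 -> T2 -> R) : measurable_fun setT (fun p : T1 * T2 => h p.1 p.2) ->
    measurable_fun setT (fun x => Rintegral m2 setT (h x)).
  move=> mh; apply: (measurableT_comp (@fine_measurable R setT measurableT)).
  under eq_fun do rewrite integralE.
  have mhE : measurable_fun setT (fun p : T1 * T2 => (h p.1 p.2)%:E) by apply/measurable_EFinP.
  apply: emeasurable_funB.
    apply: (measurable_integral (f := fun x => (fun y => (h x y)%:E)^\+)%E s2) => //.
    under eq_fun do rewrite funeposE.
    by apply: measurable_maxe => //; exact: measurable_cst.
  apply: (measurable_integral (f := fun x => (fun y => (h x y)%:E)^\-)%E s2) => //.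
  under eq_fun do rewrite funenegE.
  by apply: measurable_maxe; [exact: measurableT_comp|exact: measurable_cst].
by split; exact: aux.
Qed.

Lemma cL1_cintegral (f : T1 -> T2 -> R[i]) :
  cmeas (fun p : T1 * T2 => f p.1 p.2) ->
  (\int[m1]_x \int[m2]_y (cmod (f x y))%:E < +oo)%E ->
  cL1 m1 (fun x => cintegral m2 (f x)).
Proof.
move=> mf fi; split; first exact: cmeas_cintegral.
apply: le_lt_trans fi; apply: ge0_le_integral => //.
- by move=> x _; rewrite lee_fin cmod_ge0.
- by apply/measurable_EFinP; apply: measurable_cmod; exact: cmeas_cintegral.
- apply: (measurable_integral (f := fun x y => (cmod (f x y))%:E) s2).
    by apply/measurable_EFinP; exact: (measurable_cmod mf).
  by move=> x y; rewrite lee_fin cmod_ge0.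
move=> x _; apply: cmod_cintegral_le.
have [rf imf] := mf; split.
  exact: (measurable_fun_pair2 x rf).
exact: (measurable_fun_pair2 x imf).
Qed.

Lemma ae_cL1_slice (f : T1 -> T2 -> R[i]) :
  cmeas (fun p : T1 * T2 => f p.1 p.2) ->
  (\int[m1]_x \int[m2]_y (cmod (f x y))%:E < +oo)%E ->
  {ae m1, forall x, cL1 m2 (f x)}.
Proof.
move=> mf fi.
have i1 : m1.-integrable setT (fun x => \int[m2]_y (cmod (f x y))%:E)%E.
  apply/integrableP; split.
    apply: (measurable_integral (f := fun x y => (cmod (f x y))%:E) s2).
      by apply/measurable_EFinP; exact: (measurable_cmod mf).
    by move=> x y; rewrite lee_fin cmod_ge0.
  have h x : (0 <= \int[m2]_y (cmod (f x y))%:E)%E.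
    by apply: integral_ge0 => y _; rewrite lee_fin cmod_ge0.
  by under eq_integral do rewrite gee0_abs//.
have := integrable_ae measurableT i1; apply: filterS => x /(_ I) fx.
have [rf imf] := mf; split.
  by split; [exact: (measurable_fun_pair2 x rf)|exact: (measurable_fun_pair2 x imf)].
by rewrite ltey_eq fx.
Qed.

End cfubini.

(** A positive factor fixes the infinite values, and [fine] sends [A - B] to 0 on both sides as soon
    as [A] or [B] is infinite. Substitutions therefore respect the default values of complex
    integrals. *)
Lemma fine_mulB {R : realType} (c : R) (A B : \bar R) : 0 < c ->
  (0 <= A)%E -> (0 <= B)%E ->
  fine (c%:E * A - c%:E * B)%E = c * fine (A - B)%E.
Proof.
move=> c0; have cy : (c%:E * +oo = +oo)%E by rewrite gt0_muley// lte_fin.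
case: A => [a| |] A0; last by [].
  case: B => [b| |] B0; last by [].
    by rewrite -!EFinM -!EFinB [LHS]/= [fine _]/= mulrBr.
  by rewrite cy [LHS]/= [fine _]/= mulr0.
case: B => [b| |] B0; last by [].
  by rewrite cy [LHS]/= [fine _]/= mulr0.
by rewrite cy [LHS]/= [fine _]/= mulr0.
Qed.

Section change_of_variables.
Context d d' (T : measurableType d) (T' : measurableType d') {R : realType}.
Context (mu : {measure set T -> \bar R}) (nu : {measure set T' -> \bar R}).
Variables (phi : T -> T') (c : R).
Hypotheses (c0 : 0 < c) (mphi : measurable_fun setT phi).
Hypothesis H : forall f : T' -> \bar R, measurable_fun setT f ->
  (forall x, 0 <= f x)%E -> (\int[mu]_x f (phi x) = c%:E * \int[nu]_x f x)%E.

Lemma Rintegral_change (f : T' -> R) : measurable_fun setT f ->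
  Rintegral mu setT (fun x => f (phi x)) = c * Rintegral nu setT f.
Proof.
move=> mf; have mfE : measurable_fun setT (fun x => (f x)%:E) by apply/measurable_EFinP.
rewrite /Rintegral integralE [in RHS]integralE.
have -> : (\int[mu]_x (fun x => (f (phi x))%:E)^\+ x =
    c%:E * \int[nu]_x (fun x => (f x)%:E)^\+ x)%E.
  rewrite -(H (measurable_funepos mfE) (funepos_ge0 _)).
  by apply: eq_integral => x _; rewrite !funeposE.
have -> : (\int[mu]_x (fun x => (f (phi x))%:E)^\- x =
    c%:E * \int[nu]_x (fun x => (f x)%:E)^\- x)%E.
  rewrite -(H (measurable_funeneg mfE) (funeneg_ge0 _)).
  by apply: eq_integral => x _; rewrite !funenegE.
by apply: fine_mulB => //; exact: integral_ge0.
Qed.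

Lemma cintegral_change (f : T' -> R[i]) : cmeas f ->
  cintegral mu (fun x => f (phi x)) = c%:C * cintegral nu f.
Proof.
move=> [rf imf]; rewrite /cintegral; apply: complex_ext; rewrite ?ReM ?ImM /=.
  by rewrite mul0r subr0; exact: (Rintegral_change rf).
by rewrite mul0r addr0; exact: (Rintegral_change imf).
Qed.

End change_of_variables.

(** * The rectangle form on L^2 *)

Lemma cintegral0 d (T : measurableType d) (R : realType)
  (mu : {measure set T -> \bar R}) : cintegral mu (cst (0 : R[i])) = 0.
Proof. by rewrite /cintegral /Rintegral /= integral0. Qed.

Section pairing.
Context {R : realType}.
Local Notation mR := (measurableTypeR R).
Implicit Types f g h : plane R -> R[i].

Definition leb4 : {measure set (plane R * plane R) -> \bar R} :=
  prodm (@sigma_finite_leb2 R) (@sigma_finite_leb2 R).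

Lemma sigma_finite_leb4 : sigma_finite setT leb4.
Proof. exact: sigma_finite_prodm. Qed.

(** A positive upper bound stands in for the L^2 norm: positivity lets the Young weight of
    [quad_slice_le] be formed without treating null functions apart. *)
Definition L2le f (n : R) :=
  [/\ 0 < n, cmeas f & (\int[leb2]_x (cmod (f x) ^+ 2)%:E <= (n ^+ 2)%:E)%E].

Lemma L2leP f : cmeas f -> (\int[leb2]_x (cmod (f x) ^+ 2)%:E < +oo)%E ->
  exists n, L2le f n.
Proof.
move=> mf fi; set I := (\int[leb2]_x _)%E in fi.
have I0 : (0 <= I)%E by apply: integral_ge0 => x _; rewrite lee_fin sqr_ge0.
have If : I \is a fin_num by rewrite ge0_fin_numE.
exists (fine I + 1); split => //; first by rewrite ltr_wpDl// fine_ge0.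
rewrite -/I -(fineK If) lee_fin.
have := fine_ge0 I0; move: (fine I) => r r0.
by rewrite (_ : fine r%:E = r)//; have := sqr_ge0 r; rewrite sqrrD expr1n mulr1; lra.
Qed.

Definition cquad f1 f2 f3 f4 (l : mR) (z x : plane R) : R[i] :=
  f1 (x + z) * f2 (smul l (perp x) + z) * (cj (f3 (x + smul l (perp x) + z))) *
  (cj (f4 z)).

Lemma cmeas_cquad f1 f2 f3 f4 : cmeas f1 -> cmeas f2 -> cmeas f3 -> cmeas f4 ->
  cmeas (fun p : (mR * plane R) * plane R => cquad f1 f2 f3 f4 p.1.1 p.1.2 p.2).
Proof.
move=> m1 m2 m3 m4; apply: cmeasM; last first.
  apply: cmeasJ; apply: (cmeas_comp m4 (g := fun p : (mR * plane R) * plane R => p.1.2)).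
  by measurability.
apply: cmeasM; last by apply: cmeasJ; exact: (cmeas_comp m3 measurable_rectC).
by apply: cmeasM; [exact: (cmeas_comp m1 measurable_rectA)|exact: (cmeas_comp m2 measurable_rectB)].
Qed.

Lemma cmod_cquad f1 f2 f3 f4 l z x : cmod (cquad f1 f2 f3 f4 l z x) =
  quad (cst 1%R) (fun x => cmod (f1 x)) (fun x => cmod (f2 x))
    (fun x => cmod (f3 x)) (fun x => cmod (f4 x)) l z x.
Proof. by rewrite /cquad /quad mul1r !cmodM !cmodJ. Qed.

Lemma cmeas_cquad_l f1 f2 f3 f4 l : cmeas f1 -> cmeas f2 -> cmeas f3 -> cmeas f4 ->
  cmeas (fun p : plane R * plane R => cquad f1 f2 f3 f4 l p.1 p.2).
Proof.
move=> m1 m2 m3 m4; have m := cmeas_cquad m1 m2 m3 m4.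
apply: (cmeas_comp m (g := fun p : plane R * plane R => ((l : mR, p.1), p.2))).
by measurability.
Qed.

Definition cform l f1 f2 f3 f4 : R[i] :=
  cintegral leb4 (fun p => cquad f1 f2 f3 f4 l p.1 p.2).

Lemma cquad_slice_le f1 f2 f3 f4 n1 n2 n3 n4 l :
  L2le f1 n1 -> L2le f2 n2 -> L2le f3 n3 -> L2le f4 n4 ->
  (\int[leb2]_z \int[leb2]_x (cmod (cquad f1 f2 f3 f4 l z x))%:E <=
   (kern l * (n1 * n2 * n3 * n4))%:E)%E.
Proof.
move=> [n10 m1 i1] [n20 m2 i2] [n30 m3 i3] [n40 m4 i4].
under eq_integral do under eq_integral do rewrite cmod_cquad.
rewrite -[kern l]mul1r.
apply: (@quad_slice_le R (cst 1%R)) => //;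
  solve [exact: measurable_cmod | by move=> x; exact: cmod_ge0].
Qed.

Lemma cL1_cquad f1 f2 f3 f4 n1 n2 n3 n4 l :
  L2le f1 n1 -> L2le f2 n2 -> L2le f3 n3 -> L2le f4 n4 ->
  cL1 leb4 (fun p => cquad f1 f2 f3 f4 l p.1 p.2).
Proof.
move=> h1 h2 h3 h4; have [n10 m1 i1] := h1; have [n20 m2 i2] := h2.
have [n30 m3 i3] := h3; have [n40 m4 i4] := h4.
apply: cL1_prodm; first exact: cmeas_cquad_l.
by apply: (le_lt_trans (cquad_slice_le l h1 h2 h3 h4)); rewrite ltry.
Qed.

Lemma int3_cquad_lty f1 f2 f3 f4 n1 n2 n3 n4 :
  L2le f1 n1 -> L2le f2 n2 -> L2le f3 n3 -> L2le f4 n4 ->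
  (int3 (fun l z x => cmod (cquad f1 f2 f3 f4 l z x)) < +oo)%E.
Proof.
move=> [n10 m1 i1] [n20 m2 i2] [n30 m3 i3] [n40 m4 i4].
rewrite /int3; under eq_integral do under eq_integral do under eq_integral do rewrite cmod_cquad.
apply: (@le_lt_trans _ _ (pi * (n1 * n2 * n3 * n4))%:E); last exact: ltry.
apply: (@int3_quad_le R (cst 1%R)) => //;
  try solve [exact: measurable_cmod | by move=> x; exact: cmod_ge0].
by under eq_integral do rewrite mul1r; rewrite integral_kernT.
Qed.

Lemma cmeas_cform f1 f2 f3 f4 : cmeas f1 -> cmeas f2 -> cmeas f3 -> cmeas f4 ->
  cmeas (fun l : mR => cform l f1 f2 f3 f4).
Proof.
move=> m1 m2 m3 m4; have m := cmeas_cquad m1 m2 m3 m4.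
apply: (cmeas_cintegral (f := fun (l : mR) (p : plane R * plane R) =>
  cquad f1 f2 f3 f4 l p.1 p.2) sigma_finite_leb4).
apply: (cmeas_comp m (g := fun q : mR * (plane R * plane R) => ((q.1, q.2.1), q.2.2))).
by measurability.
Qed.

Lemma ae_lty d (T : measurableType d) (mu : {measure set T -> \bar R})
    (F : T -> \bar R) : measurable_fun setT F -> (forall x, 0 <= F x)%E ->
  (\int[mu]_x F x < +oo)%E -> {ae mu, forall x, (F x < +oo)%E}.
Proof.
move=> mF F0 Fi; have iF : mu.-integrable setT F.
  by apply/integrableP; split => //; under eq_integral do rewrite gee0_abs//.
have := integrable_ae measurableT iF; apply: filterS => x /(_ I) fx.
by rewrite ltey_eq fx.
Qed.

Variables (omega : R) (phi : plane R -> R[i]) (n : R).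
Hypothesis phi_L2 : L2le phi n.
Hypothesis phi_eq : {ae @leb2 R, forall z : R * R,
  omega%:C * phi z = trilinear phi phi phi z}.

Lemma cL1_mulJ f g n1 n2 : L2le f n1 -> L2le g n2 -> cL1 leb2 (fun z => f z * (cj (g z))).
Proof.
move=> [n10 m1 i1] [n20 m2 i2].
apply: (@cL1_le _ _ _ _ _ (fun z => cmod (f z) ^+ 2 + cmod (g z) ^+ 2)).
- by apply: cmeasM => //; exact: cmeasJ.
- by apply: measurable_funD; apply: measurable_funX; exact: measurable_cmod.
- move=> z; rewrite cmodM cmodJ; have := sqr_ge0 (cmod (f z) - cmod (g z)).
  have := sqr_ge0 (cmod (f z) + cmod (g z)).
  by rewrite sqrrD sqrrB; lra.
under eq_integral do rewrite EFinD.
rewrite ge0_integralD//; try by [move=> x _; rewrite lee_fin sqr_ge0|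
  apply/measurable_EFinP; apply: measurable_funX; exact: measurable_cmod].
by apply: lte_add_pinfty; [apply: le_lt_trans i1 _|apply: le_lt_trans i2 _]; rewrite ltry.
Qed.

(** Absolute convergence of the triple integral lets Fubini exchange the shape with [z]. What
    remains is pointwise in [z]: the factor [cj (h z)] has to be taken out of two nested integrals,
    which is legitimate once these converge absolutely. *)
Lemma pairing h nh : L2le h nh ->
  omega%:C * cintegral leb2 (fun z => phi z * (cj (h z))) =
  cintegral leb (fun l => cform l phi phi phi h).
Proof.
move=> hh; have [_ mphi _] := phi_L2; have [_ mh _] := hh.
pose K (l : mR) z x := cquad phi phi phi h l z x.
have mK : cmeas (fun p : (mR * plane R) * plane R => K p.1.1 p.1.2 p.2) by exact: cmeas_cquad.
have Ki := int3_cquad_lty phi_L2 phi_L2 phi_L2 hh.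
have mKn : meas3 (fun l z x => cmod (K l z x)) by exact: measurable_cmod mK.
have Kn0 l z x : 0 <= cmod (K l z x) by exact: cmod_ge0.
pose G (l : mR) (z : plane R) := cintegral leb2 (K l z).
have mG : cmeas (fun p : mR * plane R => G p.1 p.2).
  exact: (cmeas_cintegral (f := fun (p : mR * plane R) x => K p.1 p.2 x) sigma_finite_leb2 mK).
have mKz : measurable_fun setT (fun p : mR * plane R => \int[leb2]_x (cmod (K p.1 p.2 x))%:E)%E.
  exact: (measurable_int_x mKn Kn0).
have mKlz l z : cmeas (K l z).
  have [rK iK] := mK; split; first exact: (@meas3_slice R (fun l z x => complex.Re (K l z x)) l z rK).
  exact: (@meas3_slice R (fun l z x => complex.Im (K l z x)) l z iK).
have GK l z : ((cmod (G l z))%:E <= \int[leb2]_x (cmod (K l z x))%:E)%E.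
  exact: cmod_cintegral_le.
have Gi : (\int[leb]_l \int[leb2]_z (cmod (G l z))%:E < +oo)%E.
  apply: le_lt_trans Ki; apply: ge0_le_integral => //.
  - by move=> l _; apply: integral_ge0 => z _; rewrite lee_fin cmod_ge0.
  - apply: (measurable_integral (f := fun l z => (cmod (G l z))%:E) sigma_finite_leb2).
      by apply/measurable_EFinP; exact: (measurable_cmod mG).
    by move=> *; rewrite lee_fin cmod_ge0.
  - exact: measurable_int_zx.
  move=> l _; apply: ge0_le_integral => //.
  - by move=> z _; rewrite lee_fin cmod_ge0.
  - apply/measurable_EFinP.
    exact: (measurable_fun_pair2 l (measurable_cmod mG)).
  - exact: (measurable_fun_pair2 l mKz).
have -> : cintegral leb (fun l => cform l phi phi phi h) =
    cintegral leb (fun l => cintegral leb2 (G l)).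
  apply: eq_cintegral => l.
  by rewrite /cform cintegral_prodm//; exact: (cL1_cquad l phi_L2 phi_L2 phi_L2 hh).
rewrite (cfubini sigma_finite_leb sigma_finite_leb2 (f := G))//.
rewrite -cintegralZl; last exact: (cL1_mulJ phi_L2 hh).
have mGswap : cmeas (fun p : plane R * mR => G p.2 p.1).
  apply: (cmeas_comp mG (g := fun p : plane R * mR => (p.2, p.1))).
  by measurability.
apply: ae_eq_cintegral.
- apply: cmeasM; first exact: cmeas_cst.
  by apply: cmeasM => //; exact: cmeasJ.
- exact: (cmeas_cintegral (f := fun z l => G l z) sigma_finite_leb).
have Kz : {ae @leb2 R, forall z, (\int[leb]_l \int[leb2]_x (cmod (K l z x))%:E < +oo)%E}.
  apply: ae_lty.
  - apply: (measurable_integral (f := fun z l => \int[leb2]_x (cmod (K l z x))%:E)%E sigma_finite_leb).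
      apply: (measurableT_comp mKz (g := fun p : plane R * mR => (p.2, p.1))).
      by measurability.
    by move=> z l; apply: integral_ge0 => x _; rewrite lee_fin.
  - by move=> z; do 2!apply: integral_ge0 => ? _; rewrite lee_fin.
  rewrite -(tonelli (f := fun l z => \int[leb2]_x (cmod (K l z x))%:E)%E sigma_finite_leb sigma_finite_leb2)//.
  by move=> l z; apply: integral_ge0 => x _; rewrite lee_fin.
apply: (@filterS2 _ _ (ae_filter_ringOfSetsType (@leb2 R)) _ _ _ _ phi_eq Kz) => z ez {}Kz.
rewrite mulrA ez.
(* Where [h z = 0] the convergence of [trilinear] cannot be inferred from that of [K], but both
   sides vanish. *)
have [hz|hz] := eqVneq (h z) 0.
  rewrite hz cj0 mulr0 /G; apply/esym.
  have e l : cintegral leb2 (K l z) = 0.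
    rewrite (@eq_cintegral _ _ _ _ _ (cst 0)); last by move=> x; rewrite /K /cquad hz cj0 mulr0.
    exact: cintegral0.
  rewrite (@eq_cintegral _ _ _ _ _ (cst 0))//.
  exact: cintegral0.
(* This is the integrand of [trilinear] at [z]. Its modulus is that of [K] divided by the positive
   number [cmod (h z)], which makes it absolutely integrable. *)
pose k (l : mR) x := phi (x + z) * phi (smul l (perp x) + z) * (cj (phi (x + smul l (perp x) + z))).
have KE l x : K l z x = k l x * (cj (h z)) by [].
have c0 : 0 < cmod (h z).
  by rewrite lt_neqAle cmod_ge0 andbT eq_sym; apply: contra_neq hz => /cmod_eq0.
have mk : cmeas (fun p : mR * plane R => k p.1 p.2).
  have mm : measurable_fun setT (fun p : mR * plane R => ((p.1, z), p.2)) by measurability.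
  apply: cmeasM; last first.
    by apply: cmeasJ; exact: (cmeas_comp mphi (measurableT_comp measurable_rectC mm)).
  apply: cmeasM; first exact: (cmeas_comp mphi (measurableT_comp measurable_rectA mm)).
  exact: (cmeas_comp mphi (measurableT_comp measurable_rectB mm)).
have kE l x : (cmod (k l x))%:E = ((cmod (h z))^-1%:E * (cmod (K l z x))%:E)%E.
  by rewrite KE cmodM cmodJ -EFinM mulrCA mulVf ?mulr1// gt_eqF.
have mKx l : measurable_fun setT (fun x => (cmod (K l z x))%:E).
  by apply/measurable_EFinP; exact: measurable_cmod.
have kint l : (\int[leb2]_x (cmod (k l x))%:E =
    (cmod (h z))^-1%:E * \int[leb2]_x (cmod (K l z x))%:E)%E.
  under eq_integral do rewrite kE.
  rewrite ge0_integralZl//; first by move=> x _; rewrite lee_fin.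
  by rewrite lee_fin invr_ge0 ltW.
have ki : (\int[leb]_l \int[leb2]_x (cmod (k l x))%:E < +oo)%E.
  under eq_integral do rewrite kint.
  rewrite ge0_integralZl//.
  - by rewrite lte_mul_pinfty// lee_fin invr_ge0 ltW.
  - exact: (measurable_fun_pair1 z mKz).
  - by move=> l _; apply: integral_ge0 => x _; rewrite lee_fin.
  - by rewrite lee_fin invr_ge0 ltW.
have lk := cL1_cintegral sigma_finite_leb2 mk ki.
rewrite /trilinear -/(k _ _) -cintegralZr; last exact: lk.
apply: ae_eq_cintegral.
- by apply: cmeasM; [exact: lk.1|exact: cmeas_cst].
- have [rG iG] := mG; split; first exact: (measurable_fun_pair1 z rG).
  exact: (measurable_fun_pair1 z iG).
have := ae_cL1_slice sigma_finite_leb2 mk ki; apply: filterS => l lkl.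
by rewrite /G -cintegralZr.
Qed.

End pairing.

(** * Fourier invariance of the rectangle form *)

Section fourier.
Context {R : realType}.
Local Notation mR := (measurableTypeR R).
Implicit Types f g h : plane R -> R[i].

Definition kappa : R := (2 * pi)^-1.

Lemma kappa_gt0 : 0 < kappa.
Proof. by rewrite invr_gt0 mulr_gt0// pi_gt0. Qed.

Lemma fourier1E f xi : fourier1 f xi =
  kappa%:C * cintegral leb2 (fun x => f x * expi (- edot x xi)).
Proof.
by rewrite /fourier1; congr (_ * _); apply: eq_cintegral => x; rewrite /expi cosN sinN.
Qed.

Lemma measurable_edot d (T : measurableType d) (x y : T -> plane R) :
  measurable_fun setT x -> measurable_fun setT y ->
  measurable_fun setT (fun t => edot (x t) (y t)).
Proof. by move=> mx my; rewrite /edot; measurability. Qed.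

Lemma cL1_expi d (T : measurableType d) (mu : {measure set T -> \bar R})
    (f : T -> R[i]) (h : T -> R) : cL1 mu f -> measurable_fun setT h ->
  cL1 mu (fun x => f x * expi (h x)).
Proof.
move=> [mf fi] mh; split; first by apply: cmeasM => //; exact: cmeas_expi.
by under eq_integral do rewrite cmodM cmod_expi mulr1.
Qed.

Lemma measurable_edotN y : measurable_fun setT (fun x : plane R => - edot x y).
Proof. by apply: measurableT_comp => //; apply: measurable_edot; measurability. Qed.

Lemma cmeas_fourier1 f : cmeas f -> cmeas (fourier1 f : plane R -> R[i]).
Proof.
move=> mf; rewrite (funext (fourier1E f)).
apply: cmeasM; first exact: cmeas_cst.
apply: (cmeas_cintegral (f := fun xi x => f x * expi (- edot x xi)) sigma_finite_leb2).
apply: cmeasM; first exact: (cmeas_comp mf measurable_snd).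
apply: cmeas_expi; apply: measurableT_comp => //.
by apply: measurable_edot; measurability.
Qed.

Lemma cmod_fourier1_le f xi : cmeas f ->
  ((cmod (fourier1 f xi))%:E <= kappa%:E * \int[leb2]_x (cmod (f x))%:E)%E.
Proof.
move=> mf; rewrite fourier1E cmodM cmod_real gtr0_norm ?kappa_gt0// EFinM.
apply: lee_wpmul2l; first by rewrite lee_fin ltW// kappa_gt0.
have m : cmeas (fun x => f x * expi (- edot x xi)).
  by apply: cmeasM => //; apply: cmeas_expi; exact: measurable_edotN.
apply: (le_trans (cmod_cintegral_le _ m)).
by under eq_integral do rewrite cmodM cmod_expi mulr1.
Qed.

Lemma fourier1_bounded f : cL1 leb2 f -> exists2 M, 0 < M &
  forall xi, cmod (fourier1 f xi) <= M.
Proof.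
move=> [mf fi]; set I := (\int[leb2]_x _)%E in fi.
have I0 : (0 <= I)%E by apply: integral_ge0 => x _; rewrite lee_fin cmod_ge0.
have If : I \is a fin_num by rewrite ge0_fin_numE.
exists (kappa * fine I + 1).
  by rewrite ltr_wpDl// mulr_ge0 ?fine_ge0// ltW// kappa_gt0.
move=> xi; have := cmod_fourier1_le xi mf; rewrite -/I -(fineK If) -EFinM lee_fin.
by move=> h; rewrite (le_trans h)// lerDl.
Qed.

(** The inverse transform, written as a twofold conjugate so that measurability and bounds carry
    over from [fourier1]; [iftE] gives the usual formula. *)
Definition ift g (x : plane R) : R[i] := cj (fourier1 (fun xi => cj (g xi)) x).

Lemma cmeas_ift g : cmeas g -> cmeas (ift g).
Proof. by move=> mg; apply: cmeasJ; apply: cmeas_fourier1; exact: cmeasJ. Qed.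

Lemma iftE g x : cL1 leb2 g ->
  ift g x = kappa%:C * cintegral leb2 (fun xi => g xi * expi (edot x xi)).
Proof.
move=> lg; rewrite /ift fourier1E cjM cj_real -cintegralJ; last first.
  by apply: cL1_expi; [exact: cL1J|exact: measurable_edotN].
congr (_ * _); apply: eq_cintegral => xi.
rewrite cjM cjK expiN cjK; congr (_ * expi _).
by rewrite /edot [x.1 * _]mulrC [x.2 * _]mulrC.
Qed.

Definition conf_pair (a b a' b' : R) (p : plane R * plane R) : plane R * plane R :=
  (conf a b p.2 + p.1, conf a' b' p.2 + p.1).

Lemma measurable_pairmap a b a' b' : measurable_fun setT (conf_pair a b a' b').
Proof.
by apply: measurable_fun_pair; apply: measurable_addV; try exact: measurable_fst;
  apply: measurable_conf; try exact: measurable_cst; exact: measurable_snd.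
Qed.

Lemma cintegral_pairmap (a b a' b' : R) (H : plane R * plane R -> R[i]) :
  0 < (a' - a) ^+ 2 + (b' - b) ^+ 2 -> cmeas H ->
  cintegral leb4 (fun p => H (conf_pair a b a' b' p)) =
  ((a' - a) ^+ 2 + (b' - b) ^+ 2)^-1%:C * cintegral leb4 H.
Proof.
move=> D0 mH; apply: (cintegral_change (mu := leb4) (nu := leb4)) => //.
  by rewrite invr_gt0.
move=> F mF F0; rewrite integral_prodm//; last first.
  exact: (measurableT_comp mF (measurable_pairmap _ _ _ _)).
rewrite (integral_prodm _ _ mF F0).
by apply: integral_pair => //; rewrite gt_eqF.
Qed.

(** The complex quotient [(q.1 - i l q.2) / (1 - i l)]: the vertex [c] of the rectangle of shape [l]
    whose other diagonal is [(a, b) = q]. The remaining vertex is [q.1 + q.2 - dual_c l q]. *)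
Definition dual_c (l : R) (q : plane R * plane R) : plane R :=
  conf (kern l) (kern l * l) (q.1 - conf 0 l q.2).

Lemma kern_neq0 (l : R) : 1 + l ^+ 2 != 0.
Proof. by rewrite gt_eqF// ltr_wpDr// sqr_ge0. Qed.

Lemma measurable_oppV d (T : measurableType d) (x : T -> plane R) :
  measurable_fun setT x -> measurable_fun setT (fun t => - x t : plane R).
Proof.
move=> mx; rewrite (_ : (fun t => _) = fun t => (- (x t).1, - (x t).2))//.
by measurability.
Qed.

Lemma measurable_dual_c l : measurable_fun setT (dual_c l).
Proof.
apply: measurable_conf; [exact: measurable_cst|exact: measurable_cst|].
apply: measurable_addV; first exact: measurable_fst.
apply: measurable_oppV.
by apply: measurable_conf; [exact: measurable_cst|exact: measurable_cst|exact: measurable_snd].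
Qed.

Lemma kernK (l : R) : kern l * (1 + l ^+ 2) = 1.
Proof. by rewrite mulVf// kern_neq0. Qed.

(** For fixed [l] the map from the diagonal [(a, b)] to the diagonal [(c, d)] is linear and
    preserves the sum of the squared lengths, hence is orthogonal on R^4. The identity is its
    polarization, and it is the reason why the transform keeps the shape of the rectangles. *)
Lemma dual_phase (l : R) (p q : plane R * plane R) :
  edot q.1 (p.2 + p.1) + edot q.2 (smul l (perp p.2) + p.1) =
  edot (p.2 + smul l (perp p.2) + p.1) (dual_c l q) +
  edot p.1 (q.1 + q.2 - dual_c l q).
Proof.
have h := kernK l.
rewrite /edot /dual_c /conf /smul /perp /=; move: (kern l) h => k h.
case: p => [[z1 z2] [x1 x2]]; case: q => [[a1 a2] [b1 b2]] /=.
apply/eqP; rewrite -subr_eq0; apply/eqP.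
transitivity ((x1 * (a1 + l * b2) + x2 * (a2 - l * b1)) * (1 - k * (1 + l ^+ 2))).
  by ring.
by rewrite h subrr mulr0.
Qed.

Lemma dual_cE (l : R) (p : plane R * plane R) :
  dual_c l (p.2 + p.1, smul l (perp p.2) + p.1) = p.2 + smul l (perp p.2) + p.1.
Proof.
have h := kernK l.
rewrite /dual_c /conf /smul /perp /=; move: (kern l) h => k h.
case: p => [[z1 z2] [x1 x2]] /=; congr (_, _) => /=.
  transitivity ((x1 + l * - x2 + z1) * (k * (1 + l ^+ 2))); first by ring.
  by rewrite h mulr1.
transitivity ((x2 + l * x1 + z2) * (k * (1 + l ^+ 2))); first by ring.
by rewrite h mulr1.
Qed.

Lemma cquad_pairmap l f1 f2 f3 f4 (p : plane R * plane R) :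
  [/\ p.2 + p.1 = (conf_pair 1 0 0 l p).1, smul l (perp p.2) + p.1 = (conf_pair 1 0 0 l p).2,
    p.2 + smul l (perp p.2) + p.1 = (conf_pair 0 0 1 l p).2 & p.1 = (conf_pair 0 0 1 l p).1].
Proof.
have [e1 e2 e3 e4] := rect_conf l p.2 p.1.
by rewrite /conf_pair /= -e1 -e2 -e3 -e4.
Qed.

(* The multiplication formula [int f^ g = int f g^] on the space of pairs. *)
Lemma cform_fourier l f1 f2 g3 g4 :
  cL1 leb2 f1 -> cL1 leb2 f2 -> cL1 leb2 g3 -> cL1 leb2 g4 ->
  cform l f1 f2 (ift g3) (ift g4) = cform l (fourier1 f1) (fourier1 f2) g3 g4.
Proof.
move=> l1 l2 l3 l4; have [m1 i1] := l1; have [m2 i2] := l2.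
have [m3 i3] := l3; have [m4 i4] := l4.
pose G3 xi := cj (g3 xi); pose G4 xi := cj (g4 xi).
have lG3 : cL1 leb2 G3 by exact: cL1J.
have lG4 : cL1 leb2 G4 by exact: cL1J.
have mF3 : cmeas (fourier1 G3 : plane R -> R[i]) by apply: cmeas_fourier1; exact: lG3.1.
have mF4 : cmeas (fourier1 G4 : plane R -> R[i]) by apply: cmeas_fourier1; exact: lG4.1.
pose s q : plane R := q.1 + q.2 - dual_c l q.
have ms : measurable_fun setT s.
  rewrite (_ : s = fun q => (q.1 + q.2 : plane R) + (- (dual_c l q).1, - (dual_c l q).2))//.
  have mc := measurable_dual_c l.
  apply: measurable_addV; first by apply: measurable_addV; measurability.
  by measurability.
pose H q := f1 q.1 * f2 q.2 * fourier1 G3 (dual_c l q) * fourier1 G4 (s q).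
have mf12 : cmeas (fun q : plane R * plane R => f1 q.1 * f2 q.2).
  by apply: cmeasM; [exact: (cmeas_comp m1)|exact: (cmeas_comp m2)].
have mH : cmeas H.
  apply: cmeasM; last exact: (cmeas_comp mF4 ms).
  by apply: cmeasM => //; exact: (cmeas_comp mF3 (measurable_dual_c l)).
have D1 : 0 < (0 - 1) ^+ 2 + (l - 0) ^+ 2 by rewrite sub0r subr0 sqrrN expr1n ltr_wpDr// sqr_ge0.
have D2 : 0 < (1 - 0) ^+ 2 + (l - 0) ^+ 2 by rewrite !subr0 expr1n ltr_wpDr// sqr_ge0.
(* In the variables [(a, b)] of one diagonal, the vertices [c] and [d] become functions of the pair
   and the Jacobian contributes [kern l]. *)
have -> : cform l f1 f2 (ift g3) (ift g4) = (kern l)%:C * cintegral leb4 H.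
  rewrite (_ : kern l = ((0 - 1) ^+ 2 + (l - 0) ^+ 2)^-1); last first.
    by rewrite sub0r subr0 sqrrN expr1n.
  rewrite -(cintegral_pairmap D1 mH).
  apply: eq_cintegral => p.
  have [e1 e2 e3 e4] := cquad_pairmap l f1 f2 f1 f1 p.
  rewrite /cquad /H /ift !cjK.
  have eq1 : conf_pair 1 0 0 l p = (p.2 + p.1, smul l (perp p.2) + p.1).
    by rewrite e1 e2; case: (conf_pair _ _ _ _ _).
  rewrite eq1 /s dual_cE /=; congr (_ * fourier1 G4 _).
  by rewrite [p.2 + p.1 + _]addrACA [_ + (p.1 + p.1)]addrA [_ + p.1 + p.1]addrC addrK.
(* The other side: [p] runs over the rectangles on the frequency side and [q] over the two variables
   of integration of the transforms. *)
pose K p q := (kappa ^+ 2)%:C * (G3 (p.2 + smul l (perp p.2) + p.1) * G4 p.1) *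
  ((f1 q.1 * f2 q.2) * expi (- (edot q.1 (p.2 + p.1) + edot q.2 (smul l (perp p.2) + p.1)))).
have mA : measurable_fun setT (fun p : plane R * plane R => p.2 + p.1 : plane R).
  by apply: measurable_addV; measurability.
have mB : measurable_fun setT (fun p : plane R * plane R => smul l (perp p.2) + p.1 : plane R).
  by apply: measurable_addV; rewrite /smul /perp /=; measurability.
have mC : measurable_fun setT (fun p : plane R * plane R => p.2 + smul l (perp p.2) + p.1 : plane R).
  by apply: measurable_addV; [apply: measurable_addV|]; rewrite /smul /perp /=; measurability.
have lf12 : cL1 leb4 (fun q : plane R * plane R => f1 q.1 * f2 q.2).
  exact: cL1_prodm_tensor.
have mphase : measurable_fun setT (fun pq : (plane R * plane R) * (plane R * plane R) =>
    - (edot pq.2.1 (pq.1.2 + pq.1.1) + edot pq.2.2 (smul l (perp pq.1.2) + pq.1.1))).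
  apply: measurableT_comp => //; apply: measurable_funD; apply: measurable_edot.
  - by measurability.
  - exact: (measurableT_comp mA measurable_fst).
  - by measurability.
  - exact: (measurableT_comp mB measurable_fst).
have mK : cmeas (fun pq : (plane R * plane R) * (plane R * plane R) => K pq.1 pq.2).
  apply: cmeasM.
    apply: cmeasM; first exact: cmeas_cst.
    apply: cmeasM; first exact: (cmeas_comp lG3.1 (measurableT_comp mC measurable_fst)).
    by apply: (cmeas_comp lG4.1 (g := fun pq : (plane R * plane R) * (plane R * plane R) => pq.1.1)); measurability.
  apply: cmeasM; last exact: cmeas_expi.
  exact: (cmeas_comp mf12 measurable_snd).
have -> : cform l (fourier1 f1) (fourier1 f2) g3 g4 =
    cintegral leb4 (fun p => cintegral leb4 (K p)).
  apply: eq_cintegral => p; rewrite /K cintegralZl; last first.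
    apply: cL1_expi => //; apply: measurableT_comp => //.
    by apply: measurable_funD; apply: measurable_edot; measurability.
  rewrite /cquad -/(G3 _) -/(G4 _) !fourier1E.
  rewrite [X in _ = _ * X](_ : _ = cintegral leb2 (fun x => f1 x * expi (- edot x (p.2 + p.1))) *
    cintegral leb2 (fun x => f2 x * expi (- edot x (smul l (perp p.2) + p.1)))).
    by rewrite [in RHS]expr2 rmorphM/=; ring.
  rewrite -(cintegral_prodm_tensor sigma_finite_leb2 sigma_finite_leb2); try by apply: cL1_expi => //; exact: measurable_edotN.
  by apply: eq_cintegral => q; rewrite opprD expiD mulrACA.
pose W0 p := G4 p.1 * G3 p.2.
have lW0 : cL1 leb4 W0 by exact: cL1_prodm_tensor.
(* In the variables [(d, c)] of the other diagonal the integrand is a tensor product of integrable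
   functions. *)
have iW : (\int[leb4]_p (cmod (G3 (p.2 + smul l (perp p.2) + p.1) * G4 p.1))%:E < +oo)%E.
  have E : (\int[leb4]_p (cmod (G3 (p.2 + smul l (perp p.2) + p.1) * G4 p.1))%:E =
     \int[leb4]_p (cmod (W0 (conf_pair 0 0 1 l p)))%:E)%E.
    apply: eq_integral => p _; have [_ _ e3 e4] := cquad_pairmap l f1 f2 f1 f1 p.
    by rewrite /W0 -e3 -e4 mulrC.
  have mW0 : measurable_fun setT (fun p => (cmod (W0 p))%:E).
    by apply/measurable_EFinP; exact: measurable_cmod lW0.1.
  have W00 p : (0 <= (cmod (W0 p))%:E)%E by rewrite lee_fin cmod_ge0.
  rewrite E integral_prodm//; last first.
    exact: (measurableT_comp mW0 (measurable_pairmap _ _ _ _)).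
  rewrite [X in (X < _)%E](@integral_pair R 0 0 1 l (fun p => (cmod (W0 p))%:E))//; last by rewrite gt_eqF.
  rewrite -(integral_prodm sigma_finite_leb2 sigma_finite_leb2 mW0 W00).
  by rewrite lte_mul_pinfty ?lee_fin ?invr_ge0 ?(ltW D2)//; exact: lW0.2.
have iK : (\int[leb4]_p \int[leb4]_q (cmod (K p q))%:E < +oo)%E.
  have E p : (\int[leb4]_q (cmod (K p q))%:E = (kappa ^+ 2)%:E *
      (cmod (G3 (p.2 + smul l (perp p.2) + p.1) * G4 p.1))%:E *
      \int[leb4]_q (cmod (f1 q.1 * f2 q.2))%:E)%E.
    rewrite -ge0_integralZl//.
    - apply: eq_integral => q _.
      by rewrite /K [cmod (_ * (_ * expi _))]cmodM [cmod (_ * expi _)]cmodM cmod_expi mulr1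
        [cmod (_%:C * _)]cmodM cmod_real ger0_norm ?sqr_ge0// !EFinM.
    - by apply/measurable_EFinP; exact: measurable_cmod lf12.1.
    - by move=> q _; rewrite lee_fin cmod_ge0.
    - by rewrite -EFinM lee_fin mulr_ge0 ?sqr_ge0 ?cmod_ge0.
  under eq_integral do rewrite E.
  rewrite ge0_integralZr//; last 3 first.
  - apply: measurable_funeM; apply/measurable_EFinP; apply: measurable_cmod.
    by apply: cmeasM; [exact: (cmeas_comp lG3.1 mC)|exact: (cmeas_comp lG4.1)].
  - by move=> p _; rewrite -EFinM lee_fin mulr_ge0 ?sqr_ge0 ?cmod_ge0.
  - by apply: integral_ge0 => q _; rewrite lee_fin cmod_ge0.
  rewrite ge0_integralZl//; last 3 first.
  - apply/measurable_EFinP; apply: measurable_cmod.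
    by apply: cmeasM; [exact: (cmeas_comp lG3.1 mC)|exact: (cmeas_comp lG4.1)].
  - by move=> p _; rewrite lee_fin cmod_ge0.
  - by rewrite lee_fin sqr_ge0.
  have [_ i12] := lf12.
  have I0 : (0 <= \int[leb4]_p (cmod (G3 (p.2 + smul l (perp p.2) + p.1) * G4 p.1))%:E)%E.
    by apply: integral_ge0 => q _; rewrite lee_fin cmod_ge0.
  rewrite -(@fineK _ (\int[leb4]_p (cmod (G3 (p.2 + smul l (perp p.2) + p.1) * G4 p.1))%:E)%E) ?ge0_fin_numE//.
  by rewrite -EFinM lte_mul_pinfty// lee_fin mulr_ge0 ?sqr_ge0 ?fine_ge0.
rewrite (cfubini sigma_finite_leb4 sigma_finite_leb4 mK iK).
have mexps : cmeas (fun q : plane R * plane R => fourier1 G3 (dual_c l q) * fourier1 G4 (s q)).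
  by apply: cmeasM; [exact: (cmeas_comp mF3 (measurable_dual_c l))|exact: (cmeas_comp mF4 ms)].
have lH : cL1 leb4 H.
  have [M3 M30 hM3] := fourier1_bounded lG3; have [M4 M40 hM4] := fourier1_bounded lG4.
  apply: (@cL1_le _ _ _ _ _ (fun q => cmod ((M3 * M4)%:C * (f1 q.1 * f2 q.2)))) => //.
  - by apply: measurable_cmod; apply: cmeasM => //; exact: cmeas_cst.
  - move=> q; rewrite /H -[_ * _ * fourier1 G3 _ * _]mulrA [cmod (_ * (_ * _))]cmodM
      [leRHS]cmodM mulrC ler_wpM2r ?cmod_ge0// cmod_real cmodM.
    by rewrite gtr0_norm ?mulr_gt0// ler_pM ?cmod_ge0.
  - exact: (cL1Z (M3 * M4)%:C lf12).2.
rewrite -cintegralZl//.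
apply: eq_cintegral => q.
(* By [dual_phase] the oscillating factor depends on [c] and [d] separately, so the integral over
   the rectangles is a product of two transforms. *)
pose e4f d := G4 d * expi (- edot d (s q)).
pose e3f c := G3 c * expi (- edot c (dual_c l q)).
have le3f : cL1 leb2 e3f by apply: cL1_expi => //; exact: measurable_edotN.
have le4f : cL1 leb2 e4f by apply: cL1_expi => //; exact: measurable_edotN.
pose W1 p := e4f p.1 * e3f p.2.
have lW1 : cL1 leb4 W1 by exact: cL1_prodm_tensor.
have e p : K p q = (kappa ^+ 2)%:C * (f1 q.1 * f2 q.2) * W1 (conf_pair 0 0 1 l p).
  have [_ _ e3 e4] := cquad_pairmap l f1 f2 f1 f1 p.
  rewrite /W1 -e3 -e4 /e3f /e4f /K dual_phase opprD expiD -/(s q).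
  by ring.
under eq_cintegral do rewrite e.
have lWp : cL1 leb4 (fun p => W1 (conf_pair 0 0 1 l p)).
  split; first exact: (cmeas_comp lW1.1 (measurable_pairmap _ _ _ _)).
  apply: le_lt_trans iW; apply: ge0_le_integral => //.
  - by move=> p _; rewrite lee_fin cmod_ge0.
  - apply/measurable_EFinP; apply: measurable_cmod.
    exact: (cmeas_comp lW1.1 (measurable_pairmap _ _ _ _)).
  - apply/measurable_EFinP; apply: measurable_cmod.
    by apply: cmeasM; [exact: (cmeas_comp lG3.1 mC)|exact: (cmeas_comp lG4.1)].
  - move=> p _; have [_ _ e3 e4] := cquad_pairmap l f1 f2 f1 f1 p.
    rewrite /W1 /e4f /e3f -e3 -e4 lee_fin !cmodM !cmod_expi !mulr1.
    by rewrite mulrC.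
rewrite cintegralZl// (cintegral_pairmap D2 lW1.1).
rewrite (_ : (1 - 0) ^+ 2 + (l - 0) ^+ 2 = 1 + l ^+ 2); last by rewrite !subr0 expr1n.
rewrite -/(kern l) /W1 cintegral_prodm_tensor//.
rewrite /H !fourier1E -/e3f -/e4f [in RHS]expr2 rmorphM/=.
by ring.
Qed.

End fourier.

(** * Continuity of translations *)

Lemma ae_dominated_to0 d (T : measurableType d) (R : realType)
    (mu : {measure set T -> \bar R}) (f_ : nat -> T -> \bar R) (g : T -> \bar R) (e : R) :
  (forall n, measurable_fun setT (f_ n)) -> measurable_fun setT g ->
  {ae mu, forall x, f_ ^~ x @ \oo --> 0%E} ->
  (forall n x, 0 <= f_ n x <= g x)%E -> (\int[mu]_x g x < +oo)%E -> 0 < e ->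
  \forall n \near \oo, (\int[mu]_x f_ n x <= e%:E)%E.
Proof.
move=> mf mg f0 fg gi e0.
have g0 x : (0 <= g x)%E by have /andP[h1 h2] := fg 0%N x; exact: le_trans h2.
have ig : mu.-integrable setT g.
  apply/integrableP; split => //.
  by under eq_integral do rewrite gee0_abs//.
have /fine_cvgP[fH /cvgrPdist_le cH] : (\int[mu]_x f_ n x)%E @[n --> \oo] --> 0%:E.
  have -> : 0%:E = (\int[mu]_x cst 0%:E x)%E by rewrite integral0.
  have [] := @dominated_convergence _ _ _ mu setT measurableT f_ (cst 0%:E) g mf.
  - exact: measurable_cst.
  - by apply: filterS f0 => x h _.
  - exact: ig.
  - by apply: aeW => x n _; have /andP[h1 h2] := fg n x; rewrite gee0_abs.
  - by [].
near=> n.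
have hf : (\int[mu]_x f_ n x)%E \is a fin_num by near: n.
rewrite -(fineK hf) lee_fin.
have : `|0 - fine (\int[mu]_x f_ n x)| <= e by near: n; exact: cH.
by rewrite sub0r normrN; apply: le_trans; exact: ler_norm.
Unshelve. all: by end_near. Qed.

Section translation1.
Context {R : realType}.
Local Notation mR := (measurableTypeR R).

Lemma integral_shift1 (s : R) (f : mR -> \bar R) :
  measurable_fun setT f -> (forall x, 0 <= f x)%E ->
  (\int[leb]_x f (x + s)%R = \int[leb]_x f x)%E.
Proof.
move=> mf f0; rewrite -[RHS]mul1e -{1}(invr1 R) -(normr1 R).
rewrite -(@integral_affine R 1 s f)// ?oner_eq0//.
by apply: eq_integral => x _; rewrite mul1r.
Qed.

Definition cutoff (N : R) (x : mR) : R := Num.max 0 (Num.min 1 (N + 1 - `|x|)).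

Lemma cutoff01 N x : 0 <= cutoff N x <= 1.
Proof.
rewrite /cutoff le_max lexx/= ge_max ler01/=.
by rewrite ge_min lexx.
Qed.

Lemma cutoff_out N x : N + 1 <= `|x| -> cutoff N x = 0.
Proof.
move=> h; rewrite /cutoff max_l// ge_min; apply/orP; right.
by rewrite subr_le0.
Qed.

Lemma cutoff_in N x : `|x| <= N -> cutoff N x = 1.
Proof.
move=> h; rewrite /cutoff min_l; first by rewrite max_r.
by rewrite lerBrDr addrC lerD2r.
Qed.

Lemma continuous_cutoff N : continuous (cutoff N : R -> R).
Proof.
move=> x; apply: (@continuous_max _ _ (cst 0) (fun y => Num.min 1 (N + 1 - `|y|))).
  exact: cvg_cst.
apply: (@continuous_min _ _ (cst 1) (fun y => N + 1 - `|y|)); first exact: cvg_cst.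
by apply: cvgB; [exact: cvg_cst|exact: norm_continuous].
Qed.

Lemma cutoff_dist (a b c : R) : 0 <= c <= 1 -> `|a - b * c| <= `|a - b| + `|a|.
Proof.
move=> /andP[c0 c1].
rewrite (_ : a - b * c = c * (a - b) + (1 - c) * a); last by ring.
rewrite (le_trans (ler_normD _ _))// !normrM lerD//.
  by rewrite ler_piMl// ger0_norm.
by rewrite ler_piMl// ger0_norm ?subr_ge0// gerBl.
Qed.

Lemma integral_ball_lty (c r : R) : 0 <= c ->
  (\int[leb]_(x in [set: mR]) (c * (`|x| <= r)%R%:R)%:E < +oo)%E.
Proof.
move=> c0; rewrite (_ : (fun x => _) = (fun x => c%:E * (\1_(`[(- r), r]%classic) x)%:E)%E); last first.
  by apply/funext => x; rewrite indicE mem_setE in_itv/= ler_norml EFinM.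
rewrite ge0_integralZl//; last first.
  by apply/measurable_EFinP; apply: measurable_indic.
have -> : (\int[leb]_(x in [set: mR]) (\1_(`[(- r)%R, r]%classic) x)%:E =
  lebesgue_measure (`[(- r)%R, r]%classic : set R))%E.
  by rewrite integral_indic// setIT.
rewrite lebesgue_measure_itv/=.
by case: ifP => _; rewrite ?mule0// -EFinD -EFinM ltry.
Qed.

(** Density of continuous functions of compact support: [f] is within [e / 4] of such a [G], the
    error counts twice because the integral is invariant under translation, and for [G] itself
    dominated convergence applies. *)
Lemma translation_L1 (f : mR -> R) (s : nat -> R) (e : R) :
  measurable_fun setT f -> (\int[leb]_x `|f x|%:E < +oo)%E ->
  s @ \oo --> 0 -> 0 < e ->
  \forall n \near \oo, (\int[leb]_x `|f (x + s n)%R - f x|%:E <= e%:E)%E.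
Proof.
move=> mf fi s0 e0.
have mnf : measurable_fun setT (fun x => `|f x|) by apply: measurableT_comp.
have e8 : 0 < e / 8 by rewrite divr_gt0.
have [N _ tailN] : \forall n \near \oo,
    (\int[leb]_x (`|f x| * (n%:R <= `|x|)%R%:R)%:E <= (e / 8)%:E)%E.
  apply: (@dominated_to0 _ _ _ _ _ (fun x => `|f x|)) => //.
  - move=> n; apply: measurable_funM => //; apply: measurable_bool.
    by apply: measurable_fun_ler.
  - move=> x; apply: cvg_near_cst; exists (Num.bound `|x|) => // n /= hn.
    rewrite leNgt (_ : `|x| < n%:R)%R ?mulr0//.
    by rewrite (lt_le_trans (archi_boundP (normr_ge0 x)))// ler_nat.
  - by move=> n x; rewrite mulr_ge0//= ler_piMr// lern1 leq_b1.
pose E := `[(- (N%:R + 1) : R), N%:R + 1]%classic.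
have mE : measurable E by exact: measurable_itv.
have Elty : (lebesgue_measure E < +oo)%E.
  by rewrite /E lebesgue_measure_itv/=; case: ifP => _; rewrite -?EFinD ltry.
have intf : lebesgue_measure.-integrable setT (EFin \o f).
  apply/integrableP; split; first by apply/measurable_EFinP.
  exact: fi.
have intfE : lebesgue_measure.-integrable E (EFin \o f).
  exact: (integrableS measurableT).
have [g_ [cg ig]] := approximation_continuous_integrable mE Elty intfE.
move=> /fine_cvgP[gfin /cvgrPdist_le /(_ _ e8) gcvg].
have [n0 _ /(_ n0 (leqnn _))[gf0 gc0]] := filterI gfin gcvg.
pose g := g_ n0.
have fgE : (\int[leb]_(x in E) `|f x - g x|%:E <= (e / 8)%:E)%E.
  have h : (\int[leb]_(x in E) `|f x - g x|%:E =
    \int[lebesgue_measure]_(x in E) `|(f x - g_ n0 x)%:E|)%E by [].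
  rewrite h -(fineK gf0) lee_fin.
  by move: gc0; rewrite sub0r normrN; apply: le_trans; exact: ler_norm.
(* The continuous [g] approximates [f] on the interval [E] only; the cutoff, supported in [E], makes
   the approximation global at the price of the tail of [f]. *)
pose G x := g x * cutoff N%:R x.
have cG : continuous (G : R -> R).
  by move=> x; apply: cvgM; [exact: cg|exact: continuous_cutoff].
have mG : measurable_fun setT (G : mR -> R) by exact: continuous_measurable_fun.
have mg : measurable_fun setT (g : mR -> R) by apply: continuous_measurable_fun; exact: cg.
have N10 : 0 <= N%:R + 1 :> R by rewrite addr_ge0.
have [M hM] : exists M, forall x, `|G x| <= M.
  have [||c _ hc] := @EVT_max R (fun x => `|G x|) (- (N%:R + 1)) (N%:R + 1).
  - by rewrite (le_trans _ N10)// oppr_le0.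
  - apply: continuous_subspaceT => x; apply: continuous_comp; first exact: cG.
    exact: norm_continuous.
  exists `|G c| => x; have [h|h] := leP (N%:R + 1) `|x|.
    by rewrite /G cutoff_out// mulr0 normr0.
  by apply: hc; rewrite in_itv /= -ler_norml ltW.
have M0 : 0 <= M by exact: le_trans (hM 0).
have fG : (\int[leb]_x `|f x - G x|%:E <= (e / 4)%:E)%E.
  apply: (@le_trans _ _ (\int[leb]_x (((fun x => `|f x - g x|%:E) \_ E) x +
      (`|f x| * (N%:R <= `|x|)%R%:R)%:E))%E).
    apply: ge0_le_integral => //.
    - apply/measurable_EFinP; apply: measurableT_comp => //; exact: measurable_funB.
    - apply: emeasurable_funD; last first.
        apply/measurable_EFinP; apply: measurable_funM => //; apply: measurable_bool.
        exact: measurable_fun_ler.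
      apply/(measurable_restrictT _ mE)/measurable_EFinP.
      apply: measurableT_comp => //; apply: measurable_funTS; exact: measurable_funB.
    - move=> x _; have [N1|N1] := leP (N%:R + 1) `|x|.
        rewrite /G cutoff_out// mulr0 subr0 (_ : (N%:R <= `|x|)%R); last first.
          by rewrite (le_trans _ N1)// lerDl.
        by rewrite mulr1 leeDr// erestrict_ge0.
      rewrite /patch mem_set; last by rewrite /E/= in_itv/= -ler_norml ltW.
      rewrite -EFinD lee_fin.
      have [N2|N2] := leP N%:R `|x|.
        by rewrite mulr1; apply: cutoff_dist; exact: cutoff01.
      by rewrite mulr0 addr0 /G cutoff_in ?mulr1// ltW.
  rewrite ge0_integralD//; last 3 first.
  - by move=> x _; rewrite erestrict_ge0.
  - apply/(measurable_restrictT _ mE)/measurable_EFinP.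
    apply: measurableT_comp => //; apply: measurable_funTS; exact: measurable_funB.
  - apply/measurable_EFinP; apply: measurable_funM => //; apply: measurable_bool.
    exact: measurable_fun_ler.
  rewrite -integral_mkcond (_ : e / 4 = e / 8 + e / 8); last by field.
  by rewrite EFinD leeD// tailN/=.
have Gs : \forall n \near \oo, (\int[leb]_x `|G (x + s n)%R - G x|%:E <= (e / 4)%:E)%E.
  have ms n : measurable_fun setT (fun x : mR => G (x + s n)).
    by apply: measurableT_comp => //; exact: measurable_funD.
  have s1 : \forall n \near \oo, `|s n| <= 1.
    move/cvgrPdist_le : s0 => /(_ _ ltr01); apply: filterS => n.
    by rewrite sub0r normrN.
  (* The indicator of [|s n| <= 1] confines all differences to one bounded interval and so provides
     a dominating function for every [n]; it equals 1 eventually. *)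
  have : \forall n \near \oo, (\int[leb]_x (`|G (x + s n)%R - G x| *
      (`|s n| <= 1)%R%:R)%:E <= (e / 4)%:E)%E.
    apply: (@dominated_to0 _ mR _ _ (fun n x => `|G (x + s n)%R - G x| *
      (`|s n| <= 1)%R%:R) (fun x => (M + M) * (`|x| <= N%:R + 2)%R%:R)).
    - move=> n; apply: measurable_funM => //.
      by apply: measurableT_comp => //; exact: measurable_funB.
    - apply: measurable_funM => //; apply: measurable_bool.
      by apply: measurable_fun_ler => //; exact: measurableT_comp.
    - move=> x; have h : (fun n => G (x + s n)) @ \oo --> G x.
        apply: (cvg_comp (fun n => x + s n) G); last exact: cG.
        have h : (fun n => x + s n) @ \oo --> x + 0 by apply: cvgD => //; exact: cvg_cst.
        by rewrite addr0 in h; exact: h.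
      apply/cvgrPdist_le => r r0; move/cvgrPdist_le : h => /(_ _ r0).
      apply: filterS => n hn; rewrite sub0r normrN normrM normr_id distrC.
      by apply: le_trans hn; rewrite ler_piMr// normr_nat lern1 leq_b1.
    - move=> n x; rewrite mulr_ge0//=.
      have [s1n|s1n] := leP `|s n| 1; last by rewrite mulr0 mulr_ge0// addr_ge0.
      rewrite mulr1; have [x2|x2] := leP `|x| (N%:R + 2).
        by rewrite mulr1 (le_trans (ler_normB _ _))// lerD.
      have h : N%:R + 1 <= `|x + s n|.
        have := ler_normB (x + s n) (s n); rewrite addrK => h; lra.
      by rewrite /G !cutoff_out ?mulr0 ?subr0 ?normr0//; lra.
    - by apply: integral_ball_lty; rewrite addr_ge0.
    - by rewrite divr_gt0.
  apply: filterS2 s1 => n s1; apply: le_trans.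
  by rewrite [leRHS](eq_integral (fun x : mR => `|G (x + s n)%R - G x|%:E))// => x _; rewrite s1 mulr1.
near=> n.
have hn : (\int[leb]_x `|G (x + s n)%R - G x|%:E <= (e / 4)%:E)%E by near: n.
have mfs : measurable_fun setT (fun x : mR => f (x + s n)).
  by apply: measurableT_comp => //; exact: measurable_funD.
have mGs : measurable_fun setT (fun x : mR => G (x + s n)).
  by apply: measurableT_comp => //; exact: measurable_funD.
have mfG : measurable_fun setT (fun x : mR => `|f x - G x|%:E).
  apply/measurable_EFinP; apply: measurableT_comp => //; exact: measurable_funB.
have mfGs : measurable_fun setT (fun x : mR => `|f (x + s n)%R - G (x + s n)%R|%:E).
  apply/measurable_EFinP; apply: measurableT_comp => //; exact: measurable_funB.
have mGG : measurable_fun setT (fun x : mR => `|G (x + s n)%R - G x|%:E).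
  apply/measurable_EFinP; apply: measurableT_comp => //; exact: measurable_funB.
have mff : measurable_fun setT (fun x : mR => `|f (x + s n)%R - f x|%:E).
  apply/measurable_EFinP; apply: measurableT_comp => //; exact: measurable_funB.
apply: (@le_trans _ _ (\int[leb]_x (`|f (x + s n)%R - G (x + s n)%R|%:E +
   (`|G (x + s n)%R - G x|%:E + `|f x - G x|%:E)))%E).
  apply: ge0_le_integral => //.
  - by apply: emeasurable_funD => //; exact: emeasurable_funD.
  - move=> x _; rewrite -!EFinD lee_fin.
    rewrite (_ : f (x + s n) - f x = (f (x + s n) - G (x + s n)) + ((G (x + s n) - G x) + (G x - f x))); last by ring.
    by rewrite (le_trans (ler_normD _ _))// lerD2l (le_trans (ler_normD _ _))// lerD2l distrC.
rewrite ge0_integralD//; last exact: emeasurable_funD.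
rewrite ge0_integralD//.
rewrite (@integral_shift1 (s n) (fun x => `|f x - G x|%:E))//.
- apply: (@le_trans _ _ (e / 4 + (e / 4 + e / 4))%:E).
    by rewrite !EFinD leeD// leeD.
  by rewrite lee_fin; lra.
- by move=> x _; rewrite adde_ge0.
Unshelve. all: by end_near. Qed.

End translation1.

Lemma cvge0P (R : realType) (u : nat -> \bar R) : (forall n, 0 <= u n)%E ->
  (forall e, 0 < e -> \forall n \near \oo, (u n <= e%:E)%E) -> u @ \oo --> 0%E.
Proof.
move=> u0 h; apply/fine_cvgP; split.
  by apply: filterS (h 1 ltr01) => n hn; rewrite ge0_fin_numE// (le_lt_trans hn) ?ltry.
apply/cvgrPdist_le => e e0; apply: filterS (h _ e0) => n hn.
rewrite sub0r normrN ger0_norm ?fine_ge0// -lee_fin fineK// ge0_fin_numE//.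
by rewrite (le_lt_trans hn) ?ltry.
Qed.

Section translation2.
Context {R : realType}.
Local Notation mR := (measurableTypeR R).

(** On almost every line the one-dimensional statement applies, and the inner integral is dominated
    by twice the norm of the slice. Dominated convergence in the other variable concludes. *)
Lemma translation_L1_snd (f : plane R -> R) (s : nat -> R) (e : R) :
  measurable_fun setT f -> (\int[leb2]_x `|f x|%:E < +oo)%E ->
  s @ \oo --> 0 -> 0 < e ->
  \forall n \near \oo, (\int[leb2]_x `|f (x + (0, s n))%R - f x|%:E <= e%:E)%E.
Proof.
move=> mf fi s0 e0.
have ms n : measurable_fun setT (fun x : plane R => f (x + (0, s n))%R).
  by apply: (measurableT_comp mf); apply: measurable_addV.
have mn : measurable_fun setT (fun x : plane R => `|f x|%:E).
  by apply/measurable_EFinP; apply: measurableT_comp.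
have md n : measurable_fun setT (fun x : plane R => `|f (x + (0, s n))%R - f x|%:E).
  by apply/measurable_EFinP; apply: measurableT_comp => //; exact: measurable_funB.
have mfx x : measurable_fun setT (fun y : mR => f (x, y)).
  by apply: (measurableT_comp mf); measurability.
have : \forall n \near \oo, (\int[leb]_x \int[leb]_y `|f (x, y + s n)%R - f (x, y)|%:E <= e%:E)%E.
  apply: (@ae_dominated_to0 _ _ _ leb
    (fun n x => \int[leb]_y `|f (x, y + s n)%R - f (x, y)|%:E)%E
    (fun x => 2%:E * \int[leb]_y `|f (x, y)|%:E)%E) => //.
  - move=> n; apply: (measurable_integral (f := fun x y : mR => `|f (x, y + s n)%R - f (x, y)|%:E) sigma_finite_leb) => //.
    apply/measurable_EFinP; apply: measurableT_comp => //.
    by apply: measurable_funB; apply: (measurableT_comp mf); measurability.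
  - apply: emeasurable_funM => //.
    apply: (measurable_integral (f := fun x y => `|f (x, y)|%:E) sigma_finite_leb) => //.
    by apply: (measurableT_comp mn); measurability.
  - have : {ae leb, forall x, (\int[leb]_y `|f (x, y)|%:E < +oo)%E}.
      apply: ae_lty.
      + apply: (measurable_integral (f := fun x y => `|f (x, y)|%:E) sigma_finite_leb) => //.
        by apply: (measurableT_comp mn); measurability.
      + by move=> x; apply: integral_ge0.
      + by rewrite -(integral_leb2E mn).
    apply: filterS => x hx; apply: cvge0P => [n|r r0]; first exact: integral_ge0.
    exact: (@translation_L1 R (fun y => f (x, y))).
  - move=> n x; rewrite integral_ge0//=.
    apply: (@le_trans _ _ (\int[leb]_y (`|f (x, y + s n)%R|%:E + `|f (x, y)|%:E)))%E.
      apply: ge0_le_integral => //.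
      + apply/measurable_EFinP; apply: measurableT_comp => //.
        by apply: measurable_funB => //; apply: (measurableT_comp mf); measurability.
      + apply: emeasurable_funD; apply/measurable_EFinP; apply: measurableT_comp => //.
        by apply: (measurableT_comp mf); measurability.
      + by move=> y _; rewrite -EFinD lee_fin ler_normB.
    rewrite ge0_integralD//; last 2 first.
    + apply/measurable_EFinP; apply: measurableT_comp => //.
      by apply: (measurableT_comp mf); measurability.
    + by apply/measurable_EFinP; apply: measurableT_comp.
    rewrite (@integral_shift1 R (s n) (fun y => `|f (x, y)|%:E))//; last first.
      by apply/measurable_EFinP; apply: measurableT_comp.
    by rewrite -mule2n mule_natl.
  - rewrite ge0_integralZl//; last 2 first.
    + apply: (measurable_integral (f := fun x y => `|f (x, y)|%:E) sigma_finite_leb) => //.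
      by apply: (measurableT_comp mn); measurability.
    + by move=> x _; apply: integral_ge0.
    by rewrite -(integral_leb2E mn)// lte_mul_pinfty.
apply: filterS => n; rewrite (integral_leb2E (md n) (fun=> normr_ge0 _)).
have E (x y : R) : (x, y) + (0, s n) = (x, y + s n) by congr pair; rewrite addr0.
by under [X in _ -> (X <= _)%E]eq_integral do under eq_integral do rewrite E.
Qed.

Lemma translation_L1_fst (f : plane R -> R) (s : nat -> R) (e : R) :
  measurable_fun setT f -> (\int[leb2]_x `|f x|%:E < +oo)%E ->
  s @ \oo --> 0 -> 0 < e ->
  \forall n \near \oo, (\int[leb2]_x `|f (x + (s n, 0))%R - f x|%:E <= e%:E)%E.
Proof.
move=> mf fi s0 e0.
have ms n : measurable_fun setT (fun x : plane R => f (x + (s n, 0))%R).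
  by apply: (measurableT_comp mf); apply: measurable_addV.
have msw : measurable_fun setT (fun x : plane R => f (x.2, x.1)).
  by apply: (measurableT_comp mf); measurability.
have swi : (\int[leb2]_(x in [set: plane R]) `|f (x.2, x.1)|%:E < +oo)%E.
  rewrite (@integral_leb2_swap _ (fun x => `|f x|%:E))//.
  by apply/measurable_EFinP; apply: measurableT_comp.
have := translation_L1_snd msw swi s0 e0; apply: filterS => n.
rewrite -(@integral_leb2_swap _ (fun x => `|f (x + (s n, 0))%R - f x|%:E))//.
by apply/measurable_EFinP; apply: measurableT_comp => //; exact: measurable_funB.
Qed.

Lemma translation_L1_plane (f : plane R -> R) (h : nat -> plane R) (e : R) :
  measurable_fun setT f -> (\int[leb2]_x `|f x|%:E < +oo)%E ->
  (fun n => (h n).1) @ \oo --> 0 -> (fun n => (h n).2) @ \oo --> 0 -> 0 < e ->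
  \forall n \near \oo, (\int[leb2]_x `|f (x + h n)%R - f x|%:E <= e%:E)%E.
Proof.
move=> mf fi h1 h2 e0; have e2 : 0 < e / 2 by rewrite divr_gt0.
have ms z : measurable_fun setT (fun x : plane R => f (x + z)%R).
  by apply: (measurableT_comp mf); apply: measurable_addV.
have md z w : measurable_fun setT (fun x : plane R => `|f (x + w)%R - f (x + z)%R|%:E).
  by apply/measurable_EFinP; apply: measurableT_comp => //; exact: measurable_funB.
have md0 w : measurable_fun setT (fun x : plane R => `|f (x + w)%R - f x|%:E).
  by apply/measurable_EFinP; apply: measurableT_comp => //; exact: measurable_funB.
have t1 := translation_L1_fst mf fi h1 e2.
have t2 := translation_L1_snd mf fi h2 e2.
apply: filterS2 t1 t2 => n t1 t2.
apply: (@le_trans _ _ (\int[leb2]_x (`|f (x + h n)%R - f (x + ((h n).1, 0))%R|%:E +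
    `|f (x + ((h n).1, 0))%R - f x|%:E)))%E.
  apply: ge0_le_integral => //; first exact: emeasurable_funD.
  by move=> x _; rewrite -EFinD lee_fin ler_distD.
rewrite ge0_integralD// [e]splitr EFinD leeD//.
have := @integral_shift R ((h n).1, 0) (fun x => `|f (x + (0, (h n).2))%R - f x|%:E).
move=> /(_ (md0 _) (fun=> normr_ge0 _)) => E; move: t2; rewrite -E.
apply: le_trans; apply: ge0_le_integral => //.
  apply/measurable_EFinP; apply: measurableT_comp => //; apply: measurable_funB => //.
  by apply: (measurableT_comp (ms _)); apply: measurable_addV.
move=> x _; rewrite -addrA (_ : ((h n).1, 0) + (0, (h n).2) = h n)//.
by case: (h n) => a b; congr pair; rewrite /= ?addr0 ?add0r.
Qed.

(* Reduces translation continuity in L^2 to L^1, applied to [f * `|f|]. *)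
Lemma sq_dist_signed_sq (a b : R) : (a - b) ^+ 2 <= 2 * `|a * `|a| - b * `|b| |.
Proof.
wlog ab : a b / b <= a.
  move=> H; have [/H//|/ltW/H] := leP b a.
  by rewrite distrC -sqrrN opprB.
have [b0|b0] := leP 0 b.
  have a0 := le_trans b0 ab.
  have h : 0 <= (a - b) * b by rewrite mulr_ge0// subr_ge0.
  have h2 : 0 <= a * a - b * b by have := sqr_ge0 (a - b); nra.
  by rewrite (ger0_norm a0) (ger0_norm b0) ger0_norm//; have := sqr_ge0 (a - b); nra.
have [a0|a0] := leP 0 a.
  rewrite (ger0_norm a0) (ltr0_norm b0) ger0_norm; last by nra.
  by have := sqr_ge0 (a + b); nra.
rewrite (ltr0_norm a0) (ltr0_norm b0) ger0_norm; last by nra.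
by nra.
Qed.

Lemma translation_L2 (f : plane R -> R) (h : nat -> plane R) (e : R) :
  measurable_fun setT f -> (\int[leb2]_x (f x ^+ 2)%:E < +oo)%E ->
  (fun n => (h n).1) @ \oo --> 0 -> (fun n => (h n).2) @ \oo --> 0 -> 0 < e ->
  \forall n \near \oo, (\int[leb2]_x ((f (x + h n)%R - f x) ^+ 2)%:E <= e%:E)%E.
Proof.
move=> mf fi h1 h2 e0; have e2 : 0 < e / 2 by rewrite divr_gt0.
have mq : measurable_fun setT (fun x => f x * `|f x|).
  by apply: measurable_funM => //; apply: measurableT_comp.
have ms z : measurable_fun setT (fun x : plane R => f (x + z)%R).
  by apply: (measurableT_comp mf); apply: measurable_addV.
have mqs z : measurable_fun setT (fun x : plane R => f (x + z)%R * `|f (x + z)%R|).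
  by apply: measurable_funM => //; apply: measurableT_comp.
have qi : (\int[leb2]_x `|f x * `|f x| |%:E < +oo)%E.
  by under eq_integral do rewrite normrM normr_id -normrM -expr2 ger0_norm ?sqr_ge0//.
have := translation_L1_plane mq qi h1 h2 e2; apply: filterS => n hn.
apply: (@le_trans _ _ (\int[leb2]_x (2%:E *
    `|f (x + h n)%R * `|f (x + h n)%R| - f x * `|f x| |%:E)))%E.
  apply: ge0_le_integral => //.
  - by move=> x _; rewrite lee_fin sqr_ge0.
  - by apply/measurable_EFinP; apply: measurable_funX; exact: measurable_funB.
  - apply: emeasurable_funM => //; apply/measurable_EFinP.
    by apply: measurableT_comp => //; exact: measurable_funB.
  - by move=> x _; rewrite -EFinM lee_fin sq_dist_signed_sq.
rewrite ge0_integralZl//; last first.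
  by apply/measurable_EFinP; apply: measurableT_comp => //; exact: measurable_funB.
apply: (@le_trans _ _ (2%:E * (e / 2)%:E)%E); first by apply: lee_pmul => //; exact: integral_ge0.
by rewrite -EFinM mulrC divfK.
Qed.

Lemma translation_cL2 (f : plane R -> R[i]) (m : R) (h : nat -> plane R) (e : R) :
  L2le f m ->
  (fun n => (h n).1) @ \oo --> 0 -> (fun n => (h n).2) @ \oo --> 0 -> 0 < e ->
  \forall n \near \oo,
    (\int[leb2]_x (cmod (f (x + h n)%R - f x) ^+ 2)%:E <= e%:E)%E.
Proof.
move=> [m0 [mr mi] fi] h1 h2 e0; have e2 : 0 < e / 2 by rewrite divr_gt0.
have mc : measurable_fun setT (fun x => (cmod (f x) ^+ 2)%:E).
  by apply/measurable_EFinP; apply: measurable_funX; apply: measurable_cmod.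
have ir : (\int[leb2]_x (complex.Re (f x) ^+ 2)%:E < +oo)%E.
  apply: le_lt_trans (le_lt_trans fi (ltry _)); apply: ge0_le_integral => //.
  - by move=> x _; rewrite lee_fin sqr_ge0.
  - by apply/measurable_EFinP; apply: measurable_funX.
  - by move=> x _; rewrite lee_fin cmod_sq lerDl sqr_ge0.
have ii : (\int[leb2]_x (complex.Im (f x) ^+ 2)%:E < +oo)%E.
  apply: le_lt_trans (le_lt_trans fi (ltry _)); apply: ge0_le_integral => //.
  - by move=> x _; rewrite lee_fin sqr_ge0.
  - by apply/measurable_EFinP; apply: measurable_funX.
  - by move=> x _; rewrite lee_fin cmod_sq lerDr sqr_ge0.
have tr := translation_L2 mr ir h1 h2 e2.
have ti := translation_L2 mi ii h1 h2 e2.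
have msr z : measurable_fun setT (fun x : plane R => complex.Re (f (x + z)%R)).
  by apply: (measurableT_comp mr); apply: measurable_addV.
have msi z : measurable_fun setT (fun x : plane R => complex.Im (f (x + z)%R)).
  by apply: (measurableT_comp mi); apply: measurable_addV.
apply: filterS2 tr ti => n tr ti.
rewrite (eq_integral (fun x : plane R => ((complex.Re (f (x + h n)%R) - complex.Re (f x)) ^+ 2)%:E +
   ((complex.Im (f (x + h n)%R) - complex.Im (f x)) ^+ 2)%:E)%E); last first.
  by move=> x _; rewrite cmod_sq EFinD; case: (f (x + h n)) => ? ?; case: (f x).
rewrite ge0_integralD//.
- by rewrite [e]splitr EFinD leeD.
- by move=> x _; rewrite lee_fin sqr_ge0.
- by apply/measurable_EFinP; apply: measurable_funX; exact: measurable_funB.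
- by move=> x _; rewrite lee_fin sqr_ge0.
- by apply/measurable_EFinP; apply: measurable_funX; exact: measurable_funB.
Qed.

End translation2.

(** * Poisson kernel and mollification *)

Section poisson1.
Context {R : realType}.
Local Notation mR := (measurableTypeR R).
Variables (eps t : R).
Hypothesis eps0 : 0 < eps.

Let D := eps ^+ 2 + t ^+ 2.
Let D0 : 0 < D. Proof. by rewrite ltr_pwDl// ?exprn_gt0// sqr_ge0. Qed.

(** An antiderivative of [expR (- (eps * s)) * (1 + cos (t * s))]. Adding 1 to the cosine makes the
    integrand nonnegative, as the fundamental theorem on a half-line requires here. *)
Definition laplace_prim (s : R) : R :=
  expR (- (eps * s)) * ((t * sin (t * s) - eps * cos (t * s)) / D - eps^-1).

#[local] Instance is_derive_expRN (s : R) :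
  is_derive s 1 (fun s => expR (- (eps * s))) (expR (- (eps * s)) * (- eps)).
Proof.
apply: (@is_derive1_comp R expR (fun s => - (eps * s))).
by apply: is_derive_eq; rewrite scaler1.
Qed.

#[local] Instance is_derive_sinM (s : R) :
  is_derive s 1 (fun s => sin (t * s)) (cos (t * s) * t).
Proof.
apply: (@is_derive1_comp R sin (fun s => t * s)).
by apply: is_derive_eq; rewrite scaler1.
Qed.

#[local] Instance is_derive_cosM (s : R) :
  is_derive s 1 (fun s => cos (t * s)) (- sin (t * s) * t).
Proof.
apply: (@is_derive1_comp R cos (fun s => t * s)).
by apply: is_derive_eq; rewrite scaler1.
Qed.

Lemma is_derive_laplace_prim (s : R) :
  is_derive s 1 laplace_prim (expR (- (eps * s)) * (1 + cos (t * s))).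
Proof.
have d4 : is_derive s 1 (fun s => (t * sin (t * s) - eps * cos (t * s)) / D - eps^-1)
   ((t * (cos (t * s) * t) - eps * (- sin (t * s) * t)) / D).
  by apply: is_derive_eq; rewrite /GRing.scale/=; have := lt0r_neq0 D0 => ?; field.
apply: is_derive_eq.
rewrite /GRing.scale/=.
have := D0; rewrite lt0r => /andP[Dn _]; have en := lt0r_neq0 eps0.
move: Dn; rewrite /D; generalize (sin (t * s)) (cos (t * s)) (expR (- (eps * s))) => a b c Dn.
field.
by rewrite en Dn.
Qed.

Lemma cvg_laplace_prim : laplace_prim x @[x --> +oo] --> 0.
Proof.
pose C := (`|t| + eps) / D + eps^-1.
have C1 : 0 <= (`|t| + eps) / D by apply: divr_ge0; [apply: addr_ge0 => //|]; exact: ltW.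
have C0 : 0 < C by rewrite /C ltr_wpDl// invr_gt0.
apply/cvgrPdist_le => e e0; near=> s.
rewrite sub0r normrN /laplace_prim normrM ger0_norm ?expR_ge0//.
apply: (@le_trans _ _ (expR (- (eps * s)) * C)).
  rewrite ler_pM2l ?expR_gt0// (le_trans (ler_normB _ _))//.
  apply: lerD; last by rewrite ger0_norm// invr_ge0 ltW.
  rewrite normrM (gtr0_norm (x := D^-1)) ?invr_gt0// ler_pM2r ?invr_gt0//.
  rewrite (le_trans (ler_normB _ _))// !normrM lerD//.
    by rewrite ler_piMr// ler_norml sin_geN1 sin_le1.
  by rewrite (gtr0_norm eps0) ler_piMr ?(ltW eps0)// ler_norml cos_geN1 cos_le1.
rewrite expRN mulrC ler_pdivrMr ?expR_gt0// mulrC -ler_pdivrMr//.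
apply: (@le_trans _ _ (1 + eps * s)); last exact: expR_ge1Dx.
rewrite (@le_trans _ _ (eps * s))// ?lerDr//.
by rewrite -ler_pdivrMl//; near: s; apply: nbhs_pinfty_ge; exact: num_real.
Unshelve. all: by end_near. Qed.

Lemma laplace_cos :
  (\int[leb]_(s in `[0%R, +oo[) (expR (- (eps * s)) * (1 + cos (t * s)))%:E =
   (eps^-1 + eps / D)%:E)%E.
Proof.
rewrite (@ge0_continuous_FTC2y _ (fun s => expR (- (eps * s)) * (1 + cos (t * s))) laplace_prim 0 0).
- rewrite /laplace_prim !mulr0 oppr0 expR0 sin0 cos0 mulr0 mulr1 mul1r -EFinB; congr EFin.
  by rewrite sub0r sub0r opprB mulNr opprK.
- by move=> x _; rewrite mulr_ge0 ?expR_ge0//; have := cos_geN1 (t * x); lra.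
- apply: continuous_subspaceT => x.
  apply: differentiable_continuous; apply/derivable1_diffP.
  have h : is_derive x (1 : R) (fun s => expR (- (eps * s)) * (1 + cos (t * s)))
      (expR (- (eps * x)) * (- sin (t * x) * t) + (1 + cos (t * x)) * (expR (- (eps * x)) * - eps)).
    by apply: is_derive_eq; rewrite /GRing.scale/=; ring.
  by case: h.
- exact: cvg_laplace_prim.
- by move=> x _; have [] := is_derive_laplace_prim x.
- apply: cvg_at_right_filter; apply: differentiable_continuous; apply/derivable1_diffP.
  by have [] := is_derive_laplace_prim 0.
- by move=> x _; rewrite derive1E; have [_ ->] := is_derive_laplace_prim x.
Qed.

Definition wexp (s : R) : R := expR (- (eps * `|s|)).

Lemma wexp_gt0 s : 0 < wexp s. Proof. exact: expR_gt0. Qed.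

Lemma continuous_wexp : continuous (wexp : R -> R).
Proof.
move=> x; apply: (@continuous_comp _ _ _ (fun s : R => - (eps * `|s|)) expR); last exact: continuous_expR.
apply: cvgN; apply: cvgM; [exact: cvg_cst|exact: norm_continuous].
Qed.

Lemma measurable_wexp : measurable_fun setT (wexp : mR -> R).
Proof. by apply: continuous_measurable_fun; exact: continuous_wexp. Qed.

Lemma integral_wexp_cos :
  (\int[leb]_(s in [set: mR]) (wexp s * (1 + cos (t * s)))%:E = (2 * (eps^-1 + eps / D))%:E)%E.
Proof.
rewrite /leb (@ge0_symfun_integralT _ (fun s => wexp s * (1 + cos (t * s)))).
- rewrite (_ : [set x | _] = `[0, +oo[%classic); last first.
    by apply/seteqP; split => x/=; rewrite in_itv/= andbT.
  rewrite EFinM -laplace_cos; congr (_ * _)%E; apply: eq_integral => x.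
  by rewrite inE/= in_itv/= andbT => x0; rewrite /wexp ger0_norm.
- by move=> x; rewrite mulr_ge0 ?expR_ge0//; have := cos_geN1 (t * x); lra.
- move=> x; apply: cvgM; first exact: continuous_wexp.
  apply: cvgD; first exact: cvg_cst.
  apply: (@continuous_comp _ _ _ (fun s : R => t * s) cos); last exact: continuous_cos.
  by apply: cvgM; [exact: cvg_cst|exact: cvg_id].
- by move=> x /=; rewrite /wexp normrN mulrN cosN.
Qed.

End poisson1.

Section poisson_transform.
Context {R : realType}.
Local Notation mR := (measurableTypeR R).

Lemma integral_wexp (eps : R) : 0 < eps ->
  (\int[leb]_(s in [set: mR]) (wexp eps s)%:E = (2 / eps)%:E)%E.
Proof.
move=> e0; have := integral_wexp_cos 0 e0.
under eq_integral do rewrite mul0r cos0 mulrC EFinM.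
rewrite ge0_integralZl//; last 2 first.
- by apply/measurable_EFinP; exact: measurable_wexp.
- by move=> x _; rewrite lee_fin ltW// wexp_gt0.
rewrite expr0n/= addr0 (_ : eps / eps ^+ 2 = eps^-1); last first.
  by rewrite expr2 invfM mulrA divff ?mul1r// gt_eqF.
move=> h; have : (2^-1%:E * ((1 + 1)%:E * \int[leb]_(s in [set: mR]) (wexp eps s)%:E) =
   2^-1%:E * (2 * (eps^-1 + eps^-1))%:E)%E by rewrite h.
rewrite muleA -!EFinM (_ : 2^-1 * (1 + 1) = 1 :> R); last by field.
rewrite mul1e => ->; congr EFin; have en := lt0r_neq0 e0.
by field.
Qed.

Lemma cL1_wexp (eps : R) : 0 < eps -> cL1 leb (fun s : mR => (wexp eps s)%:C).
Proof.
move=> e0; apply: (@cL1_le _ mR R leb _ (wexp eps)).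
- by apply: cmeas_real; exact: measurable_wexp.
- exact: measurable_wexp.
- by move=> x; rewrite cmod_real ger0_norm// ltW// wexp_gt0.
- by rewrite integral_wexp// ltry.
Qed.

(** Reflection conjugates the integrand, so the integral is real. Its real part is the integral
    against [1 + cos] minus the integral of the weight alone. *)
Lemma fourier_wexp (eps t : R) : 0 < eps ->
  cintegral leb (fun s : mR => (wexp eps s)%:C * expi (t * s)) =
  (2 * eps / (eps ^+ 2 + t ^+ 2))%:C.
Proof.
move=> e0; have mt : measurable_fun setT (fun s : mR => t * s).
  by apply: measurable_funM => //; exact: measurable_cst.
have lf : cL1 leb (fun s : mR => (wexp eps s)%:C * expi (t * s)).
  by apply: cL1_expi => //; exact: cL1_wexp.
set f := fun s : mR => _.
have oddI : cintegral leb f = cj (cintegral leb f).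
  rewrite -cintegralJ//.
  transitivity (cintegral leb (fun s => f (- s))); last first.
    apply: eq_cintegral => s; rewrite /f /wexp normrN mulrN expiN cjM cj_real//.
  rewrite (@cintegral_change _ _ mR mR R leb leb (fun s => - s) 1 ltr01) ?mul1r//.
  - move=> g mg g0; have := @integral_affine R (- 1) 0 g.
    rewrite normrN normr1 invr1 oppr_eq0 oner_eq0 => /(_ isT mg g0) <-.
    by apply: eq_integral => x _; rewrite mulN1r addr0.
  - by case: lf.
apply: complex_ext; last first.
  move: (congr1 (@complex.Im R) oddI); rewrite ImJ.
  by move: (complex.Im _) => y h; rewrite [RHS]/=; lra.
have RE : (fun s : mR => complex.Re (f s)) = (fun s => wexp eps s * cos (t * s)).
  by apply/funext => s; rewrite /f/= mul0r subr0.
have iR := cL1_Re lf; have iw := cL1_Re (cL1_wexp e0).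
have := RintegralD measurableT iw iR.
rewrite -/f RE [X in X = _ -> _](_ : _ = 2 * (eps^-1 + eps / (eps ^+ 2 + t ^+ 2))); last first.
  rewrite /Rintegral -[RHS]/(fine (_%:E)) -integral_wexp_cos//; congr fine.
  by apply: eq_integral => s _; rewrite /= mul0r subr0 mulrDr mulr1.
rewrite [X in _ = X + _](_ : _ = 2 / eps); last by rewrite /Rintegral integral_wexp.
change (2 * (eps^-1 + eps / (eps ^+ 2 + t ^+ 2)) =
  2 / eps + Rintegral leb setT (fun s : mR => wexp eps s * cos (t * s)) ->
  Rintegral leb setT (fun s => complex.Re (f s)) = 2 * eps / (eps ^+ 2 + t ^+ 2)).
by rewrite RE mulrDr mulrA => /addrI <-.
Qed.

End poisson_transform.

Section poisson2.
Context {R : realType}.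
Local Notation mR := (measurableTypeR R).
Implicit Types f g : plane R -> R[i].

(** The exponential of the l^1 norm rather than the Euclidean one: its transform factors into
    one-dimensional integrals, and the resulting kernel is a product of two dilated copies of
    [kern]. *)
Definition wexp2 (eps : R) (xi : plane R) : R := wexp eps xi.1 * wexp eps xi.2.

Definition pois (y : plane R) : R := (pi ^+ 2)^-1 * (kern y.1 * kern y.2).

Lemma wexp2_gt0 eps xi : 0 < wexp2 eps xi.
Proof. by rewrite mulr_gt0// wexp_gt0. Qed.

Lemma wexp2_le1 eps xi : 0 < eps -> wexp2 eps xi <= 1.
Proof.
move=> e0; have h s : wexp eps s <= 1.
  by rewrite -(expR0 R) ler_expR oppr_le0 mulr_ge0// ltW.
by rewrite mulr_ile1// ltW// wexp_gt0.
Qed.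

Lemma measurable_wexp2 eps : measurable_fun setT (wexp2 eps).
Proof.
apply: measurable_funM; first exact: (measurableT_comp (measurable_wexp eps) measurable_fst).
exact: (measurableT_comp (measurable_wexp eps) measurable_snd).
Qed.

Lemma pois_ge0 y : 0 <= pois y.
Proof.
by rewrite mulr_ge0 ?invr_ge0 ?exprn_ge0 ?pi_ge0// mulr_ge0// ltW// kern_gt0.
Qed.

Lemma pois_le1 y : pois y <= 1.
Proof.
rewrite mulr_ile1//; first by rewrite invr_ge0 exprn_ge0// pi_ge0.
- by rewrite mulr_ge0// ltW// kern_gt0.
- rewrite invf_le1 ?exprn_gt0 ?pi_gt0// exprn_ege1// (le_trans _ (pi_ge2 R))//.
  by rewrite ler1n.
- by rewrite mulr_ile1 ?kern_le1// ltW// kern_gt0.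
Qed.

Lemma measurable_pois : measurable_fun setT pois.
Proof.
apply: measurable_funM; first exact: measurable_cst.
apply: measurable_funM; first exact: (measurableT_comp measurable_kern measurable_fst).
exact: (measurableT_comp measurable_kern measurable_snd).
Qed.

Lemma integral_pois : (\int[leb2]_y (pois y)%:E = 1)%E.
Proof.
have mk : measurable_fun setT (fun l : mR => (kern l)%:E).
  by apply/measurable_EFinP; exact: measurable_kern.
have k0 (l : mR) : (0 <= (kern l)%:E)%E by rewrite lee_fin ltW// kern_gt0.
rewrite integral_leb2E; last 2 first.
- by apply/measurable_EFinP; exact: measurable_pois.
- by move=> x; rewrite lee_fin pois_ge0.
under eq_integral => x _.
  under eq_integral => y _ do rewrite /pois /= mulrA EFinM.
  rewrite ge0_integralZl//; last first.
    by rewrite lee_fin; apply: mulr_ge0; [rewrite invr_ge0 exprn_ge0// pi_ge0|exact/ltW/kern_gt0].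
  rewrite integral_kernT muleC EFinM muleA -EFinM.
  over.
under eq_integral do rewrite EFinM.
rewrite ge0_integralZl//; last by rewrite lee_fin mulr_ge0 ?invr_ge0 ?exprn_ge0 ?pi_ge0.
rewrite integral_kernT -EFinM; congr EFin.
by have := lt0r_neq0 (pi_gt0 R); generalize (pi : R) => p p0; field.
Qed.

Lemma cL1_wexp2 eps : 0 < eps -> cL1 leb2 (fun xi : plane R => (wexp2 eps xi)%:C).
Proof.
move=> e0.
rewrite (_ : (fun xi => _) = (fun xi : plane R => (wexp eps xi.1)%:C * (wexp eps xi.2)%:C)).
  exact: (cL1_prodm_tensor sigma_finite_leb sigma_finite_leb (cL1_wexp e0) (cL1_wexp e0)).
by apply/funext => xi; rewrite -rmorphM.
Qed.

Lemma fourier_wexp2 eps x : 0 < eps ->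
  cintegral leb2 (fun xi : plane R => (wexp2 eps xi)%:C * expi (edot x xi)) =
  (2 / eps * kern (x.1 / eps) * (2 / eps * kern (x.2 / eps)))%:C.
Proof.
move=> e0.
have kE t : 2 / eps * kern (t / eps) = 2 * eps / (eps ^+ 2 + t ^+ 2).
  have h : eps ^+ 2 + t ^+ 2 != 0 by rewrite gt_eqF// ltr_pwDl ?exprn_gt0 ?sqr_ge0.
  rewrite /kern; have := lt0r_neq0 e0 => en; field.
  by rewrite h en.
rewrite !kE rmorphM/= -!fourier_wexp//.
rewrite -(cintegral_prodm_tensor sigma_finite_leb sigma_finite_leb).
- apply: eq_cintegral => xi; rewrite /edot expiD /wexp2 rmorphM/=.
  by rewrite -!mulrA; congr (_ * _); rewrite mulrCA.
- by apply: cL1_expi; [exact: cL1_wexp|measurability].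
- by apply: cL1_expi; [exact: cL1_wexp|measurability].
Qed.

(** Defined on the frequency side, so that for integrable [f] and positive [eps] it is visibly [ift]
    of an integrable function; [mollifyE] gives the form as an average of dilated translates. *)
Definition mollify (eps : R) f : plane R -> R[i] :=
  ift (fun xi => (wexp2 eps xi)%:C * fourier1 f xi).

Lemma cL1_wexp2_fourier eps f : 0 < eps -> cL1 leb2 f ->
  cL1 leb2 (fun xi => (wexp2 eps xi)%:C * fourier1 f xi).
Proof.
move=> e0 lf; have [M M0 hM] := fourier1_bounded lf.
have [mf _] := lf; have [mw wi] := cL1_wexp2 e0.
apply: (@cL1_le _ _ _ leb2 _ (fun xi => M * cmod (wexp2 eps xi)%:C)).
- by apply: cmeasM => //; exact: cmeas_fourier1.
- by apply: measurable_funM => //; exact: measurable_cmod.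
- by move=> xi; rewrite cmodM mulrC ler_wpM2r// cmod_ge0.
under eq_integral do rewrite EFinM.
rewrite ge0_integralZl//.
- by rewrite lte_mul_pinfty// lee_fin ltW.
- by apply/measurable_EFinP; exact: measurable_cmod.
- by move=> x _; rewrite lee_fin cmod_ge0.
- by rewrite lee_fin ltW.
Qed.

(** Fubini turns the damped inversion integral into a convolution with the explicit kernel [K], and
    the dilation by [eps] together with the shift by [x] brings [K] to the normalized [pois]. *)
Lemma mollifyE eps f x : 0 < eps -> cL1 leb2 f ->
  mollify eps f x = cintegral leb2 (fun y : plane R => f (conf eps 0 y + x) * (pois y)%:C).
Proof.
move=> e0 lf; have [mf fi] := lf.
rewrite /mollify iftE; last exact: cL1_wexp2_fourier.
pose k1 (s : R) := 2 / eps * kern (s / eps).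
pose K (y : plane R) : R := k1 (x.1 - y.1) * k1 (x.2 - y.2).
have k10 s : 0 <= k1 s by rewrite /k1 mulr_ge0 ?divr_ge0// ltW// kern_gt0.
have k1le s : k1 s <= 2 / eps by rewrite /k1 ler_piMr ?kern_le1// divr_ge0// ltW.
have K0 y : 0 <= K y by apply: mulr_ge0.
have mkern := @measurable_kern R.
have mk1 : measurable_fun setT (k1 : mR -> R) by rewrite /k1; measurability.
have mK : measurable_fun setT K by rewrite /K; measurability.
have lfK : cL1 leb2 (fun y => f y * (K y)%:C).
  apply: (@cL1_le _ _ _ leb2 _ (fun y => (2 / eps * (2 / eps)) * cmod (f y))).
  - by apply: cmeasM => //; exact: cmeas_real.
  - by apply: measurable_funM => //; exact: measurable_cmod.
  - move=> y; rewrite cmodM mulrC ler_wpM2r ?cmod_ge0// cmod_real ger0_norm ?K0//.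
    exact: ler_pM.
  under eq_integral do rewrite EFinM.
  rewrite ge0_integralZl//.
  - by rewrite lte_mul_pinfty// lee_fin mulr_ge0// divr_ge0// ltW.
  - by apply/measurable_EFinP; exact: measurable_cmod.
  - by move=> y _; rewrite lee_fin cmod_ge0.
  - by rewrite lee_fin mulr_ge0// divr_ge0// ltW.
have -> : cintegral leb2 (fun xi => (wexp2 eps xi)%:C * fourier1 f xi * expi (edot x xi)) =
   kappa%:C * cintegral leb2 (fun y => f y * (K y)%:C).
  pose Phi (xi y : plane R) := (kappa%:C * f y) * ((wexp2 eps xi)%:C * expi (edot (x - y) xi)).
  transitivity (cintegral leb2 (fun xi => cintegral leb2 (fun y => Phi xi y))).
    apply: eq_cintegral => xi; rewrite fourier1E.
    have lfe : cL1 leb2 (fun y => f y * expi (- edot y xi)).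
      by apply: cL1_expi => //; exact: measurable_edotN.
    rewrite -[RHS](@eq_cintegral _ _ _ leb2 (fun y => (kappa%:C * (wexp2 eps xi)%:C * expi (edot x xi)) *
      (f y * expi (- edot y xi)))); last first.
      move=> y; rewrite /Phi (_ : edot (x - y) xi = edot x xi - edot y xi).
        by rewrite expiD; ring.
      by rewrite /edot /=; ring.
    by rewrite cintegralZl//; ring.
  rewrite (cfubini sigma_finite_leb2 sigma_finite_leb2).
  - rewrite -cintegralZl//; apply: eq_cintegral => y.
    rewrite /Phi cintegralZl; last first.
      by apply: cL1_expi; [exact: cL1_wexp2|apply: measurable_edot; measurability].
    by rewrite fourier_wexp2// -mulrA.
  - apply: cmeasM.
      by apply: cmeasM; [exact: cmeas_cst|exact: (cmeas_comp mf measurable_snd)].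
    apply: cmeasM.
      by apply: cmeas_real; exact: (measurableT_comp (measurable_wexp2 eps) measurable_fst).
    apply: cmeas_expi; apply: measurable_edot; last exact: measurable_fst.
    apply: measurable_addV; first exact: measurable_cst.
    by apply: measurable_oppV; exact: measurable_snd.
  - under eq_integral => xi _.
      under eq_integral => y _ do
        rewrite /Phi !cmodM cmod_expi mulr1 !cmod_real mulrC (gtr0_norm (wexp2_gt0 _ _))
          (gtr0_norm kappa_gt0) EFinM.
      over.
    rewrite (@integral_prod2 R (fun xi => (wexp2 eps xi)%:E) (fun y => (kappa * cmod (f y))%:E)).
    + have [_] := cL1Z kappa%:C lf; under eq_integral do rewrite cmodM cmod_real (gtr0_norm kappa_gt0).
      have [_ h1 h2] := cL1_wexp2 e0; apply: lte_mul_pinfty => //.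
      * by apply: integral_ge0 => xi _; rewrite lee_fin ltW// wexp2_gt0.
      * rewrite ge0_fin_numE; last by apply: integral_ge0 => xi _; rewrite lee_fin ltW// wexp2_gt0.
        by move: h1; under eq_integral do rewrite cmod_real (gtr0_norm (wexp2_gt0 _ _)).
    + by apply/measurable_EFinP; exact: measurable_wexp2.
    + by apply/measurable_EFinP; apply: measurable_funM => //; exact: measurable_cmod.
    + by move=> xi; rewrite lee_fin ltW// wexp2_gt0.
    + by move=> y; rewrite lee_fin mulr_ge0 ?cmod_ge0// ltW// kappa_gt0.
have e2 : eps ^+ 2 + 0 ^+ 2 != 0 :> R by rewrite expr0n/= addr0 gt_eqF// exprn_gt0.
have mphi : measurable_fun setT (fun y => conf eps 0 y + x).
  by apply: measurable_addV => //; apply: measurable_conf => //; measurability.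
have G1 : cintegral leb2 (fun y => f (conf eps 0 y + x) * (K (conf eps 0 y + x))%:C) =
    (eps ^+ 2)^-1%:C * cintegral leb2 (fun y => f y * (K y)%:C).
  apply: (@cintegral_change _ _ _ _ _ leb2 leb2 (fun y => conf eps 0 y + x)).
  - by rewrite invr_gt0 exprn_gt0.
  - by move=> g mg g0; rewrite integral_conf// expr0n/= addr0.
  - by have [] := lfK.
have lG : cL1 leb2 (fun y => f (conf eps 0 y + x) * (K (conf eps 0 y + x))%:C).
  have [mfK fKi] := lfK; split; first exact: (cmeas_comp mfK mphi).
  rewrite (integral_conf x (f := fun y => (cmod (f y * (K y)%:C))%:E) e2).
  - by rewrite lte_mul_pinfty// lee_fin invr_ge0 addr_ge0// sqr_ge0.
  - by apply/measurable_EFinP; exact: measurable_cmod.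
  - by move=> y; rewrite lee_fin cmod_ge0.
rewrite -[RHS](@eq_cintegral _ _ _ leb2 (fun y => (eps ^+ 2 * kappa * kappa)%:C *
   (f (conf eps 0 y + x) * (K (conf eps 0 y + x))%:C))); last first.
  move=> y; rewrite mulrCA; congr (_ * _); rewrite -rmorphM; congr (_%:C).
  have en := lt0r_neq0 e0; have kN a : kern (- a : R) = kern a by rewrite /kern sqrrN.
  rewrite /K /k1 /conf /= !mul0r subr0 add0r.
  rewrite (_ : (x.1 - (eps * y.1 + x.1)) / eps = - y.1); last by field.
  rewrite (_ : (x.2 - (eps * y.2 + x.2)) / eps = - y.2); last by field.
  rewrite !kN /pois /kappa; move: (kern y.1) (kern y.2) => a b.
  have := lt0r_neq0 (pi_gt0 R); generalize (pi : R) => p p0; field.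
  by rewrite en p0.
rewrite cintegralZl// G1 mulrA -rmorphM mulrA -rmorphM; congr (_%:C * _).
by have en := lt0r_neq0 e0; generalize (kappa : R) => k; field.
Qed.

(** Jensen's inequality for the probability density [pois], obtained by integrating
    [2 m G <= G ^ 2 + m ^ 2]. Using a lower bound [m] of the mean rather than the mean keeps
    infinite means harmless. *)
Lemma pois_jensen (m : R) (G : plane R -> R) : measurable_fun setT G ->
  (forall y, 0 <= G y) -> 0 <= m ->
  (m%:E <= \int[leb2]_y (G y * pois y)%:E)%E ->
  ((m ^+ 2)%:E <= \int[leb2]_y (G y ^+ 2 * pois y)%:E)%E.
Proof.
move=> mG G0 m0 hm; have mp := measurable_pois; have p0 := pois_ge0.
have mGp : measurable_fun setT (fun y => (G y * pois y)%:E).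
  by apply/measurable_EFinP; measurability.
have h : ((2 * m)%:E * m%:E <= \int[leb2]_y (G y ^+ 2 * pois y)%:E + (m ^+ 2)%:E)%E.
  apply: (@le_trans _ _ ((2 * m)%:E * \int[leb2]_y (G y * pois y)%:E)%E).
    by apply: lee_wpmul2l => //; rewrite lee_fin mulr_ge0.
  rewrite -ge0_integralZl//; last 2 first.
  - by move=> y _; rewrite lee_fin mulr_ge0.
  - by rewrite lee_fin mulr_ge0.
  rewrite -[X in (_ <= _ + X)%E]mule1 -integral_pois -ge0_integralZl//; last 3 first.
  - by apply/measurable_EFinP.
  - by move=> y _; rewrite lee_fin.
  - by rewrite lee_fin sqr_ge0.
  rewrite -ge0_integralD//; last 4 first.
  - by move=> y _; rewrite lee_fin mulr_ge0// sqr_ge0.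
  - by apply/measurable_EFinP; measurability.
  - by move=> y _; rewrite mule_ge0 ?lee_fin ?sqr_ge0.
  - by apply/measurable_EFinP; measurability.
  apply: ge0_le_integral => //.
  - by move=> y _; rewrite -EFinM lee_fin; apply: mulr_ge0; apply: mulr_ge0.
  - by apply/measurable_EFinP; measurability.
  - by apply/measurable_EFinP; measurability.
  - move=> y _; rewrite -!EFinM -EFinD lee_fin mulrA -mulrDl ler_wpM2r//.
    by have := sqr_ge0 (G y - m); nra.
move: h; set A := (\int[leb2]_y _)%E.
case: A => [a| |]; last by [].
  by rewrite -EFinM -EFinD !lee_fin => h; nra.
by move=> _; rewrite leey.
Qed.

(** Replaces Minkowski's integral inequality. With [G] the modulus of [f] at the displaced point it
    bounds the mollification, with [G] the modulus of an increment of [f] it bounds the error. *)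
Lemma pois_average_sq (m : plane R -> R) (G : plane R -> plane R -> R) :
  measurable_fun setT m -> measurable_fun setT (fun p => G p.1 p.2) ->
  (forall x y, 0 <= G x y) -> (forall x, 0 <= m x) ->
  (forall x, (m x)%:E <= \int[leb2]_y (G x y * pois y)%:E)%E ->
  (\int[leb2]_x (m x ^+ 2)%:E <=
   \int[leb2]_y ((pois y)%:E * \int[leb2]_x (G x y ^+ 2)%:E))%E.
Proof.
move=> mm mG G0 m0 hm; have mp := measurable_pois.
have mG2 : measurable_fun setT (fun p : plane R * plane R => G p.1 p.2 ^+ 2 * pois p.2).
  by measurability.
have mGx x : measurable_fun setT (G x).
  by apply: (measurableT_comp mG (g := fun y => (x, y))); measurability.
have mGy y : measurable_fun setT (G ^~ y).
  by apply: (measurableT_comp mG (g := fun x => (x, y))); measurability.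
apply: (@le_trans _ _ (\int[leb2]_x \int[leb2]_y (G x y ^+ 2 * pois y)%:E)%E).
  apply: ge0_le_integral => //.
  - by move=> x _; rewrite lee_fin sqr_ge0.
  - by apply/measurable_EFinP; measurability.
  - apply: (measurable_integral (f := fun x y => (G x y ^+ 2 * pois y)%:E) sigma_finite_leb2).
      exact/measurable_EFinP.
    by move=> x y; rewrite lee_fin mulr_ge0 ?sqr_ge0 ?pois_ge0.
  - by move=> x _; apply: pois_jensen.
rewrite (tonelli (f := fun x y => (G x y ^+ 2 * pois y)%:E) sigma_finite_leb2 sigma_finite_leb2).
- rewrite le_eqVlt; apply/orP; left; apply/eqP; apply: eq_integral => y _.
  under eq_integral do rewrite mulrC EFinM.
  rewrite ge0_integralZl//.
  + by apply/measurable_EFinP; apply: measurable_funX.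
  + by move=> x _; rewrite lee_fin sqr_ge0.
  + by rewrite lee_fin pois_ge0.
- exact/measurable_EFinP.
- by move=> x y; rewrite lee_fin mulr_ge0 ?sqr_ge0 ?pois_ge0.
Qed.

Lemma cmeas_mollify eps f : cmeas f -> cmeas (mollify eps f).
Proof.
move=> mf; apply: cmeas_ift; apply: cmeasM; last exact: cmeas_fourier1.
by apply: cmeas_real; exact: measurable_wexp2.
Qed.

Lemma measurable_conf_addr eps : measurable_fun setT
  (fun p : plane R * plane R => conf eps 0 p.2 + p.1 : plane R).
Proof.
apply: measurable_addV; last exact: measurable_fst.
by apply: measurable_conf; [exact: measurable_cst|exact: measurable_cst|exact: measurable_snd].
Qed.

Lemma measurable_conf_add eps (x : plane R) : measurable_fun setT
  (fun y : plane R => conf eps 0 y + x : plane R).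
Proof.
apply: measurable_addV; last exact: measurable_cst.
by apply: measurable_conf; [exact: measurable_cst|exact: measurable_cst|exact: measurable_id].
Qed.

Lemma cmeas_dilate eps x f : cmeas f -> cmeas (fun y : plane R => f (conf eps 0 y + x)).
Proof. move=> mf; exact: (cmeas_comp mf (measurable_conf_add eps x)). Qed.

Lemma cmod_mollify_le eps f x : 0 < eps -> cL1 leb2 f ->
  ((cmod (mollify eps f x))%:E <=
   \int[leb2]_y (cmod (f (conf eps 0 y + x)%R) * pois y)%:E)%E.
Proof.
move=> e0 lf; have [mf _] := lf; rewrite mollifyE//.
apply: (le_trans (cmod_cintegral_le _ _)).
  by apply: cmeasM; [exact: cmeas_dilate|apply: cmeas_real; exact: measurable_pois].
by under eq_integral do rewrite cmodM cmod_real (ger0_norm (pois_ge0 _)).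
Qed.

Lemma L2le_mollify eps f n : 0 < eps -> cL1 leb2 f -> L2le f n ->
  L2le (mollify eps f) n.
Proof.
move=> e0 lf [n0 mf fi]; split => //; first exact: cmeas_mollify.
have mm := cmeas_mollify eps mf.
apply: (le_trans (pois_average_sq (G := fun x y => cmod (f (conf eps 0 y + x)%R)) _ _ _ _ _)).
- exact: measurable_cmod.
- by apply: measurable_cmod; exact: (cmeas_comp mf (measurable_conf_addr eps)).
- by move=> x y; exact: cmod_ge0.
- by move=> x; exact: cmod_ge0.
- by move=> x; exact: cmod_mollify_le.
have fm : measurable_fun setT (fun x => (cmod (f x) ^+ 2)%:E).
  by apply/measurable_EFinP; apply: measurable_funX; exact: measurable_cmod.
under eq_integral => y _.
  under eq_integral do rewrite addrC.
  rewrite (integral_shift (conf eps 0 y) (f := fun x => (cmod (f x) ^+ 2)%:E) fm); last first.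
    by move=> x; rewrite lee_fin sqr_ge0.
  over.
rewrite ge0_integralZr//.
- by rewrite integral_pois mul1e.
- by apply/measurable_EFinP; exact: measurable_pois.
- by move=> y _; rewrite lee_fin pois_ge0.
- by apply: integral_ge0 => x _; rewrite lee_fin sqr_ge0.
Qed.

Lemma cL1_pois : cL1 leb2 (fun y : plane R => (pois y)%:C).
Proof.
apply: (@cL1_le _ _ _ leb2 _ pois).
- by apply: cmeas_real; exact: measurable_pois.
- exact: measurable_pois.
- by move=> x; rewrite cmod_real ger0_norm// pois_ge0.
- by rewrite integral_pois ltry.
Qed.

Lemma cintegral_pois : cintegral leb2 (fun y : plane R => (pois y)%:C) = 1.
Proof.
apply: complex_ext => /=; last by rewrite /Rintegral integral0.
by rewrite /Rintegral integral_pois.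
Qed.

Lemma cmod_mollify_sub eps f x : 0 < eps -> cL1 leb2 f ->
  ((cmod (mollify eps f x - f x))%:E <=
   \int[leb2]_y (cmod (f (conf eps 0 y + x)%R - f x) * pois y)%:E)%E.
Proof.
move=> e0 lf; have [mf fi] := lf; rewrite mollifyE//.
have e2 : eps ^+ 2 + 0 ^+ 2 != 0 :> R by rewrite expr0n/= addr0 gt_eqF// exprn_gt0.
have mp : cmeas (fun y : plane R => (pois y)%:C) by apply: cmeas_real; exact: measurable_pois.
have md := cmeas_dilate eps x mf.
have l1 : cL1 leb2 (fun y => f (conf eps 0 y + x) * (pois y)%:C).
  apply: (@cL1_le _ _ _ leb2 _ (fun y => cmod (f (conf eps 0 y + x)))).
  - exact: cmeasM.
  - exact: measurable_cmod.
  - by move=> y; rewrite cmodM ler_piMr ?cmod_ge0// cmod_real ger0_norm ?pois_ge0 ?pois_le1.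
  rewrite (integral_conf x (f := fun y => (cmod (f y))%:E) e2).
  - by rewrite lte_mul_pinfty// lee_fin invr_ge0 addr_ge0// sqr_ge0.
  - by apply/measurable_EFinP; exact: measurable_cmod.
  - by move=> y; rewrite lee_fin cmod_ge0.
have l2 := cL1Z (- f x) cL1_pois.
have -> : cintegral leb2 (fun y => f (conf eps 0 y + x) * (pois y)%:C) - f x =
    cintegral leb2 (fun y => f (conf eps 0 y + x) * (pois y)%:C + (- f x) * (pois y)%:C).
  by rewrite (cintegralD l1 l2) (cintegralZl _ cL1_pois) cintegral_pois mulr1.
apply: (le_trans (cmod_cintegral_le _ _)).
  by have [] := cL1D l1 l2.
under eq_integral do rewrite -mulrDl cmodM cmod_real (ger0_norm (pois_ge0 _)).
by [].
Qed.

Lemma cmod_sqB_le (a b : R[i]) : cmod (a - b) ^+ 2 <= 2 * (cmod a ^+ 2 + cmod b ^+ 2).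
Proof.
have := cmod_triangle a (- b); rewrite cmodN.
move: (cmod_ge0 (a - b)) (cmod_ge0 a) (cmod_ge0 b) => h1 h2 h3 h4.
by have := sqr_ge0 (cmod a - cmod b); nra.
Qed.

(** The squared error is at most the [pois] average of the squared L^2 modulus of continuity [T] at
    the displacements [conf eps 0 y]. That modulus is bounded by [4 * n ^ 2] and tends to 0 for each
    [y]. *)
Lemma mollify_cvg f n (e : R) : cL1 leb2 f -> L2le f n -> 0 < e ->
  \forall k \near \oo,
    (\int[leb2]_x (cmod (mollify k.+1%:R^-1 f x - f x) ^+ 2)%:E <= e%:E)%E.
Proof.
move=> lf Lf e0; have [n0 mf fi] := Lf.
have fm : measurable_fun setT (fun x => (cmod (f x) ^+ 2)%:E).
  by apply/measurable_EFinP; apply: measurable_funX; exact: measurable_cmod.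
pose T (h : plane R) := (\int[leb2]_x (cmod (f (x + h)%R - f x) ^+ 2)%:E)%E.
have T0 h : (0 <= T h)%E by apply: integral_ge0 => x _; rewrite lee_fin sqr_ge0.
have mfh (h : plane R) : cmeas (fun x : plane R => f (x + h)).
  apply: (cmeas_comp mf (g := fun x : plane R => x + h : plane R)).
  by apply: measurable_addV; [exact: measurable_id|exact: measurable_cst].
have Tle (h : plane R) : (T h <= (4 * n ^+ 2)%:E)%E.
  apply: (@le_trans _ _ (\int[leb2]_x (2%:E * ((cmod (f (x + h)%R) ^+ 2)%:E + (cmod (f x) ^+ 2)%:E)))%E).
    apply: ge0_le_integral => //.
    - by move=> x _; rewrite lee_fin sqr_ge0.
    - by apply/measurable_EFinP; apply: measurable_funX; apply: measurable_cmod; exact: cmeasB.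
    - apply: emeasurable_funM => //; apply: emeasurable_funD => //.
      by apply/measurable_EFinP; apply: measurable_funX; apply: measurable_cmod.
    - by move=> x _; rewrite -EFinD -EFinM lee_fin cmod_sqB_le.
  rewrite ge0_integralZl//; last 2 first.
  - apply: emeasurable_funD => //.
    by apply/measurable_EFinP; apply: measurable_funX; apply: measurable_cmod.
  - by move=> x _; rewrite adde_ge0 ?lee_fin ?sqr_ge0.
  rewrite ge0_integralD//; last 3 first.
  - by move=> x _; rewrite lee_fin sqr_ge0.
  - by apply/measurable_EFinP; apply: measurable_funX; apply: measurable_cmod.
  - by move=> x _; rewrite lee_fin sqr_ge0.
  rewrite (integral_shift h (f := fun x => (cmod (f x) ^+ 2)%:E) fm); last first.
    by move=> x; rewrite lee_fin sqr_ge0.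
  rewrite (_ : 4 * n ^+ 2 = 2 * (n ^+ 2 + n ^+ 2)); last by ring.
  by rewrite EFinM; apply: lee_wpmul2l => //; rewrite EFinD; exact: leeD.
have mT k : measurable_fun setT (fun y => T (conf k.+1%:R^-1 0 y)).
  apply: (measurable_integral (f := fun y x : plane R => (cmod (f (x + conf k.+1%:R^-1 0 y)%R - f x) ^+ 2)%:E) sigma_finite_leb2).
    apply/measurable_EFinP; apply: measurable_funX; apply: measurable_cmod; apply: cmeasB; last first.
      exact: (cmeas_comp mf measurable_snd).
    apply: (cmeas_comp mf (g := fun p : plane R * plane R => p.2 + conf k.+1%:R^-1 0 p.1 : plane R)).
    apply: measurable_addV; first exact: measurable_snd.
    by apply: measurable_conf; [exact: measurable_cst|exact: measurable_cst|exact: measurable_fst].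
  by move=> y x; rewrite lee_fin sqr_ge0.
have : \forall k \near \oo, (\int[leb2]_y ((pois y)%:E * T (conf k.+1%:R^-1 0 y)) <= e%:E)%E.
  apply: (@ae_dominated_to0 _ _ _ leb2 (fun k y => (pois y)%:E * T (conf k.+1%:R^-1 0 y))%E
    (fun y => (4 * n ^+ 2)%:E * (pois y)%:E)%E) => //.
  - by move=> k; apply: emeasurable_funM => //; apply/measurable_EFinP; exact: measurable_pois.
  - by apply: emeasurable_funM => //; apply/measurable_EFinP; exact: measurable_pois.
  - apply: aeW => y; apply: cvge0P => [k|r r0]; first by rewrite mule_ge0// lee_fin pois_ge0.
    have c0 (a : R) : (fun k => k.+1%:R^-1 * a) @ \oo --> (0 : R).
      by rewrite -[X in _ --> X](mul0r a); apply: cvgM; [exact: cvg_harmonic|exact: cvg_cst].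
    have c1 : (fun k => (conf k.+1%:R^-1 0 y).1) @ \oo --> (0 : R).
      by under eq_fun do rewrite /conf/= mul0r subr0; exact: c0.
    have c2 : (fun k => (conf k.+1%:R^-1 0 y).2) @ \oo --> (0 : R).
      by under eq_fun do rewrite /conf/= mul0r add0r; exact: c0.
    have := translation_cL2 Lf c1 c2 r0; apply: filterS => k hk.
    rewrite (le_trans _ hk)// -[leRHS]mul1e lee_pmul// ?lee_fin ?pois_ge0 ?pois_le1//.
  - move=> k y; rewrite mule_ge0 ?lee_fin ?pois_ge0//= muleC.
    by rewrite lee_pmul// lee_fin pois_ge0.
  - rewrite ge0_integralZl//.
    + by rewrite integral_pois mule1 ltry.
    + by apply/measurable_EFinP; exact: measurable_pois.
    + by move=> y _; rewrite lee_fin pois_ge0.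
    + by rewrite lee_fin mulr_ge0// sqr_ge0.
apply: filterS => k; apply: le_trans.
apply: (le_trans (pois_average_sq (G := fun x y => cmod (f (conf k.+1%:R^-1 0 y + x)%R - f x)) _ _ _ _ _)).
- by apply: measurable_cmod; apply: cmeasB => //; exact: cmeas_mollify.
- apply: measurable_cmod; apply: cmeasB; first exact: (cmeas_comp mf (measurable_conf_addr _)).
  exact: (cmeas_comp mf measurable_fst).
- by move=> x y; exact: cmod_ge0.
- by move=> x; exact: cmod_ge0.
- by move=> x; apply: cmod_mollify_sub => //; rewrite invr_gt0.
rewrite le_eqVlt; apply/orP; left; apply/eqP; apply: eq_integral => y _.
by congr (_ * _)%E; apply: eq_integral => x _; rewrite [conf _ _ _ + _]addrC.
Qed.

End poisson2.

(** * Plancherel and inversion *)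

Lemma cmod_cintegral_real d (T : measurableType d) (R : realType)
    (mu : {measure set T -> \bar R}) (r : T -> R) :
  measurable_fun setT r -> (forall x, 0 <= r x) -> (\int[mu]_x (r x)%:E < +oo)%E ->
  ((cmod (cintegral mu (fun x => (r x)%:C)))%:E = \int[mu]_x (r x)%:E)%E.
Proof.
move=> mr r0 ri; have I0 : (0 <= \int[mu]_x (r x)%:E)%E by apply: integral_ge0 => x _; rewrite lee_fin.
rewrite (_ : cintegral mu _ = (fine (\int[mu]_x (r x)%:E))%:C); last first.
  by apply: complex_ext => //=; rewrite /Rintegral integral0.
by rewrite cmod_real ger0_norm ?fine_ge0// fineK// ge0_fin_numE.
Qed.

Lemma ae_eq0_of_small d (T : measurableType d) (R : realType)
    (mu : {measure set T -> \bar R}) (f : T -> R[i]) : cmeas f ->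
  (forall e, 0 < e -> (\int[mu]_x (cmod (f x) ^+ 2)%:E <= e%:E)%E) ->
  {ae mu, forall x, f x = 0}.
Proof.
move=> mf h.
have mc : measurable_fun setT (fun x => (cmod (f x) ^+ 2)%:E).
  by apply/measurable_EFinP; apply: measurable_funX; exact: measurable_cmod.
have : (\int[mu]_x `|(cmod (f x) ^+ 2)%:E| = 0)%E.
  apply/eqP; rewrite eq_le integral_ge0// andbT.
  apply/lee_addgt0Pr => e e0; rewrite add0e.
  under eq_integral do rewrite gee0_abs ?lee_fin ?sqr_ge0//.
  exact: h.
move/(ae_eq_integral_abs mu measurableT mc); apply: filterS => x /(_ I) [] /eqP.
by rewrite expf_eq0/= => /eqP; exact: cmod_eq0.
Qed.

Section plancherel.
Context {R : realType}.
Local Notation mR := (measurableTypeR R).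
Implicit Types f g : plane R -> R[i].

Lemma parseval f g : cL1 leb2 f -> cL1 leb2 g ->
  cintegral leb2 (fun xi => g xi * cj (fourier1 f xi)) =
  cintegral leb2 (fun x => ift g x * cj (f x)).
Proof.
move=> lf lg; have [mf fi] := lf; have [mg gi] := lg.
pose Phi (xi x : plane R) := kappa%:C * cj (f x) * (g xi * expi (edot x xi)).
transitivity (cintegral leb2 (fun xi => cintegral leb2 (Phi xi))).
  apply: eq_cintegral => xi.
  have lfe : cL1 leb2 (fun x => f x * expi (- edot x xi)).
    by apply: cL1_expi => //; exact: measurable_edotN.
  rewrite fourier1E cjM cj_real -cintegralJ// mulrA -cintegralZl; last exact: cL1J.
  by apply: eq_cintegral => x; rewrite /Phi cjM expiN cjK; ring.
rewrite (cfubini sigma_finite_leb2 sigma_finite_leb2).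
- apply: eq_cintegral => x; rewrite /Phi cintegralZl; last first.
    by apply: cL1_expi => //; apply: measurable_edot; measurability.
  by rewrite iftE//; ring.
- apply: cmeasM.
    apply: cmeasM; first exact: cmeas_cst.
    by apply: cmeasJ; exact: (cmeas_comp mf measurable_snd).
  apply: cmeasM; first exact: (cmeas_comp mg measurable_fst).
  by apply: cmeas_expi; apply: measurable_edot; measurability.
- have mcf : measurable_fun setT (fun x => (kappa * cmod (f x))%:E).
    by apply/measurable_EFinP; apply: measurable_funM => //; exact: measurable_cmod.
  have mcg : measurable_fun setT (fun x => (cmod (g x))%:E).
    by apply/measurable_EFinP; exact: measurable_cmod.
  under eq_integral => xi _.
    under eq_integral => x _ do rewrite /Phi !cmodM cmod_expi mulr1 cmod_real cmodJ mulrC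
        (gtr0_norm kappa_gt0) EFinM.
    over.
  rewrite (integral_prod2 mcg mcf).
  + have [_] := cL1Z kappa%:C lf; under eq_integral do rewrite cmodM cmod_real (gtr0_norm kappa_gt0).
    apply: lte_mul_pinfty; last by rewrite ge0_fin_numE// integral_ge0// => x _; rewrite lee_fin cmod_ge0.
    by apply: integral_ge0 => x _; rewrite lee_fin cmod_ge0.
  + by move=> x; rewrite lee_fin cmod_ge0.
  + by move=> x; rewrite lee_fin mulr_ge0 ?cmod_ge0// ltW// kappa_gt0.
Qed.

Lemma cvg_wexp2 (xi : plane R) : wexp2 k.+1%:R^-1 xi @[k --> \oo] --> (1 : R).
Proof.
have h (s : R) : wexp k.+1%:R^-1 s @[k --> \oo] --> (1 : R).
  have c : - (k.+1%:R^-1 * `|s|) @[k --> \oo] --> (- (0 * `|s|) : R).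
    by apply: cvgN; apply: cvgM; [exact: cvg_harmonic|exact: cvg_cst].
  have := cvg_comp _ _ c (@continuous_expR R _).
  by rewrite mul0r oppr0 expR0.
by rewrite -[X in _ --> X](mulr1 1); apply: cvgM; exact: h.
Qed.

Lemma invS_gt0 k : 0 < k.+1%:R^-1 :> R. Proof. by rewrite invr_gt0. Qed.

Lemma L2le_mul_int f g n : L2le f n -> L2le g n ->
  (\int[leb2]_x (cmod (f x) * cmod (g x))%:E <= (n ^+ 2)%:E)%E.
Proof.
move=> [n0 mf fi] [_ mg gi].
have mcf := measurable_cmod mf; have mcg := measurable_cmod mg.
apply: (@le_trans _ _ (\int[leb2]_x (2^-1%:E * ((cmod (f x) ^+ 2)%:E + (cmod (g x) ^+ 2)%:E)))%E).
  apply: ge0_le_integral => //.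
  - by move=> x _; rewrite lee_fin mulr_ge0// cmod_ge0.
  - by apply/measurable_EFinP; measurability.
  - apply: emeasurable_funM => //; apply: emeasurable_funD.
      by apply/measurable_EFinP; measurability.
    by apply/measurable_EFinP; measurability.
  - by move=> x _; rewrite -EFinD -EFinM lee_fin; have := sqr_ge0 (cmod (f x) - cmod (g x)); nra.
rewrite ge0_integralZl//; last 2 first.
- apply: emeasurable_funD; first by apply/measurable_EFinP; measurability.
  by apply/measurable_EFinP; measurability.
- by move=> x _; rewrite -EFinD lee_fin addr_ge0// sqr_ge0.
rewrite ge0_integralD//; last 4 first.
- by move=> x _; rewrite lee_fin sqr_ge0.
- by apply/measurable_EFinP; measurability.
- by move=> x _; rewrite lee_fin sqr_ge0.
- by apply/measurable_EFinP; measurability.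
rewrite (_ : n ^+ 2 = 2^-1 * (n ^+ 2 + n ^+ 2)); last by field.
by rewrite EFinM; apply: lee_wpmul2l; rewrite ?lee_fin// EFinD leeD.
Qed.

(** Parseval turns the damped integral of the squared transform into the pairing of the
    mollification of [f] with [f], which is at most [n ^ 2] because mollification keeps L^2 bounds.
    Fatou's lemma lifts the damping. *)
Lemma plancherel_le f n : cL1 leb2 f -> L2le f n -> L2le (fourier1 f) n.
Proof.
move=> lf Lf; have [n0 mf fi] := Lf; have mF := cmeas_fourier1 mf.
split => //.
have mcF := measurable_cmod mF.
apply: (@ge0_fatou_le _ _ R leb2 (fun k xi => wexp2 k.+1%:R^-1 xi * cmod (fourier1 f xi) ^+ 2)).
- move=> k; apply: measurable_funM; first exact: measurable_wexp2.
  exact: measurable_funX.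
- by move=> k xi; rewrite mulr_ge0 ?sqr_ge0// ltW// wexp2_gt0.
- move=> xi; rewrite -[X in _ --> X]mul1r; apply: cvgM; last exact: cvg_cst.
  exact: cvg_wexp2.
move=> k; have e0 := invS_gt0 k; have lg := cL1_wexp2_fourier e0 lf.
have [M M0 hM] := fourier1_bounded lf.
have E : (fun xi => (wexp2 k.+1%:R^-1 xi)%:C * fourier1 f xi * cj (fourier1 f xi)) =
   (fun xi => (wexp2 k.+1%:R^-1 xi * cmod (fourier1 f xi) ^+ 2)%:C).
  by apply/funext => xi; rewrite -mulrA mul_cj -rmorphM.
have hfin : (\int[leb2]_xi (wexp2 k.+1%:R^-1 xi * cmod (fourier1 f xi) ^+ 2)%:E < +oo)%E.
  have [_ h] := lg; apply: (@le_lt_trans _ _ (M%:E * \int[leb2]_xi (cmod ((wexp2 k.+1%:R^-1 xi)%:C * fourier1 f xi))%:E)%E); last first.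
    by rewrite lte_mul_pinfty// lee_fin ltW.
  rewrite -ge0_integralZl//; last 3 first.
  - by apply/measurable_EFinP; apply: measurable_cmod; have [] := lg.
  - by move=> x _; rewrite lee_fin cmod_ge0.
  - by rewrite lee_fin ltW.
  apply: ge0_le_integral => //.
  - by move=> xi _; rewrite lee_fin mulr_ge0 ?sqr_ge0// ltW// wexp2_gt0.
  - apply/measurable_EFinP; apply: measurable_funM; first exact: measurable_wexp2.
    exact: measurable_funX.
  - apply/measurable_EFinP; apply: measurable_funM => //; apply: measurable_cmod; by have [] := lg.
  - move=> xi _; rewrite -EFinM lee_fin cmodM cmod_real gtr0_norm ?wexp2_gt0// expr2 mulrA mulrC.
    by rewrite ler_wpM2r// mulr_ge0 ?cmod_ge0// ltW// wexp2_gt0.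
rewrite -cmod_cintegral_real//; last 2 first.
- apply: measurable_funM; first exact: measurable_wexp2.
  exact: measurable_funX.
- by move=> xi; rewrite mulr_ge0 ?sqr_ge0// ltW// wexp2_gt0.
rewrite -E (parseval lf lg).
have Lm := L2le_mollify e0 lf Lf; have [_ mm _] := Lm.
apply: (le_trans (cmod_cintegral_le _ _)).
  by apply: cmeasM => //; exact: cmeasJ.
by under eq_integral do rewrite cmodM cmodJ; exact: L2le_mul_int.
Qed.

(** All mollifications vanish, and they converge to [f] in L^2. *)
Lemma fourier1_eq0 f n : cL1 leb2 f -> L2le f n -> (forall xi, fourier1 f xi = 0) ->
  {ae leb2, forall x, f x = 0}.
Proof.
move=> lf Lf h; have [n0 mf fi] := Lf; apply: ae_eq0_of_small => // e e0.
have [k _ /(_ k (leqnn _))] := mollify_cvg lf Lf e0.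
apply: le_trans; rewrite le_eqVlt; apply/orP; left; apply/eqP.
apply: eq_integral => x _; congr (_ ^+ 2)%:E.
rewrite /mollify iftE; last by apply: cL1_wexp2_fourier => //; exact: invS_gt0.
rewrite (@eq_cintegral _ _ _ leb2 _ (cst 0)); last by move=> xi; rewrite h mulr0 mul0r.
by rewrite cintegral0 mulr0 sub0r cmodN.
Qed.

Lemma mollify_cvg_ift f x : cL1 leb2 f -> cL1 leb2 (fourier1 f) ->
  cmod (mollify k.+1%:R^-1 f x - ift (fourier1 f) x) @[k --> \oo] --> 0.
Proof.
move=> lf lF; have [mF Fi] := lF; have mcF := measurable_cmod mF.
have k0 : 0 <= kappa :> R by rewrite ltW// kappa_gt0.
apply/cvgrPdist_le => e e0.
have ek : 0 < e / kappa by rewrite divr_gt0// kappa_gt0.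
have : \forall k \near \oo,
    (\int[leb2]_xi ((1 - wexp2 k.+1%:R^-1 xi) * cmod (fourier1 f xi))%:E <= (e / kappa)%:E)%E.
  apply: (@dominated_to0 _ _ _ leb2 (fun k xi => (1 - wexp2 k.+1%:R^-1 xi) * cmod (fourier1 f xi))
     (fun xi => cmod (fourier1 f xi))) => //.
  - move=> k; apply: measurable_funM => //; apply: measurable_funB => //.
    exact: measurable_wexp2.
  - move=> xi; rewrite -(mul0r (cmod (fourier1 f xi))); apply: cvgM; last exact: cvg_cst.
    by rewrite -(subrr 1); apply: cvgB; [exact: cvg_cst|exact: cvg_wexp2].
  - move=> k xi; have w0 := wexp2_gt0 (k.+1%:R^-1) xi; have w1 := wexp2_le1 xi (invS_gt0 k).
    by rewrite mulr_ge0 ?subr_ge0 ?cmod_ge0//= ler_piMl ?cmod_ge0// gerBl ltW.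
apply: filterS => k hk.
rewrite sub0r normrN ger0_norm ?cmod_ge0//.
have e1 := invS_gt0 k.
have lw := cL1_wexp2_fourier e1 lf.
have mx : measurable_fun setT (fun xi : plane R => edot x xi) by apply: measurable_edot; measurability.
have l1 := cL1_expi lw mx; have l2 := cL1_expi lF mx.
have -> : mollify k.+1%:R^-1 f x - ift (fourier1 f) x = kappa%:C *
   cintegral leb2 (fun xi => (wexp2 k.+1%:R^-1 xi)%:C * fourier1 f xi * expi (edot x xi) +
     (-1) * (fourier1 f xi * expi (edot x xi))).
  by rewrite (cintegralD l1 (cL1Z (-1) l2)) (cintegralZl _ l2) /mollify !iftE// mulN1r mulrBr.
rewrite cmodM cmod_real ger0_norm// mulrC -ler_pdivlMr ?kappa_gt0// -lee_fin.
apply: le_trans hk; apply: (le_trans (cmod_cintegral_le _ _)).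
  by have [] := cL1D l1 (cL1Z (-1) l2).
rewrite le_eqVlt; apply/orP; left; apply/eqP; apply: eq_integral => xi _.
have w1 := wexp2_le1 xi e1.
rewrite mulN1r -mulrA -[X in _ - X]mul1r -mulrBl cmodM cmodM cmod_expi mulr1 mulrC.
rewrite (_ : _ - 1 = (wexp2 k.+1%:R^-1 xi - 1)%:C); last by rewrite rmorphB.
by rewrite cmod_real mulrC distrC ger0_norm ?subr_ge0.
Qed.

Lemma cmod_dist (a b : R[i]) : `|cmod a - cmod b| <= cmod (a - b).
Proof.
rewrite ler_norml; apply/andP; split.
  have := cmod_triangle (b - a) a; rewrite subrK -(cmodN (b - a)) opprB; lra.
by have := cmod_triangle (a - b) b; rewrite subrK; lra.
Qed.

(** The mollifications converge to [f] in L^2 and pointwise to the inverse transform; Fatou's lemma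
    identifies the two limits. *)
Lemma fourier_inversion f n : cL1 leb2 f -> L2le f n -> cL1 leb2 (fourier1 f) ->
  {ae leb2, forall x, f x = ift (fourier1 f) x}.
Proof.
move=> lf Lf lF; have [n0 mf fi] := Lf; have [mF Fi] := lF.
have mI : cmeas (ift (fourier1 f)) by exact: cmeas_ift.
suff : {ae leb2, forall x, ift (fourier1 f) x - f x = 0}.
  by apply: filterS => x /eqP; rewrite subr_eq0 => /eqP.
apply: ae_eq0_of_small => [|e e0]; first exact: cmeasB.
have [N _ hN] := mollify_cvg lf Lf e0.
apply: (@ge0_fatou_le _ _ R leb2 (fun k x => cmod (mollify (k + N).+1%:R^-1 f x - f x) ^+ 2)).
- move=> k; apply: measurable_funX; apply: measurable_cmod; apply: cmeasB => //.
  exact: cmeas_mollify.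
- by move=> k x; exact: sqr_ge0.
- move=> x.
  have c : cmod (mollify k.+1%:R^-1 f x - f x) @[k --> \oo] --> cmod (ift (fourier1 f) x - f x).
    apply/cvgrPdist_le => r r0.
    have /cvgrPdist_le/(_ _ r0) := mollify_cvg_ift x lf lF.
    apply: filterS => k; rewrite sub0r normrN ger0_norm ?cmod_ge0//; apply: le_trans.
    by rewrite distrC (le_trans (cmod_dist _ _))// opprB addrA subrK.
  apply: (cvgM (f := fun k => cmod (mollify (k + N).+1%:R^-1 f x - f x))
               (g := fun k => cmod (mollify (k + N).+1%:R^-1 f x - f x))).
    by rewrite -(cvg_shiftn N) in c.
  by rewrite -(cvg_shiftn N) in c.
- by move=> k; apply: hN => /=; rewrite leq_addl.
Qed.

End plancherel.

(** * Weighted L^2 bounds *)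

Lemma enorm_ge_fst (R : realType) (x : plane R) : `|x.1| <= enorm x.
Proof. by rewrite /enorm -sqrtr_sqr ler_wsqrtr// lerDl sqr_ge0. Qed.

Lemma enorm_ge_snd (R : realType) (x : plane R) : `|x.2| <= enorm x.
Proof. by rewrite /enorm -sqrtr_sqr ler_wsqrtr// lerDr sqr_ge0. Qed.

Section bootstrap_phi.
Context {R : realType}.
Local Notation mR := (measurableTypeR R).
Implicit Types f g h : plane R -> R[i].

Definition cabs f (x : plane R) : R := cmod (f x).

Lemma cabs_ge0 f x : 0 <= cabs f x. Proof. exact: cmod_ge0. Qed.

Lemma measurable_cabs f : cmeas f -> measurable_fun setT (cabs f).
Proof. exact: measurable_cmod. Qed.

Lemma meas3_cabs f1 f2 f3 f4 : cmeas f1 -> cmeas f2 -> cmeas f3 -> cmeas f4 ->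
  meas3 (quad (cst 1) (cabs f1) (cabs f2) (cabs f3) (cabs f4)).
Proof. by move=> *; apply: measurable_quad => //; exact: measurable_cabs. Qed.

Lemma quad_cabs_ge0 f1 f2 f3 f4 l z x :
  0 <= quad (cst 1) (cabs f1) (cabs f2) (cabs f3) (cabs f4) l z x.
Proof. by apply: quad_ge0 => *; rewrite ?cabs_ge0. Qed.

Lemma cmod_cform_le f1 f2 f3 f4 l : cmeas f1 -> cmeas f2 -> cmeas f3 -> cmeas f4 ->
  ((cmod (cform l f1 f2 f3 f4))%:E <=
   \int[leb2]_z \int[leb2]_x
     (quad (cst 1%R) (cabs f1) (cabs f2) (cabs f3) (cabs f4) l z x)%:E)%E.
Proof.
move=> m1 m2 m3 m4; have mq := cmeas_cquad_l l m1 m2 m3 m4.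
apply: (le_trans (cmod_cintegral_le _ mq)).
rewrite (integral_prodm _ _ (f := fun p => (cmod (cquad f1 f2 f3 f4 l p.1 p.2))%:E)); first last.
- by move=> x; rewrite lee_fin cmod_ge0.
- by apply/measurable_EFinP; exact: measurable_cmod.
by under eq_integral do under eq_integral do rewrite cmod_cquad.
Qed.

Lemma cmod_int_cform_le f1 f2 f3 f4 (g : mR -> plane R -> plane R -> R) :
  cmeas f1 -> cmeas f2 -> cmeas f3 -> cmeas f4 ->
  meas3 g -> (forall l z x, 0 <= g l z x) ->
  (forall l, (cmod (cform l f1 f2 f3 f4))%:E <=
    \int[leb2]_z \int[leb2]_x (g l z x)%:E)%E ->
  ((cmod (cintegral leb (fun l => cform l f1 f2 f3 f4)))%:E <= int3 g)%E.
Proof.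
move=> m1 m2 m3 m4 mg g0 hg; have mc := cmeas_cform m1 m2 m3 m4.
apply: (le_trans (cmod_cintegral_le _ mc)); apply: ge0_le_integral => //.
- by move=> l _; rewrite lee_fin cmod_ge0.
- by apply/measurable_EFinP; exact: measurable_cmod.
- exact: measurable_int_zx.
Qed.

Variables (omega : R) (phi : plane R -> R[i]) (n : R).
Hypothesis phi_L2 : L2le phi n.
Hypothesis phi_eq : {ae @leb2 R, forall z : R * R,
  omega%:C * phi z = trilinear phi phi phi z}.

Lemma L2le_mul_bounded (v : plane R -> R) (M : R) f m : L2le f m ->
  measurable_fun setT v -> (forall x, 0 <= v x <= M) -> 0 < M ->
  L2le (fun x => (v x)%:C * f x) (M * m).
Proof.
move=> [m0 mf fi] mv vM M0; split; first exact: mulr_gt0.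
  by apply: cmeasM => //; exact: cmeas_real.
have mcf := measurable_cmod mf.
apply: (@le_trans _ _ (\int[leb2]_x ((M ^+ 2)%:E * (cmod (f x) ^+ 2)%:E))%E).
  apply: ge0_le_integral => //.
  - by move=> x _; rewrite lee_fin sqr_ge0.
  - by apply/measurable_EFinP; apply: measurable_funX; apply: measurable_cmod;
      apply: cmeasM => //; exact: cmeas_real.
  - by apply: emeasurable_funM => //; apply/measurable_EFinP; exact: measurable_funX.
  - move=> x _; rewrite -EFinM lee_fin cmodM exprMn ler_wpM2r ?sqr_ge0// cmod_real.
    by have /andP[v0 v1] := vM x; rewrite ger0_norm// lerXn2r ?nnegrE// ltW.
rewrite ge0_integralZl//; last 3 first.
- by apply/measurable_EFinP; exact: measurable_funX.
- by move=> x _; rewrite lee_fin sqr_ge0.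
- by rewrite lee_fin sqr_ge0.
by rewrite [(M * m) ^+ 2]exprMn [leRHS]EFinM lee_wpmul2l// lee_fin sqr_ge0.
Qed.

Lemma integral_bounded_sq_lty (v : plane R -> R) (M : R) f m : L2le f m ->
  measurable_fun setT v -> (forall x, 0 <= v x <= M) -> 0 < M ->
  (\int[leb2]_x (v x * cabs f x ^+ 2)%:E < +oo)%E.
Proof.
move=> [m0 mf fi] mv vM M0; have mcf := measurable_cabs mf.
apply: (@le_lt_trans _ _ (\int[leb2]_x (M%:E * (cabs f x ^+ 2)%:E))%E).
  apply: ge0_le_integral => //.
  - by move=> x _; rewrite lee_fin mulr_ge0 ?sqr_ge0//; have /andP[] := vM x.
  - by apply/measurable_EFinP; apply: measurable_funM => //; exact: measurable_funX.
  - by apply: emeasurable_funM => //; apply/measurable_EFinP; exact: measurable_funX.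
  - by move=> x _; rewrite -EFinM lee_fin ler_wpM2r ?sqr_ge0//; have /andP[] := vM x.
rewrite ge0_integralZl//; last 3 first.
- by apply/measurable_EFinP; exact: measurable_funX.
- by move=> x _; rewrite lee_fin sqr_ge0.
- by rewrite lee_fin ltW.
by rewrite lte_mul_pinfty ?lee_fin ?(ltW M0)//; apply: (le_lt_trans fi); rewrite ltry.
Qed.

Lemma weighted_bootstrap_phi : omega != 0 ->
  exists2 mu, 0 < mu &
    (\int[leb2]_x ((expR (mu * enorm x) * cabs phi x) ^+ 2)%:E < +oo)%E.
Proof.
move=> w0; have [n0 mphi phii] := phi_L2.
apply: (@weighted_bootstrap R (cabs phi) `|omega| n) => //.
- exact: measurable_cabs.
- by move=> x; exact: cabs_ge0.
- by rewrite normr_gt0.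
move=> v mv v0 [M hM].
have M0 : 0 < `|M| + 1 by rewrite ltr_wpDl.
have vM x : 0 <= v x <= `|M| + 1.
  by rewrite v0/= (le_trans (hM x))// (le_trans (ler_norm M))// lerDl.
have Lh := L2le_mul_bounded phi_L2 mv vM M0; have [_ mh _] := Lh.
have E := pairing phi_L2 phi_eq Lh.
have mu2 : measurable_fun setT (fun x => v x * cabs phi x ^+ 2).
  by apply: measurable_funM => //; apply: measurable_funX; exact: measurable_cabs.
have u0 x : 0 <= v x * cabs phi x ^+ 2 by rewrite mulr_ge0 ?sqr_ge0.
rewrite -(cmod_cintegral_real mu2 u0 (integral_bounded_sq_lty phi_L2 mv vM M0)).
rewrite -EFinM -cmod_real -cmodM.
rewrite (@eq_cintegral _ _ _ leb2 _ (fun x => phi x * cj ((v x)%:C * phi x))); last first.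
  by move=> x; rewrite cjM cj_real [RHS]mulrCA mul_cj -rmorphM.
rewrite E.
rewrite (_ : (fun x => v x * cabs phi x) = cabs (fun x => (v x)%:C * phi x)); last first.
  by apply/funext => x; rewrite /cabs cmodM cmod_real ger0_norm.
apply: cmod_int_cform_le => //; first exact: meas3_cabs.
- by move=> l z x; exact: quad_cabs_ge0.
- by move=> l; exact: cmod_cform_le.
Qed.

Lemma L2le_cj f m : L2le f m -> L2le (fun x => cj (f x)) m.
Proof.
move=> [m0 mf fi]; split => //; first exact: cmeasJ.
by under eq_integral do rewrite cmodJ.
Qed.

Lemma L2le_ift f m : cL1 leb2 f -> L2le f m -> L2le (ift f) m.
Proof.
move=> lf Lf; have h := plancherel_le (cL1J lf) (L2le_cj Lf).
exact: (L2le_cj h).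
Qed.

Hypothesis phi_L1 : cL1 leb2 phi.

(** In [cform_fourier] the third slot is [ift] of an integrable function, but [fourier1 phi] is not
    yet known to be integrable. The mollification of [phi] fits the slot; its damping factor is at
    most 1, and the error it causes is small by the slice bound. *)
Lemma cmod_cform_ift_le l g m : cL1 leb2 g -> L2le g m ->
  ((cmod (cform l phi phi phi (ift g)))%:E <=
   \int[leb2]_z \int[leb2]_x
     (quad (cst 1%R) (cabs (fourier1 phi)) (cabs (fourier1 phi)) (cabs (fourier1 phi)) (cabs g) l z x)%:E)%E.
Proof.
move=> lg Lg; have [n0 mphi phii] := phi_L2; have [m0 mg gi] := Lg.
have Lift := L2le_ift lg Lg; have [_ mift _] := Lift.
have mF := cmeas_fourier1 mphi.
(* The slice bound with the third norm set to 1: an L^2 error of [e / B] in the third slot changes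
   the form by at most [e]. *)
pose B := kern l * (n * n * 1 * m).
have B0 : 0 < B by rewrite !mulr_gt0 ?kern_gt0.
apply/lee_addgt0Pr => e e0.
have d0 : 0 < (e / B) ^+ 2 by rewrite exprn_gt0// divr_gt0.
have [k _ /(_ k (leqnn _))] := mollify_cvg phi_L1 phi_L2 d0.
have e1 := @invS_gt0 R k; set eps := k.+1%:R^-1 in e1 *; move=> hd.
have Lm := L2le_mollify e1 phi_L1 phi_L2; have [_ mm _] := Lm.
have Ld : L2le (fun x => phi x - mollify eps phi x) (e / B).
  split; first by rewrite divr_gt0.
    exact: cmeasB.
  by under eq_integral do rewrite -cmodN opprB.
have l1 := cL1_cquad l phi_L2 phi_L2 Lm Lift.
have l2 := cL1_cquad l phi_L2 phi_L2 Ld Lift.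
have -> : cform l phi phi phi (ift g) = cform l phi phi (mollify eps phi) (ift g) +
    cform l phi phi (fun x => phi x - mollify eps phi x) (ift g).
  rewrite /cform -(cintegralD l1 l2); apply: eq_cintegral => p.
  rewrite /cquad -mulrDl -mulrDr -cjD; congr (_ * cj _ * _).
  by rewrite [RHS]addrC subrK.
apply: (@le_trans _ _ ((cmod (cform l phi phi (mollify eps phi) (ift g)))%:E +
   (cmod (cform l phi phi (fun x => phi x - mollify eps phi x) (ift g)))%:E)%E).
  by rewrite -EFinD lee_fin cmod_triangle.
apply: leeD.
  rewrite /mollify (cform_fourier l phi_L1 phi_L1 (cL1_wexp2_fourier e1 phi_L1) lg).
  have mw : cmeas (fun xi => (wexp2 eps xi)%:C * fourier1 phi xi).
    by apply: cmeasM => //; apply: cmeas_real; exact: measurable_wexp2.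
  apply: (le_trans (cmod_cform_le l mF mF mw mg)).
  have M1 := meas3_cabs mF mF mw mg; have M2 := meas3_cabs mF mF mF mg.
  apply: ge0_le_integral => //.
  - by move=> z _; apply: integral_ge0 => x _; rewrite lee_fin quad_cabs_ge0.
  - apply: (measurable_fun_pair2 l (measurable_int_x M1 _)) => *; exact: quad_cabs_ge0.
  - apply: (measurable_fun_pair2 l (measurable_int_x M2 _)) => *; exact: quad_cabs_ge0.
  move=> z _; apply: ge0_le_integral => //.
  - by move=> x _; rewrite lee_fin quad_cabs_ge0.
  - by apply/measurable_EFinP; exact: meas3_slice.
  - by apply/measurable_EFinP; exact: meas3_slice.
  - move=> x _; rewrite lee_fin /quad !mul1r ler_wpM2r ?cabs_ge0// ler_wpM2l ?mulr_ge0 ?cabs_ge0//.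
    rewrite /cabs cmodM cmod_real gtr0_norm ?wexp2_gt0//.
    by rewrite ler_piMl ?cmod_ge0// wexp2_le1.
apply: (le_trans (cmod_cform_le l mphi mphi _ mift)); first by have [] := Ld.
have := cquad_slice_le l phi_L2 phi_L2 Ld Lift.
under eq_integral do under eq_integral do rewrite cmod_cquad.
rewrite (_ : kern l * (n * n * (e / B) * m) = e)//.
by rewrite /B; have := lt0r_neq0 n0; have := lt0r_neq0 m0; have := lt0r_neq0 (kern_gt0 l);
  generalize (kern l) => a a0 m1 n1; field; rewrite a0 m1 n1.
Qed.

Definition disk (N : nat) (x : plane R) : R := (enorm x <= N%:R)%R%:R.

Lemma disk01 N x : 0 <= disk N x <= 1.
Proof. by rewrite /disk ler0n lern1 leq_b1. Qed.

Lemma measurable_disk N : measurable_fun setT (disk N).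
Proof.
apply: measurable_bool; apply: measurable_fun_ler; last exact: measurable_cst.
exact: measurable_enorm.
Qed.

(** On the disk of radius [N] the modulus is at most [1 + |f|^2], and there the constant 1 is
    dominated by a multiple of the integrable [wexp2 1]. *)
Lemma cL1_disk N f m (M : R) (v : plane R -> R) : L2le f m -> measurable_fun setT v ->
  (forall x, 0 <= v x <= M) -> cL1 leb2 (fun x => (disk N x * v x)%:C * f x).
Proof.
move=> [m0 mf fi] mv vM; have mcf := measurable_cmod mf; have md := measurable_disk N.
have M0 : 0 <= M by have /andP[a b] := vM 0; exact: le_trans b.
have mw := @measurable_wexp2 R 1.
apply: (@cL1_le _ _ _ leb2 _ (fun x => M * (expR (N%:R + N%:R) * wexp2 1 x + cmod (f x) ^+ 2))).
- by apply: cmeasM => //; apply: cmeas_real; exact: measurable_funM.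
- by apply: measurable_funM => //; apply: measurable_funD; apply: measurable_funM.
- move=> x; have /andP[v0 v1] := vM x; rewrite cmodM cmod_real.
  have w0 : 0 <= expR (N%:R + N%:R) * wexp2 1 x by rewrite mulr_ge0 ?expR_ge0// ltW// wexp2_gt0.
  rewrite /disk; have [xN|xN] := leP (enorm x) N%:R; last first.
    by rewrite mul0r normr0 mul0r mulr_ge0// addr_ge0// sqr_ge0.
  rewrite mul1r ger0_norm//; apply: ler_pM => //; first exact: cmod_ge0.
  have h1 : 1 <= expR (N%:R + N%:R) * wexp2 1 x.
    rewrite /wexp2 /wexp -!expRD -[leLHS]expR0 ler_expR.
    have := enorm_ge_fst x; have := enorm_ge_snd x; lra.
  by have := sqr_ge0 (cmod (f x) - 2^-1); nra.
have mw2 : measurable_fun setT (fun x : plane R => (expR (N%:R + N%:R) * wexp2 1 x)%:E).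
  by apply/measurable_EFinP; exact: measurable_funM.
have mc2 : measurable_fun setT (fun x => (cmod (f x) ^+ 2)%:E).
  by apply/measurable_EFinP; exact: measurable_funX.
under eq_integral do rewrite EFinM EFinD.
rewrite ge0_integralZl//; last 2 first.
- exact: emeasurable_funD.
- by move=> x _; rewrite -EFinD lee_fin addr_ge0 ?sqr_ge0// mulr_ge0 ?expR_ge0// ltW// wexp2_gt0.
rewrite lte_mul_pinfty ?lee_fin// ge0_integralD//; last 2 first.
- by move=> x _; rewrite lee_fin mulr_ge0 ?expR_ge0// ltW// wexp2_gt0.
- by move=> x _; rewrite lee_fin sqr_ge0.
apply: lte_add_pinfty; last by apply: (le_lt_trans fi); rewrite ltry.
have [_] := cL1Z (expR (N%:R + N%:R))%:C (@cL1_wexp2 R 1 ltr01).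
under eq_integral do rewrite cmodM !cmod_real (gtr0_norm (expR_gt0 _)) (gtr0_norm (wexp2_gt0 _ _)).
by [].
Qed.

(** The equation lives on the space side, so the test function is [ift g], and [g] has to be
    integrable for the form to pass to the frequency side. Cutting [v] times the transform to a disk
    ensures this, and Fatou's lemma removes the disk. *)
Lemma weighted_bootstrap_fourier : omega != 0 ->
  exists2 mu, 0 < mu &
    (\int[leb2]_x ((expR (mu * enorm x) * cabs (fourier1 phi) x) ^+ 2)%:E < +oo)%E.
Proof.
move=> w0; have [n0 mphi phii] := phi_L2.
have LF := plancherel_le phi_L1 phi_L2; have [_ mF Fi] := LF.
set F := fourier1 phi in LF mF Fi *.
apply: (@weighted_bootstrap R (cabs F) `|omega| n) => //.
- exact: measurable_cabs.
- by move=> x; exact: cabs_ge0.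
- by rewrite normr_gt0.
move=> v mv v0 [M hM].
have M0 : 0 < `|M| + 1 by rewrite ltr_wpDl.
have vM x : 0 <= v x <= `|M| + 1.
  by rewrite v0/= (le_trans (hM x))// (le_trans (ler_norm M))// lerDl.
have mcF := measurable_cabs mF.
have u0 x : 0 <= v x * cabs F x ^+ 2 by rewrite mulr_ge0 ?sqr_ge0.
have u0N N x : 0 <= disk N x * v x * cabs F x ^+ 2.
  by have /andP[d0 _] := disk01 N x; rewrite mulr_ge0 ?sqr_ge0 ?mulr_ge0.
have mdv N : measurable_fun setT (fun x => disk N x * v x).
  by apply: measurable_funM => //; exact: measurable_disk.
have mu2 N : measurable_fun setT (fun x => disk N x * v x * cabs F x ^+ 2).
  by apply: measurable_funM => //; exact: measurable_funX.
rewrite -ge0_integralZl//; last 2 first.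
- by apply/measurable_EFinP; apply: measurable_funM => //; exact: measurable_funX.
- by move=> x _; rewrite lee_fin.
under eq_integral do rewrite -EFinM.
apply: (@ge0_fatou_le _ _ R leb2 (fun N x => `|omega| * (disk N x * v x * cabs F x ^+ 2))).
- by move=> N; apply: measurable_funM.
- by move=> N x; rewrite mulr_ge0.
- move=> x; apply: cvg_near_cst; exists (Num.bound (enorm x)) => // N /= hN.
  rewrite /disk (_ : enorm x <= N%:R) ?mul1r//.
  by rewrite (le_trans (ltW (archi_boundP (enorm_ge0 x))))// ler_nat.
move=> N; under eq_integral do rewrite EFinM.
rewrite ge0_integralZl//; last 2 first.
- by apply/measurable_EFinP.
- by move=> x _; rewrite lee_fin.
have dvM x : 0 <= disk N x * v x <= `|M| + 1.
  have /andP[d0 d1] := disk01 N x; have /andP[a0 a1] := vM x.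
  by rewrite mulr_ge0//= (le_trans _ a1)// ler_piMl.
pose g x := (disk N x * v x)%:C * F x.
have Lg : L2le g ((`|M| + 1) * n) by exact: L2le_mul_bounded.
have lg : cL1 leb2 g by exact: (cL1_disk N LF mv vM).
have [_ mg _] := Lg.
have Li := L2le_ift lg Lg; have [_ mi _] := Li.
have E := pairing phi_L2 phi_eq Li.
rewrite -(cmod_cintegral_real (mu2 N) (u0N N) (integral_bounded_sq_lty LF (mdv N) dvM M0)).
rewrite -EFinM -cmod_real -cmodM.
rewrite (@eq_cintegral _ _ _ leb2 _ (fun x => g x * cj (F x))); last first.
  by move=> x; rewrite /g -[RHS]mulrA mul_cj -rmorphM.
rewrite (parseval phi_L1 lg).
have -> : cintegral leb2 (fun x => ift g x * cj (phi x)) =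
    cj (cintegral leb2 (fun x => phi x * cj (ift g x))).
  rewrite -cintegralJ; last exact: (cL1_mulJ phi_L2 Li).
  by apply: eq_cintegral => x; rewrite cjM cjK mulrC.
rewrite -(cj_real omega) -cjM cmodJ E.
apply: (@le_trans _ _ (int3 (quad (cst 1) (cabs F) (cabs F) (cabs F) (cabs g)))).
  apply: cmod_int_cform_le => //; first exact: meas3_cabs.
  - by move=> l z x; exact: quad_cabs_ge0.
  - by move=> l; exact: (cmod_cform_ift_le l lg Lg).
apply: le_int3.
- exact: meas3_cabs.
- by apply: measurable_quad => //; exact: measurable_funM.
- by move=> l z x; exact: quad_cabs_ge0.
- move=> l z x; rewrite /quad !mul1r ler_wpM2l ?mulr_ge0 ?cabs_ge0//.
  rewrite /cabs /g cmodM cmod_real ger0_norm; last by have /andP[] := dvM z.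
  rewrite ler_wpM2r ?cmod_ge0// ler_piMl//; by have /andP[] := disk01 N z.
Qed.

End bootstrap_phi.

(** * Pointwise decay *)

Section decay.
Context {R : realType}.
Local Notation mR := (measurableTypeR R).
Implicit Types f g h : plane R -> R[i].

Lemma lipschitz1 (F dF : R -> R) : (forall x : R, is_derive x 1 F (dF x)) ->
  (forall x, `|dF x| <= 1) -> forall a b, `|F a - F b| <= `|a - b|.
Proof.
move=> dd d1 a b; wlog ab : a b / b <= a.
  by move=> H; have [/H//|/ltW/H] := leP b a; rewrite distrC [`|b - a|]distrC.
have [|c _ ->] := @MVT_segment _ F dF b a ab.
  apply: continuous_subspaceT => x; apply: differentiable_continuous.
  by apply/derivable1_diffP; have [] := dd x.
by rewrite normrM ler_piMl.
Qed.

Lemma cmod_expiB (a b : R) : cmod (expi a - expi b) <= 2 * `|a - b|.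
Proof.
have hc : `|cos a - cos b| <= `|a - b|.
  apply: (@lipschitz1 cos (fun x => - sin x)) => x.
  by rewrite normrN ler_norml sin_geN1 sin_le1.
have hs : `|sin a - sin b| <= `|a - b|.
  by apply: (@lipschitz1 sin cos) => x; rewrite ler_norml cos_geN1 cos_le1.
rewrite -ler_sqr ?nnegrE ?cmod_ge0 ?mulr_ge0// cmod_sq /=.
have sq (u v : R) : `|u| <= `|v| -> u ^+ 2 <= v ^+ 2.
  by rewrite -ler_sqr ?nnegrE// !real_normK ?num_real.
rewrite exprMn real_normK ?num_real//; have := sq _ _ hc; have := sq _ _ hs.
by have := sqr_ge0 (a - b); lra.
Qed.

Lemma enorm_le_sum (x : plane R) : enorm x <= `|x.1| + `|x.2|.
Proof.
rewrite -ler_sqr ?nnegrE ?addr_ge0 ?enorm_ge0// enorm_sq sqrrD !real_normK ?num_real//.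
by rewrite lerD2r lerDl mulrn_wge0// mulr_ge0.
Qed.

Lemma integral_expRN_enorm (mu : R) : 0 < mu ->
  (\int[leb2]_(x in [set: plane R]) (expR (- (mu * enorm x)))%:E < +oo)%E.
Proof.
move=> mu0; have m2 : 0 < mu / 2 by rewrite divr_gt0.
have [_] := cL1_wexp2 m2; apply: le_lt_trans; apply: ge0_le_integral => //.
- apply/measurable_EFinP; apply: measurableT_comp => //.
  apply: measurableT_comp => //; apply: measurable_funM => //; exact: measurable_enorm.
- by apply/measurable_EFinP; apply: measurable_cmod; have [] := cL1_wexp2 m2.
move=> x _; rewrite lee_fin cmod_real gtr0_norm ?wexp2_gt0// /wexp2 /wexp -expRD ler_expR.
by have := enorm_ge_fst x; have := enorm_ge_snd x; nra.
Qed.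

(** With [E = expR (mu / 2 * enorm x)] the factor [1 + enorm x] is at most a constant times [E], and
    [E |f|] is the product of [E^2 |f|] and [1 / E], two square integrable functions. *)
Lemma integral_moment f (mu : R) : 0 < mu -> cmeas f ->
  (\int[leb2]_x ((expR (mu * enorm x) * cabs f x) ^+ 2)%:E < +oo)%E ->
  (\int[leb2]_x ((1 + enorm x) * cabs f x)%:E < +oo)%E.
Proof.
move=> mu0 mf fi; have mcf := measurable_cabs mf; have me := @measurable_enorm R.
have mex (k : R) : measurable_fun setT (fun x : plane R => expR (k * enorm x)).
  by apply: measurableT_comp => //; exact: measurable_funM.
have mexN : measurable_fun setT (fun x : plane R => expR (- (mu * enorm x))).
  by apply: measurableT_comp => //; apply: measurableT_comp => //; exact: measurable_funM.
have mE1 : measurable_fun setT (fun x : plane R => ((expR (mu * enorm x) * cabs f x) ^+ 2)%:E).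
  by apply/measurable_EFinP; apply: measurable_funX; exact: measurable_funM.
have mE2 : measurable_fun setT (fun x : plane R => (expR (- (mu * enorm x)))%:E).
  exact/measurable_EFinP.
apply: (@le_lt_trans _ _ (\int[leb2]_x ((1 + 2 / mu)%:E *
    (((expR (mu * enorm x) * cabs f x) ^+ 2)%:E + (expR (- (mu * enorm x)))%:E)))%E).
  apply: ge0_le_integral => //.
  - by move=> x _; rewrite lee_fin mulr_ge0 ?cabs_ge0// addr_ge0// enorm_ge0.
  - by apply/measurable_EFinP; apply: measurable_funM => //; exact: measurable_funD.
  - by apply: emeasurable_funM => //; exact: emeasurable_funD.
  move=> x _; rewrite -EFinD -EFinM lee_fin.
  have e0 := enorm_ge0 x; have t0 := cabs_ge0 f x.
  set E := expR (mu / 2 * enorm x).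
  have E1 : 1 <= E by rewrite -expR0 ler_expR mulr_ge0// divr_ge0// ltW.
  have EE : expR (mu * enorm x) = E ^+ 2.
    by rewrite /E -expRM_natl; congr expR; field.
  have -> : expR (- (mu * enorm x)) = E ^- 2 by rewrite expRN EE.
  rewrite EE; apply: (@le_trans _ _ ((1 + 2 / mu) * (E * cabs f x))).
    rewrite mulrA ler_wpM2r//.
    have h : enorm x <= 2 / mu * E.
      rewrite -ler_pdivrMl ?divr_gt0// invf_div.
      by rewrite (le_trans _ (expR_ge1Dx _))// lerDr.
    by rewrite mulrDl mul1r lerD.
  rewrite ler_wpM2l ?addr_ge0 ?divr_ge0 ?(ltW mu0)//.
  have E0 : 0 < E by apply: lt_le_trans E1.
  have h : E * cabs f x = (E ^+ 2 * cabs f x) * E^-1.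
    by have := lt0r_neq0 E0 => En; field.
  rewrite h -exprVn; set a := E ^+ 2 * _; set b := E^-1.
  have a0 : 0 <= a by rewrite mulr_ge0 ?sqr_ge0.
  have b0 : 0 <= b by rewrite invr_ge0 ltW.
  by have := sqr_ge0 (a - b); nra.
rewrite ge0_integralZl//; last 3 first.
- exact: emeasurable_funD.
- by move=> x _; rewrite adde_ge0// lee_fin ?sqr_ge0 ?expR_ge0.
- by rewrite lee_fin addr_ge0// divr_ge0// ltW.
rewrite lte_mul_pinfty ?lee_fin ?addr_ge0 ?divr_ge0 ?(ltW mu0)//.
rewrite ge0_integralD//.
- by apply: lte_add_pinfty => //; exact: integral_expRN_enorm.
- by move=> x _; rewrite lee_fin sqr_ge0.
Qed.

Lemma cL1_of_moment f : cmeas f ->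
  (\int[leb2]_x ((1 + enorm x) * cabs f x)%:E < +oo)%E -> cL1 leb2 f.
Proof.
move=> mf fi; apply: (@cL1_le _ _ _ leb2 _ (fun x => (1 + enorm x) * cabs f x)) => //.
  apply: measurable_funM; last exact: measurable_cabs.
  by apply: measurable_funD => //; exact: measurable_enorm.
by move=> x; rewrite ler_peMl ?cmod_ge0// lerDl enorm_ge0.
Qed.

Lemma fourier1_lipschitz f : cmeas f ->
  (\int[leb2]_x ((1 + enorm x) * cabs f x)%:E < +oo)%E ->
  exists2 L, 0 < L & forall xi eta, cmod (fourier1 f xi - fourier1 f eta) <= L * enorm (xi - eta).
Proof.
move=> mf fi; have lf := cL1_of_moment mf fi.
have mcf := measurable_cabs mf; have me := @measurable_enorm R.
have mm : measurable_fun setT (fun x => ((1 + enorm x) * cabs f x)%:E).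
  by apply/measurable_EFinP; apply: measurable_funM => //; exact: measurable_funD.
set I := (\int[leb2]_x _)%E in fi.
have I0 : (0 <= I)%E.
  by apply: integral_ge0 => x _; rewrite lee_fin mulr_ge0 ?cabs_ge0// addr_ge0// enorm_ge0.
have If : I \is a fin_num by rewrite ge0_fin_numE.
have k0 := @kappa_gt0 R.
exists (kappa * (2 * fine I) + 1).
  by rewrite ltr_wpDl// !mulr_ge0 ?fine_ge0// ltW.
move=> xi eta; apply: (@le_trans _ _ (kappa * (2 * fine I) * enorm (xi - eta))); last first.
  by rewrite ler_wpM2r ?enorm_ge0// lerDl.
have l1 : cL1 leb2 (fun x => f x * expi (- edot x xi)) by apply: cL1_expi => //; exact: measurable_edotN.
have l2 : cL1 leb2 (fun x => f x * expi (- edot x eta)) by apply: cL1_expi => //; exact: measurable_edotN.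
have -> : fourier1 f xi - fourier1 f eta = kappa%:C *
   cintegral leb2 (fun x => f x * expi (- edot x xi) + (-1) * (f x * expi (- edot x eta))).
  by rewrite (cintegralD l1 (cL1Z (-1) l2)) (cintegralZl _ l2) !fourier1E mulN1r mulrBr.
rewrite (_ : kappa * (2 * fine I) * enorm (xi - eta) = kappa * (fine I * (2 * enorm (xi - eta)))); last by ring.
rewrite cmodM cmod_real gtr0_norm// ler_pM2l// -lee_fin.
apply: (le_trans (cmod_cintegral_le _ _)).
  by have [] := cL1D l1 (cL1Z (-1) l2).
rewrite mulrC EFinM fineK// -ge0_integralZl//; last 2 first.
- by move=> x _; rewrite lee_fin mulr_ge0 ?cabs_ge0// addr_ge0// enorm_ge0.
- by rewrite lee_fin mulr_ge0// enorm_ge0.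
apply: ge0_le_integral => //.
- by move=> x _; rewrite lee_fin cmod_ge0.
- by apply/measurable_EFinP; apply: measurable_cmod; have [] := cL1D l1 (cL1Z (-1) l2).
- exact: emeasurable_funM.
move=> x _; rewrite -EFinM lee_fin mulN1r -mulrBr cmodM mulrC mulrA ler_wpM2r ?cmod_ge0//.
rewrite (le_trans (cmod_expiB _ _))//.
rewrite (_ : - edot x xi - - edot x eta = - edot x (xi - eta)); last by rewrite /edot /=; ring.
have h : `|- edot x (xi - eta)| <= enorm x * enorm (xi - eta).
  rewrite normrN ler_norml edot_le andbT lerNl.
  rewrite (_ : - edot x (xi - eta) = edot (- x) (xi - eta)); last by rewrite /edot /=; ring.
  by rewrite (le_trans (edot_le _ _))// enormN.
by have := enorm_ge0 (xi - eta); have := enorm_ge0 x; nra.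
Qed.

Lemma integral_box (p : plane R) (s : R) : 0 <= s ->
  (\int[leb2]_x ((`|x.1 - p.1| <= s)%R && (`|x.2 - p.2| <= s)%R)%:R%:E = ((2 * s) ^+ 2)%:E)%E.
Proof.
move=> s0; pose A (a : R) : set mR := `[a - s, a + s]%classic.
have mA a : measurable (A a) by exact: measurable_itv.
have lA a : (leb (A a) = (2 * s)%:E)%E.
  have -> : leb (A a) = lebesgue_measure (A a : set R) by [].
  rewrite /A lebesgue_measure_itv/= lte_fin; case: ifPn => h; first by rewrite -EFinD; congr EFin; ring.
  by congr EFin; lra.
rewrite (_ : (fun x => _) = (fun x : plane R => (\1_(A p.1 `*` A p.2) x)%:E)).
  rewrite integral_indic//; last exact: measurableX.
  rewrite setIT; transitivity (leb (A p.1) * leb (A p.2))%E; first exact: product_measure1E.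
  by rewrite !lA -EFinM expr2.
apply/funext => x; rewrite indicE; congr (_%:R%:E).
have hA (a b : R) : (b \in A a) = (`|b - a| <= s)%R.
  by rewrite mem_setE in_itv/= ler_distl.
by rewrite in_setX !hA.
Qed.

(** If [A = |G p|], then [|G|] is at least [A / 2] on the ball of radius [r = A / (2 L)] about [p].
    The weighted integral over that ball dominates a multiple of [A ^ 4] times
    [expR (2 * mu * enorm p)]; taking the fourth root explains the rate [mu / 2]. *)
Lemma sup_decay (G : plane R -> R[i]) (L M mu : R) : cmeas G -> 0 < L -> 0 < mu ->
  (forall x y, cmod (G x - G y) <= L * enorm (x - y)) -> (forall x, cmod (G x) <= M) ->
  (\int[leb2]_x ((expR (mu * enorm x) * cabs G x) ^+ 2)%:E < +oo)%E ->
  exists C, forall x, expR (mu / 2 * enorm x) * cmod (G x) <= C.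
Proof.
move=> mG L0 mu0 lip bd; set I := (\int[leb2]_x _)%E => Ilt.
have I0 : (0 <= I)%E by apply: integral_ge0 => x _; rewrite lee_fin sqr_ge0.
have If : I \is a fin_num by rewrite ge0_fin_numE.
have M0 : 0 <= M by rewrite (le_trans _ (bd 0))// cmod_ge0.
(* A bound for all the radii [r], so that passing from [enorm p] to [enorm p - r] in the weight
   costs only the constant [expR (2 * mu * r0)]. *)
pose r0 := M / (2 * L).
pose D := 16 * L ^+ 2 * fine I * expR (2 * mu * r0).
have D0 : 0 <= D by rewrite /D mulr_ge0 ?expR_ge0// mulr_ge0 ?fine_ge0// mulr_ge0 ?sqr_ge0.
(* A number whose fourth power is at most [D] is below [1 + D], because beyond 1 it does not exceed
   its fourth power. *)
exists (1 + D) => p; set A := cmod (G p).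
have A0 : 0 <= A by exact: cmod_ge0.
suff h : (expR (mu / 2 * enorm p) * A) ^+ 4 <= D.
  have [//|hx] := leP (expR (mu / 2 * enorm p) * A) (1 + D).
  move: h hx; set y := _ * A => h hx; exfalso.
  have y1 : 1 <= y by lra.
  have := ler_eXnr (n := 4) isT y1; lra.
pose r := A / (2 * L).
have r_ge0 : 0 <= r by rewrite divr_ge0// mulr_ge0// ltW.
have rr0 : r <= r0 by rewrite /r /r0 ler_pM2r ?invr_gt0 ?mulr_gt0//; exact: bd.
have s0 : 0 <= r / 2 by rewrite divr_ge0.
(* The ball is replaced by the inscribed square of side [r], whose area is [r ^ 2]; it lies within
   distance [r] of [p] because the Euclidean norm is below the l^1 norm. *)
have key : (((expR (mu * (enorm p - r)) * (A / 2)) ^+ 2 * r ^+ 2)%:E <= I)%E.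
  rewrite [X in (_ * X ^+ 2)%:E](_ : r = 2 * (r / 2)); last by field.
  have mE : measurable_fun setT (fun x : plane R => (expR (mu * enorm x) * cabs G x) ^+ 2).
    apply: measurable_funX; apply: measurable_funM; last exact: measurable_cabs.
    by apply: measurableT_comp => //; apply: measurable_funM => //; exact: measurable_enorm.
  have mB : measurable_fun setT (fun x : plane R => ((`|x.1 - p.1| <= r / 2) && (`|x.2 - p.2| <= r / 2))%:R : R).
    apply: measurable_bool; apply: measurable_and; apply: measurable_fun_ler => //;
    by apply: measurableT_comp => //; apply: measurable_funB; measurability.
  rewrite EFinM -(integral_box p s0) -ge0_integralZl//; last 2 first.
  - exact/measurable_EFinP.
  - by rewrite lee_fin sqr_ge0.
  apply: ge0_le_integral => //.
  - by move=> x _; rewrite mule_ge0// lee_fin sqr_ge0.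
  - by apply: emeasurable_funM => //; exact/measurable_EFinP.
  - exact/measurable_EFinP.
  move=> x _; rewrite -EFinM lee_fin; case: andP => [[x1 x2]|_]; last by rewrite mulr0 sqr_ge0.
  rewrite mulr1.
  have xp : enorm (p - x) <= r.
    rewrite (le_trans (enorm_le_sum _))//= distrC [`|p.2 - _|]distrC; lra.
  have h1 : A / 2 <= cabs G x.
    have := cmod_triangle (G x) (G p - G x); rewrite addrC subrK -/A -/(cabs G x).
    have := lip p x; have : L * enorm (p - x) <= L * r by rewrite ler_pM2l.
    rewrite (_ : L * r = A / 2); last by rewrite /r; have := lt0r_neq0 L0 => Ln; field.
    rewrite (_ : (A / 2) = A - A / 2); last by field.
    lra.
  have h2 : enorm p - r <= enorm x.
    by have := enorm_triangle (p - x) x; rewrite subrK; lra.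
  rewrite lerXn2r ?nnegrE ?mulr_ge0 ?expR_ge0 ?cabs_ge0 ?divr_ge0//.
  by rewrite ler_pM ?expR_ge0 ?divr_ge0// ler_expR ler_pM2l.
move: key; rewrite -(fineK If) lee_fin => key.
have key2 : (expR (mu * (enorm p - r)) * (A / 2)) ^+ 2 * r ^+ 2 * (16 * L ^+ 2 * expR (2 * mu * r0)) <= D.
  rewrite /D (_ : 16 * L ^+ 2 * fine I * _ = fine I * (16 * L ^+ 2 * expR (2 * mu * r0))); last by ring.
  by rewrite ler_wpM2r// mulr_ge0 ?expR_ge0// mulr_ge0 ?sqr_ge0.
apply: le_trans key2.
have Ln := lt0r_neq0 L0.
rewrite (_ : _ * (16 * L ^+ 2 * _) =
    expR (mu * (enorm p - r)) ^+ 2 * expR (2 * mu * r0) * A ^+ 4); last first.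
  by rewrite /r; generalize (expR (mu * (enorm p - A / (2 * L)))) (expR (2 * mu * r0)) => a b; field.
rewrite exprMn ler_wpM2r ?exprn_ge0// -!expRM_natl -expRD ler_expR.
by have : 0 <= mu * (r0 - r) by [rewrite mulr_ge0 ?subr_ge0// ltW|]; lra.
Qed.

End decay.

(** * Norms in L^2 and L^oo, the Plancherel transform, and the case of nonzero [omega] *)

Section Lp.
Context {R : realType}.
Implicit Types f g : plane R -> R[i].

Lemma Lnorm2_sq (h : plane R -> R) :
  (Lnorm leb2 2%:E (fun x => (h x)%:E) `^ 2 = \int[leb2]_x (h x ^+ 2)%:E)%E.
Proof.
rewrite powR_Lnorm//; apply: eq_integral => x _.
by rewrite /= powR_mulrn// real_normK ?num_real.
Qed.

Lemma Lnorm2_lty (h : plane R -> R) :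
  (Lnorm leb2 2%:E (fun x => (h x)%:E) < +oo)%E <-> (\int[leb2]_x (h x ^+ 2)%:E < +oo)%E.
Proof.
rewrite -Lnorm2_sq; split => [|h2]; first exact: poweR_lty.
rewrite ltNge leye_eq; apply/eqP => hy; move: h2.
by rewrite hy poweRyr// pnatr_eq0.
Qed.

Lemma Lnorm2_le (h : plane R -> R) (e : R) : 0 < e ->
  (\int[leb2]_x (h x ^+ 2)%:E <= (e ^+ 2)%:E)%E ->
  (Lnorm leb2 2%:E (fun x => (h x)%:E) <= e%:E)%E.
Proof.
move=> e0; rewrite -Lnorm2_sq.
move: (Lnorm_ge0 leb2 2%:E (fun x => (h x)%:E)); case: (Lnorm _ _ _) => [r| |] //=.
  rewrite lee_fin => r0; rewrite powR_mulrn// !lee_fin.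
  by rewrite ler_sqr ?nnegrE ?(ltW e0).
by rewrite pnatr_eq0.
Qed.

Lemma cLp2_L2le f : cLp leb2 2%:E f -> exists n, L2le f n.
Proof. by move=> [mr mi] /Lnorm2_lty fi; apply: L2leP. Qed.

Lemma L2le_cLp2 f n : L2le f n -> cLp leb2 2%:E f.
Proof.
move=> [n0 [mr mi] fi]; split => //; apply/Lnorm2_lty.
by apply: (le_lt_trans fi); rewrite ltry.
Qed.

Lemma cLp_infty f (C : R) : cmeas f -> {ae leb2, forall x, cmod (f x) <= C} ->
  cLp leb2 +oo%E f.
Proof.
move=> [mr mi] fC; split => //; rewrite /finite_norm unlock; case: ifP => _; last exact: ltry.
apply: (@le_lt_trans _ _ C%:E); last exact: ltry.
by apply/ess_sup_inf.ess_supP; apply: filterS fC => x h; rewrite /= lee_fin ger0_norm ?cmod_ge0.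
Qed.

Lemma cmeas_exp_weight (mu : R) f : cmeas f -> cmeas (exp_weight mu f).
Proof.
by move=> mf; apply: cmeasM => //; apply: cmeas_real; exact: measurable_expw.
Qed.

Lemma cmod_exp_weight (mu : R) f x : cmod (exp_weight mu f x) = expR (mu * enorm x) * cmod (f x).
Proof. by rewrite cmodM cmod_real gtr0_norm ?expR_gt0. Qed.

Lemma fourier1B f g xi : cL1 leb2 f -> cL1 leb2 g ->
  fourier1 f xi - fourier1 g xi = fourier1 (fun x => f x - g x) xi.
Proof.
move=> lf lg; rewrite !fourier1E -mulrBr; congr (_ * _).
have me := @measurable_edotN R xi.
have l1 := cL1_expi lf me; have l2 := cL1_expi lg me.
rewrite -[in LHS]mulN1r -(cintegralZl (-1) l2) -(cintegralD l1 (cL1Z (-1) l2)).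
by apply: eq_cintegral => x; rewrite mulN1r mulrBl.
Qed.

Lemma ball_truncE f n x : ball_trunc f n x = (disk n x)%:C * f x.
Proof. by rewrite /ball_trunc /disk; case: ifP => _; rewrite ?mul1r ?mul0r. Qed.

(** The truncations converge to [f] in L^2 by dominated convergence, and the bound [plancherel_le]
    for the difference carries this over to the transforms. *)
Lemma is_fourier_fourier1 f n : cL1 leb2 f -> L2le f n -> is_fourier f (fourier1 f).
Proof.
move=> lf Lf; have [n0 mf fi] := Lf; split; first exact: (L2le_cLp2 (plancherel_le lf Lf)).
apply: cvge0P => [k|e e0]; first exact: Lnorm_ge0.
have mcf := measurable_cmod mf.
have mdf k : cmeas (fun x : plane R => ball_trunc f k x - f x).
  apply: cmeasB => //; rewrite (funext (ball_truncE f k)).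
  by apply: cmeasM => //; apply: cmeas_real; exact: measurable_disk.
have : \forall k \near \oo,
    (\int[leb2]_x (cmod (ball_trunc f k x - f x) ^+ 2)%:E <= (e ^+ 2)%:E)%E.
  apply: (@dominated_to0 _ _ _ leb2 (fun k x => cmod (ball_trunc f k x - f x) ^+ 2)
    (fun x => cmod (f x) ^+ 2)).
  - by move=> k; apply: measurable_funX; exact: measurable_cmod.
  - exact: measurable_funX.
  - move=> x; apply: cvg_near_cst; exists (Num.bound (enorm x)) => // k /= hk.
    rewrite /ball_trunc (_ : enorm x <= k%:R) ?subrr ?cmod0 ?expr0n//.
    by rewrite (le_trans (ltW (archi_boundP (enorm_ge0 x))))// ler_nat.
  - move=> k x; rewrite sqr_ge0 /ball_trunc/=; case: ifP => _.
      by rewrite subrr cmod0 expr0n sqr_ge0.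
    by rewrite sub0r cmodN.
  - by apply: (le_lt_trans fi); rewrite ltry.
  - by rewrite exprn_gt0.
apply: filterS => k hk; apply: Lnorm2_le => //.
have lb : cL1 leb2 (ball_trunc f k).
  rewrite (_ : ball_trunc f k = fun x => (disk k x * 1)%:C * f x); last first.
    by apply/funext => x; rewrite mulr1 ball_truncE.
  by apply: (@cL1_disk R k f n 1 (fun _ => 1)) => // x; rewrite ler01 lexx.
have ld : cL1 leb2 (fun x => ball_trunc f k x - f x).
  by have := cL1D lb (cL1Z (-1) lf); under eq_fun do rewrite mulN1r.
have Ld : L2le (fun x => ball_trunc f k x - f x) e by [].
have [_ _ h] := plancherel_le ld Ld.
by under eq_integral do rewrite fourier1B//.
Qed.

Lemma decay_conclusion f n (mu C : R) : cL1 leb2 f -> L2le f n -> 0 < mu ->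
  {ae leb2, forall x, expR (mu * enorm x) * cmod (f x) <= C} ->
  (forall xi, expR (mu * enorm xi) * cmod (fourier1 f xi) <= C) ->
  exists mu : R, 0 < mu /\
    cLp leb2 +oo%E (exp_weight mu f) /\
    exists fhat : R * R -> R[i],
      is_fourier f fhat /\ cLp leb2 +oo%E (exp_weight mu fhat).
Proof.
move=> lf Lf mu0 h1 h2; have [n0 mf fi] := Lf; exists mu; split => //; split.
  apply: (@cLp_infty _ C); first exact: cmeas_exp_weight.
  by apply: (@filterS _ _ (ae_filter_ringOfSetsType (@leb2 R)) _ _ _ h1) => x; rewrite cmod_exp_weight.
exists (fourier1 f); split; first exact: (is_fourier_fourier1 lf Lf).
apply: (@cLp_infty _ C); first by apply: cmeas_exp_weight; exact: cmeas_fourier1.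
by apply: aeW => x; rewrite cmod_exp_weight.
Qed.

Lemma expR_enorm_le (a b c : R) (x : plane R) : a <= b -> 0 <= c ->
  expR (a * enorm x) * c <= expR (b * enorm x) * c.
Proof. by move=> ab c0; rewrite ler_wpM2r// ler_expR ler_wpM2r ?enorm_ge0. Qed.

(** Each weighted L^2 bound is used twice: as a moment bound it makes the function on the other side
    Lipschitz, and through [sup_decay] it gives the pointwise decay of the function itself. *)
Lemma decay_omega_neq0 (omega : R) (phi : plane R -> R[i]) n :
  L2le phi n ->
  {ae @leb2 R, forall z : R * R, omega%:C * phi z = trilinear phi phi phi z} ->
  omega != 0 ->
  exists mu : R, 0 < mu /\
    cLp leb2 +oo%E (exp_weight mu phi) /\
    exists fhat : R * R -> R[i],
      is_fourier phi fhat /\ cLp leb2 +oo%E (exp_weight mu fhat).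
Proof.
move=> Lphi phi_eq w0; have [n0 mphi _] := Lphi.
have [mu1 mu10 i1] := weighted_bootstrap_phi Lphi phi_eq w0.
have mom1 := integral_moment mu10 mphi i1; have lphi := cL1_of_moment mphi mom1.
have [mu2 mu20 i2] := weighted_bootstrap_fourier Lphi phi_eq lphi w0.
set F := fourier1 phi in i2; have mF : cmeas F by exact: cmeas_fourier1.
have mom2 := integral_moment mu20 mF i2; have lF := cL1_of_moment mF mom2.
have [L1 L10 lip1] := fourier1_lipschitz mphi mom1.
have [M1 M10 bd1] := fourier1_bounded lphi.
have [C2 hC2] := sup_decay mF L10 mu20 lip1 bd1 i2.
pose F' xi := cj (F xi).
have mF' : cmeas F' by exact: cmeasJ.
have mom2' : (\int[leb2]_x ((1 + enorm x) * cabs F' x)%:E < +oo)%E.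
  by move: mom2; under eq_integral do rewrite /cabs -cmodJ.
have [L2 L20 lip2] := fourier1_lipschitz mF' mom2'.
have [M2 M20 bd2] := fourier1_bounded (cL1J lF).
(* [phi] is given only up to null sets; [ift F] is the Lipschitz representative to which [sup_decay]
   applies. *)
have inv := fourier_inversion lphi Lphi lF.
have mG : cmeas (ift F) by exact: cmeas_ift.
have lipG x y : cmod (ift F x - ift F y) <= L2 * enorm (x - y).
  by rewrite /ift (_ : cj _ - cj _ = cj (fourier1 F' x - fourier1 F' y)) ?cmodJ// /cj rmorphB.
have bdG x : cmod (ift F x) <= M2 by rewrite /ift cmodJ.
have iG : (\int[leb2]_x ((expR (mu1 * enorm x) * cabs (ift F) x) ^+ 2)%:E < +oo)%E.
  rewrite (@ae_eq_integral _ _ _ leb2 setT (fun x : plane R => ((expR (mu1 * enorm x) * cabs phi x) ^+ 2)%:E))//.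
  - apply/measurable_EFinP; apply: measurable_funX; apply: measurable_funM; last exact: measurable_cabs.
    exact: measurable_expw.
  - apply/measurable_EFinP; apply: measurable_funX; apply: measurable_funM; last exact: measurable_cabs.
    exact: measurable_expw.
  - by apply: filterS inv => x h _; rewrite /cabs h.
have [C1 hC1] := sup_decay mG L20 mu10 lipG bdG iG.
pose mu := Num.min (mu1 / 2) (mu2 / 2).
have mu0 : 0 < mu by rewrite lt_min !divr_gt0.
apply: (@decay_conclusion phi n mu (Num.max C1 C2)) => //.
- apply: filterS inv => x h; rewrite le_max; apply/orP; left.
  apply: le_trans (hC1 x); rewrite -h; apply: expR_enorm_le; last exact: cmod_ge0.
  by rewrite ge_min lexx.
- move=> x; rewrite le_max; apply/orP; right.
  apply: le_trans (hC2 x); apply: expR_enorm_le; last exact: cmod_ge0.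
  by rewrite ge_min lexx orbT.
Qed.

End Lp.

(** * Averaging over rotations *)

Section circle.
Context {R : realType}.
Local Notation mR := (measurableTypeR R).

(** Written as [x * (x ^ 2)^-1], the inverse becomes a real power of a nonnegative number; at 0 both
    sides are 0. *)
Lemma measurable_invr : measurable_fun setT (fun x : mR => x^-1 : mR).
Proof.
rewrite (_ : (fun x => _) = (fun x : mR => x * (x ^+ 2) `^ (- 1))).
  apply: measurable_funM; first exact: measurable_id.
  apply: (measurableT_comp (measurable_powR (- 1))).
  by apply: measurable_funX; exact: measurable_id.
apply/funext => x; rewrite powR_inv1 ?sqr_ge0// expr2.
by case: (eqVneq x 0) => [->|x0]; [rewrite invr0 mul0r|rewrite invfM mulrA divff// mul1r].
Qed.
Local Notation X := (plane R * plane R)%type.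

(* The plane as the complex numbers: [cm] is their product. *)
Definition cm (e x : plane R) : plane R := conf e.1 e.2 x.

Definition unitary (e : plane R) := e.1 ^+ 2 + e.2 ^+ 2 = 1.

Definition cmJ (e : plane R) : plane R := (e.1, - e.2).

Definition dir (w : plane R) : plane R :=
  if enorm w == 0 then (1, 0) else smul (enorm w)^-1 w.

(* A rotation invariant density on the plane: integrating a function of [dir w]
   against it is an average over the circle.  It vanishes at the origin, where
   [dir] is a junk value. *)
Definition radw (w : plane R) : R := enorm w * expR (- enorm w).

Definition rotp (e : plane R) (p : X) : X := (p.1, cm e p.2).

Lemma cmA a b c : cm a (cm b c) = cm (cm a b) c.
Proof. by rewrite /cm /conf /=; congr pair; ring. Qed.

Lemma cmC a b : cm a b = cm b a.
Proof. by rewrite /cm /conf /=; congr pair; ring. Qed.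

Lemma unitary_cm a b : unitary a -> unitary b -> unitary (cm a b).
Proof.
rewrite /unitary /cm /conf /= => ha hb.
rewrite -[RHS](mulr1 1) -{1}ha -hb; ring.
Qed.

Lemma unitaryJ e : unitary e -> unitary (cmJ e).
Proof. by rewrite /unitary /cmJ /= sqrrN. Qed.

Lemma cmJK e x : unitary e -> cm (cmJ e) (cm e x) = x.
Proof.
rewrite /unitary /cm /conf /cmJ => h; case: x => a b /=.
by congr pair; [rewrite -[RHS]mul1r -h|rewrite -[RHS]mul1r -h]; ring.
Qed.

Lemma enorm_cm e x : unitary e -> enorm (cm e x) = enorm x.
Proof.
move=> h; rewrite /enorm; congr Num.sqrt.
by rewrite -[RHS]mul1r -h /cm /conf /=; ring.
Qed.

Lemma unitary_dir w : unitary (dir w).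
Proof.
rewrite /dir; case: eqVneq => [_|h]; first by rewrite /unitary /= expr1n expr0n addr0.
rewrite /unitary /smul /= !exprMn -mulrDr -enorm_sq exprVn mulVf//.
by rewrite expf_neq0.
Qed.

Lemma dir_cm e w : unitary e -> enorm w != 0 -> dir (cm e w) = cm e (dir w).
Proof.
move=> he hw; rewrite /dir enorm_cm// (negPf hw) /smul /cm /conf /=.
by congr pair; ring.
Qed.

(** The square root is [(1 + e) / |1 + e|], which bisects the angle, except at [e = -1], where it is
    [i]. *)
Lemma unitary_sqrt e : unitary e -> exists2 s, unitary s & cm s s = e.
Proof.
rewrite /unitary => he; case: (eqVneq e.1 (-1)) => [e1|e1].
  exists (0, 1); rewrite /unitary /cm /conf /=; first by rewrite expr0n expr1n add0r.
  have e2 : e.2 = 0.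
    by apply/eqP; rewrite -sqrf_eq0; apply/eqP; move: he; rewrite e1 sqrrN expr1n; lra.
  by rewrite [e]surjective_pairing e1 e2; congr pair; ring.
have c1 : - 1 < e.1.
  rewrite lt_neqAle eq_sym e1/=; have := sqr_ge0 e.2 => h.
  rewrite leNgt; apply/negP => h1; nra.
have d0 : 0 < 2 + 2 * e.1 by lra.
pose k := Num.sqrt (2 + 2 * e.1).
have kk : k ^+ 2 = 2 + 2 * e.1 by rewrite sqr_sqrtr// ltW.
have k0 : k != 0 by rewrite gt_eqF// sqrtr_gt0.
have d0' : 2 + 2 * e.1 != 0 by rewrite gt_eqF.
exists ((1 + e.1) / k, e.2 / k); rewrite /unitary /cm /conf /=.
  rewrite !exprMn -mulrDl exprVn kk.
  by rewrite (_ : _ + _ = 2 + 2 * e.1) ?divff//; lra.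
rewrite [RHS]surjective_pairing; congr pair.
  rewrite (_ : _ - _ = ((1 + e.1) ^+ 2 - e.2 ^+ 2) / k ^+ 2); last by field.
  rewrite kk (_ : e.2 ^+ 2 = 1 - e.1 ^+ 2); last by lra.
  by rewrite (_ : _ - _ = e.1 * (2 + 2 * e.1)) ?mulfK//; ring.
rewrite (_ : _ + _ = (2 + 2 * e.1) * e.2 / k ^+ 2); last by field.
by rewrite kk mulrC mulrA mulVf// mul1r.
Qed.

Lemma measurable_cm (d : measure_display) (T : measurableType d) (e x : T -> plane R) :
  measurable_fun setT e -> measurable_fun setT x ->
  measurable_fun setT (fun t => cm (e t) (x t)).
Proof. by move=> me mx; apply: measurable_conf => //; measurability. Qed.

Lemma measurable_rot (d : measure_display) (T : measurableType d)
    (e : T -> plane R) (p : T -> X) :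
  measurable_fun setT e -> measurable_fun setT p ->
  measurable_fun setT (fun t => rotp (e t) (p t)).
Proof.
move=> me mp; apply: measurable_fun_pair; first by measurability.
by apply: measurable_cm => //; measurability.
Qed.

Lemma measurable_cmJ : measurable_fun setT cmJ.
Proof. by rewrite /cmJ; measurability. Qed.

Lemma measurable_dir : measurable_fun setT dir.
Proof.
have me := @measurable_enorm R.
apply: measurable_fun_ifT.
- by apply: measurable_fun_eqr.
- exact: measurable_cst.
have mi : measurable_fun setT (fun w : plane R => (enorm w)^-1 : mR).
  exact: (measurableT_comp measurable_invr me).
by rewrite /smul; measurability.
Qed.

Lemma measurable_radw : measurable_fun setT radw.
Proof.
have me := @measurable_enorm R.
by apply: measurable_funM => //; apply: measurableT_comp => //; apply: measurableT_comp.
Qed.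

Lemma radw_ge0 w : 0 <= radw w. Proof. by rewrite mulr_ge0 ?enorm_ge0 ?expR_ge0. Qed.

Lemma radw_cm e w : unitary e -> radw (cm e w) = radw w.
Proof. by move=> he; rewrite /radw enorm_cm. Qed.

Lemma integral_radw_lty : (\int[leb2]_w (radw w)%:E < +oo)%E.
Proof.
have me := @measurable_enorm R; have h2 : 0 < (2^-1 : R) by [].
have mE : measurable_fun setT (fun w : plane R => (expR (- (2^-1 * enorm w)))%:E).
  apply/measurable_EFinP; apply: measurableT_comp => //; apply: measurableT_comp => //.
  exact: measurable_funM.
have H : (\int[leb2]_(w in [set: plane R]) (radw w)%:E <=
    2%:E * \int[leb2]_(w in [set: plane R]) (expR (- (2^-1 * enorm w)))%:E)%E.
  rewrite -ge0_integralZl//.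
  apply: ge0_le_integral => //.
  - by move=> w _; rewrite lee_fin radw_ge0.
  - by apply/measurable_EFinP; exact: measurable_radw.
  - exact: emeasurable_funM.
  move=> w _; rewrite -EFinM lee_fin /radw.
  rewrite (_ : - enorm w = - (2^-1 * enorm w) - 2^-1 * enorm w); last by field.
  rewrite expRD mulrCA mulrC ler_wpM2r ?expR_ge0// expRN ler_pdivrMr ?expR_gt0//.
  have := expR_ge1Dx (2^-1 * enorm w); have := enorm_ge0 w; lra.
apply: (le_lt_trans H).
by rewrite lte_mul_pinfty//; exact: integral_expRN_enorm.
Qed.

Lemma integral_radw_gt0 : (0 < \int[leb2]_w (radw w)%:E)%E.
Proof.
pose c : plane R := (2, 2).
have mB : measurable_fun setT (fun x : plane R => ((`|x.1 - c.1| <= 1) && (`|x.2 - c.2| <= 1))%:R : R).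
  apply: measurable_bool; apply: measurable_and; apply: measurable_fun_ler => //;
    by apply: measurableT_comp => //; apply: measurable_funB; measurability.
apply: (@lt_le_trans _ _ ((expR (- 6))%:E * ((2 * 1) ^+ 2)%:E)%E).
  by rewrite -EFinM lte_fin mulr_gt0 ?expR_gt0.
rewrite -(@integral_box R c 1)// -ge0_integralZl//; last first.
  by apply/measurable_EFinP; exact: mB.
apply: ge0_le_integral => //.
- by apply: emeasurable_funM => //; apply/measurable_EFinP; exact: mB.
- by apply/measurable_EFinP; exact: measurable_radw.
move=> x _; rewrite -EFinM lee_fin; case: andP => [[x1 x2]|_]; last by rewrite mulr0 radw_ge0.
rewrite mulr1 /radw; move: x1 x2; rewrite /= !ler_distl => /andP[x1 x1'] /andP[x2 x2'].
have h1 : 1 <= enorm x.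
  by apply: le_trans (enorm_ge_fst x); rewrite (le_trans _ (ler_norm _))//; lra.
have h2 : enorm x <= 6.
  by rewrite (le_trans (enorm_le_sum x))// !ger0_norm; lra.
by rewrite -[leLHS]mul1r ler_pM// ?expR_ge0// ler_expR; lra.
Qed.

Lemma integral_cm e (f : plane R -> \bar R) : unitary e -> measurable_fun setT f ->
  (forall x, 0 <= f x)%E -> (\int[leb2]_x f (cm e x) = \int[leb2]_x f x)%E.
Proof.
move=> he mf f0; have := @integral_conf R e.1 e.2 0 f.
rewrite he oner_eq0 invr1 mul1e => /(_ isT mf f0) <-.
by apply: eq_integral => x _; rewrite addr0.
Qed.

Lemma integral_rot e (f : X -> \bar R) : unitary e -> measurable_fun setT f ->
  (forall x, 0 <= f x)%E -> (\int[leb4]_p f (rotp e p) = \int[leb4]_p f p)%E.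
Proof.
move=> he mf f0.
rewrite (integral_prodm _ _ (f := fun p => f (rotp e p))) //; last first.
  apply: (measurableT_comp mf); apply: measurable_rot; [exact: measurable_cst|exact: measurable_id].
rewrite (integral_prodm _ _ mf f0); apply: eq_integral => z _.
rewrite (integral_cm (f := fun x => f (z, x)) he)//.
by apply: (measurableT_comp mf); measurability.
Qed.

Lemma cintegral_cm e (f : plane R -> R[i]) : unitary e -> cmeas f ->
  cintegral leb2 (fun x => f (cm e x)) = cintegral leb2 f.
Proof.
move=> he mf; rewrite -[RHS]mul1r.
apply: (@cintegral_change _ _ _ _ R leb2 leb2 (cm e) 1 ltr01) => // h mh h0.
by rewrite mul1e integral_cm.
Qed.

Lemma cintegral_rot e (f : X -> R[i]) : unitary e -> cmeas f ->
  cintegral leb4 (fun x => f (rotp e x)) = cintegral leb4 f.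
Proof.
move=> he mf; rewrite -[RHS]mul1r.
apply: (@cintegral_change _ _ _ _ R leb4 leb4 (rotp e) 1 ltr01) => // h mh h0.
by rewrite mul1e integral_rot.
Qed.

End circle.

(** * Vanishing of the average of [F] over rotations of the second variable *)

Section rotation_average.
Context {R : realType}.
Local Notation mR := (measurableTypeR R).
Local Notation X := (plane R * plane R)%type.

Lemma integral2_radw_lty (h : plane R -> plane R -> R[i]) (B : R) :
  0 <= B -> cmeas (fun p : X => h p.1 p.2) ->
  (forall w v, cmod (h w v) <= radw w * radw v * B) ->
  (\int[leb2]_w \int[leb2]_v (cmod (h w v))%:E < +oo)%E.
Proof.
move=> B0 mh hB; have mw := @measurable_radw R.
have mh2 : measurable_fun setT (fun p : X => (cmod (h p.1 p.2))%:E).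
  by apply/measurable_EFinP; exact: measurable_cmod.
have mk : measurable_fun setT (fun p : X => ((radw p.1)%:E * (radw p.2 * B)%:E)%E).
  apply: emeasurable_funM; apply/measurable_EFinP; by measurability.
have mhw w : measurable_fun setT (fun v => (cmod (h w v))%:E).
  by apply: (measurableT_comp mh2 (g := fun v => (w, v))); measurability.
have mkw w : measurable_fun setT (fun v => ((radw w)%:E * (radw v * B)%:E)%E).
  by apply: emeasurable_funM => //; apply/measurable_EFinP; measurability.
apply: (@le_lt_trans _ _ (\int[leb2]_w \int[leb2]_v ((radw w)%:E * (radw v * B)%:E))%E).
  apply: ge0_le_integral => //.
  - by move=> w _; apply: integral_ge0 => v _; rewrite lee_fin cmod_ge0.
  - apply: (measurable_integral (f := fun w v => (cmod (h w v))%:E) sigma_finite_leb2) => //.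
    by move=> w v; rewrite lee_fin cmod_ge0.
  - apply: (measurable_integral (f := fun w v => ((radw w)%:E * (radw v * B)%:E)%E) sigma_finite_leb2) => //.
    by move=> w v; apply: mule_ge0; rewrite lee_fin ?radw_ge0// mulr_ge0// radw_ge0.
  move=> w _; apply: ge0_le_integral => //.
  - by move=> v _; rewrite lee_fin cmod_ge0.
  - by move=> v _; rewrite -EFinM lee_fin mulrA.
rewrite (@integral_prod2 R (fun w => (radw w)%:E) (fun v => (radw v * B)%:E)).
- apply: lte_mul_pinfty.
  + by apply: integral_ge0 => w _; rewrite lee_fin radw_ge0.
  + rewrite ge0_fin_numE ?integral_radw_lty// integral_ge0// => w _.
    by rewrite lee_fin radw_ge0.
  + under eq_integral do rewrite mulrC EFinM.
    rewrite ge0_integralZl//.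
    * by rewrite lte_mul_pinfty// ?integral_radw_lty.
    * exact/measurable_EFinP.
    * by move=> w _; rewrite lee_fin radw_ge0.
- exact/measurable_EFinP.
- by apply/measurable_EFinP; measurability.
- by move=> w; rewrite lee_fin radw_ge0.
- by move=> w; rewrite lee_fin mulr_ge0 ?radw_ge0.
Qed.

Variables (F : X -> R[i]).
Hypotheses (mF : cmeas F) (F2 : (\int[leb4]_p (cmod (F p) ^+ 2)%:E < +oo)%E).

Let B : R := fine (\int[leb4]_p (cmod (F p) ^+ 2)%:E).

Let BE : (\int[leb4]_p (cmod (F p) ^+ 2)%:E = B%:E)%E.
Proof.
rewrite /B fineK// ge0_fin_numE// integral_ge0// => p _; by rewrite lee_fin sqr_ge0.
Qed.

Let B0 : 0 <= B.
Proof. by rewrite fine_ge0// integral_ge0// => p _; rewrite lee_fin sqr_ge0. Qed.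

Lemma cmeas_rot e : cmeas (fun p => F (rotp e p)).
Proof.
apply: (cmeas_comp mF (g := rotp e)); apply: measurable_rot; first exact: measurable_cst.
exact: measurable_id.
Qed.

Lemma integral_rot_sq e : unitary e ->
  (\int[leb4]_p (cmod (F (rotp e p)) ^+ 2)%:E = B%:E)%E.
Proof.
move=> he; rewrite (integral_rot (f := fun p => (cmod (F p) ^+ 2)%:E) he)//.
- by apply/measurable_EFinP; apply: measurable_funX; exact: measurable_cmod.
- by move=> p; rewrite lee_fin sqr_ge0.
Qed.

Lemma integral_mul_le (G H : X -> R[i]) (b c : R) : cmeas G -> cmeas H ->
  (\int[leb4]_p (cmod (G p) ^+ 2)%:E = b%:E)%E ->
  (\int[leb4]_p (cmod (H p) ^+ 2)%:E = c%:E)%E ->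
  (\int[leb4]_p (cmod (G p * cj (H p)))%:E <= (b + c)%:E)%E.
Proof.
move=> mG mH Gb Hc; have mcG := measurable_cmod mG; have mcH := measurable_cmod mH.
have mG2 : measurable_fun setT (fun p => (cmod (G p) ^+ 2)%:E) by apply/measurable_EFinP; measurability.
have mH2 : measurable_fun setT (fun p => (cmod (H p) ^+ 2)%:E) by apply/measurable_EFinP; measurability.
apply: (@le_trans _ _ (\int[leb4]_p ((cmod (G p) ^+ 2)%:E + (cmod (H p) ^+ 2)%:E))%E).
  apply: ge0_le_integral => //.
  - by move=> p _; rewrite lee_fin cmod_ge0.
  - by apply/measurable_EFinP; apply: measurable_cmod; apply: cmeasM => //; exact: cmeasJ.
  - exact: emeasurable_funD.
  move=> p _; rewrite -EFinD lee_fin cmodM cmodJ.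
  have := sqr_ge0 (cmod (G p) - cmod (H p)); have := sqr_ge0 (cmod (G p) + cmod (H p)); nra.
rewrite ge0_integralD//.
- by rewrite EFinD Gb Hc.
- by move=> p _; rewrite lee_fin sqr_ge0.
- by move=> p _; rewrite lee_fin sqr_ge0.
Qed.

(** The inner product of [F] with its rotate by [e]. Squared norms of rotation averages are averages
    of this function on the circle, which is all that is studied until they are known to vanish. *)
Definition autocorr (e : plane R) : R[i] :=
  cintegral leb4 (fun p => F p * cj (F (rotp e p))).

Lemma cmeas_autocorr : cmeas autocorr.
Proof.
apply: (cmeas_cintegral (f := fun e p => F p * cj (F (rotp e p))) sigma_finite_leb4).
apply: cmeasM; first exact: (cmeas_comp mF measurable_snd).
apply: cmeasJ; apply: (cmeas_comp mF (g := fun q : plane R * X => rotp q.1 q.2)).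
by apply: measurable_rot; measurability.
Qed.

Lemma cmod_autocorr_le e : unitary e -> cmod (autocorr e) <= B + B.
Proof.
move=> he; rewrite -lee_fin; have mr := cmeas_rot e.
apply: (le_trans (cmod_cintegral_le _ _)); first by apply: cmeasM => //; exact: cmeasJ.
by apply: integral_mul_le => //; exact: integral_rot_sq.
Qed.

Lemma cL1_radw_autocorr (h : plane R -> plane R) : measurable_fun setT h ->
  (forall u, unitary (h u)) -> cL1 leb2 (fun u => (radw u)%:C * autocorr (h u)).
Proof.
move=> mh hu; have mw := @measurable_radw R.
apply: (@cL1_le _ _ _ leb2 _ (fun u => (B + B) * radw u)).
- by apply: cmeasM; [exact: cmeas_real|exact: (cmeas_comp cmeas_autocorr mh)].
- exact: measurable_funM.
- move=> u; rewrite cmodM cmod_real ger0_norm ?radw_ge0// mulrC ler_wpM2r ?radw_ge0//.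
  exact: cmod_autocorr_le.
under eq_integral do rewrite EFinM.
rewrite ge0_integralZl//.
- by rewrite lte_mul_pinfty ?integral_radw_lty// lee_fin addr_ge0.
- exact/measurable_EFinP.
- by move=> u _; rewrite lee_fin radw_ge0.
- by rewrite lee_fin addr_ge0.
Qed.

Lemma cL1_radw : cL1 leb2 (fun w : plane R => (radw w)%:C).
Proof.
apply: (@cL1_le _ _ _ leb2 _ radw).
- by apply: cmeas_real; exact: measurable_radw.
- exact: measurable_radw.
- by move=> u; rewrite cmod_real ger0_norm// radw_ge0.
- exact: integral_radw_lty.
Qed.

Definition radw_mass : R[i] := cintegral leb2 (fun w : plane R => (radw w)%:C).

Lemma radw_mass_neq0 : radw_mass != 0.
Proof.
apply/negP => /eqP h.
have := cmod_cintegral_real (@measurable_radw R) (@radw_ge0 R) (@integral_radw_lty R).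
rewrite -/radw_mass h cmod0 => /esym E.
by have := @integral_radw_gt0 R; rewrite E ltxx.
Qed.

Lemma radw_eq0 (u : plane R) : enorm u == 0 -> radw u = 0.
Proof. by move=> /eqP h; rewrite /radw h mul0r. Qed.

Lemma cmeas_radw_autocorr (h : plane R -> plane R) : measurable_fun setT h ->
  cmeas (fun u => (radw u)%:C * autocorr (h u)).
Proof.
move=> mh; apply: cmeasM; last exact: (cmeas_comp cmeas_autocorr mh).
by apply: cmeas_real; exact: measurable_radw.
Qed.

(** What the equation supplies when [omega = 0]. The shape of a rectangle is a slope, and the angle
    between its diagonals is twice the angle of that slope; for this reason the mean comes over
    squares of directions. *)
Hypothesis A0 :
  cintegral leb2 (fun u => (radw u)%:C * autocorr (cm (dir u) (dir u))) = 0.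

Let mdir := @measurable_dir R.

Let msq : measurable_fun setT (fun u : plane R => cm (dir u) (dir u)).
Proof. exact: measurable_cm. Qed.

(** Rotating [u] by a square root of [e] multiplies the square of its direction by [e], so the mean
    over squares is invariant under rotations. *)
Lemma autocorr_dirsq e : unitary e ->
  cintegral leb2 (fun u => (radw u)%:C * autocorr (cm e (cm (dir u) (dir u)))) = 0.
Proof.
move=> he; have [s hs se] := unitary_sqrt he.
rewrite -A0 -(cintegral_cm hs (cmeas_radw_autocorr msq)).
apply: eq_cintegral => u; rewrite radw_cm//.
case: (boolP (enorm u == 0)) => [/radw_eq0->|hu]; first by rewrite !mul0r.
rewrite dir_cm// -se; congr (_ * autocorr _).
by rewrite -!cmA; congr cm; rewrite !cmA [cm (dir u) s]cmC.
Qed.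

Let Bt := cintegral leb2 (fun v => (radw v)%:C * autocorr (dir v)).

Lemma autocorr_dir e : unitary e ->
  cintegral leb2 (fun v => (radw v)%:C * autocorr (cm e (dir v))) = Bt.
Proof.
move=> he; rewrite /Bt -(cintegral_cm he (cmeas_radw_autocorr mdir)).
apply: eq_cintegral => u; rewrite radw_cm//.
case: (boolP (enorm u == 0)) => [/radw_eq0->|hu]; first by rewrite !mul0r.
by rewrite dir_cm.
Qed.

(* The double average of [autocorr (dir v * dir u ^ 2)] vanishes when [u] is
   averaged first, by [autocorr_dirsq], and is the mass times [Bt] in the other
   order. *)
Lemma autocorr_mean0 : Bt = 0.
Proof.
pose f (v u : plane R) := (radw v)%:C * ((radw u)%:C * autocorr (cm (dir v) (cm (dir u) (dir u)))).
have E := @cfubini _ _ _ _ R leb2 leb2 sigma_finite_leb2 sigma_finite_leb2 f.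
suff : radw_mass * Bt = 0 by move/eqP; rewrite mulf_eq0 (negPf radw_mass_neq0) => /eqP.
transitivity (cintegral leb2 (fun u => cintegral leb2 (fun v => f v u))).
  rewrite /radw_mass -(cintegralZr _ cL1_radw); apply: eq_cintegral => u.
  rewrite -(@autocorr_dir (cm (dir u) (dir u))); last first.
    by apply: unitary_cm; exact: unitary_dir.
  rewrite -cintegralZl.
    by apply: eq_cintegral => v; rewrite /f mulrCA [cm (dir v) _]cmC.
  apply: cL1_radw_autocorr; first by apply: measurable_cm => //; exact: measurable_cst.
  by move=> v; do 2?apply: unitary_cm; exact: unitary_dir.
rewrite -E.
- transitivity (cintegral leb2 (fun _ : plane R => 0 : R[i])); last exact: cintegral0.
  apply: eq_cintegral => v.
  have l : cL1 leb2 (fun u => (radw u)%:C * autocorr (cm (dir v) (cm (dir u) (dir u)))).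
    apply: cL1_radw_autocorr; first by apply: measurable_cm => //; exact: measurable_cst.
    by move=> u; do 2?apply: unitary_cm; exact: unitary_dir.
  transitivity ((radw v)%:C * (0 : R[i])); last exact: mulr0.
  by rewrite -(autocorr_dirsq (unitary_dir v)) -(cintegralZl _ l).
- rewrite /f; have mw := @measurable_radw R; apply: cmeasM.
    by apply: cmeas_real; measurability.
  apply: cmeasM; first by apply: cmeas_real; measurability.
  apply: (cmeas_comp cmeas_autocorr (g := fun p : X => cm (dir p.1) (cm (dir p.2) (dir p.2)))).
  by apply: measurable_cm; [measurability|apply: measurable_cm; measurability].
apply: (@integral2_radw_lty _ (B + B)); first by rewrite addr_ge0.
  rewrite /f; have mw := @measurable_radw R; apply: cmeasM.
    by apply: cmeas_real; measurability.
  apply: cmeasM; first by apply: cmeas_real; measurability.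
  apply: (cmeas_comp cmeas_autocorr (g := fun p : X => cm (dir p.1) (cm (dir p.2) (dir p.2)))).
  by apply: measurable_cm; [measurability|apply: measurable_cm; measurability].
move=> v u; rewrite /f; set e := cm _ _; have ue : unitary e.
  by apply: unitary_cm; [exact: unitary_dir|apply: unitary_cm; exact: unitary_dir].
rewrite 2!cmodM 2!cmod_real (ger0_norm (radw_ge0 v)) (ger0_norm (radw_ge0 u)) mulrA.
apply: ler_wpM2l; first by apply: mulr_ge0; exact: radw_ge0.
exact: cmod_autocorr_le.
Qed.

(** The double mean that arises from expanding the squared norm of the rotation average: two rotates
    of [F] correlate through the quotient of their directions. For fixed [w] the mean over [v]
    already vanishes. *)
Lemma autocorr_dir2_mean0 : cintegral leb2 (fun w => cintegral leb2 (fun v =>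
  (radw w)%:C * ((radw v)%:C * autocorr (cm (cmJ (dir w)) (dir v))))) = 0.
Proof.
transitivity (cintegral leb2 (fun _ : plane R => 0 : R[i])); last exact: cintegral0.
apply: eq_cintegral => w.
have uw : unitary (cmJ (dir w)) by apply: unitaryJ; exact: unitary_dir.
have l : cL1 leb2 (fun v => (radw v)%:C * autocorr (cm (cmJ (dir w)) (dir v))).
  apply: cL1_radw_autocorr; first by apply: measurable_cm => //; exact: measurable_cst.
  by move=> u; apply: unitary_cm => //; exact: unitary_dir.
transitivity ((radw w)%:C * (0 : R[i])); last exact: mulr0.
by rewrite -[in RHS]autocorr_mean0 -(autocorr_dir uw) -(cintegralZl _ l).
Qed.

Definition rotavg (p : X) : R[i] :=
  cintegral leb2 (fun w => (radw w)%:C * F (rotp (dir w) p)).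

Let G (p : X) (w : plane R) := (radw w)%:C * F (rotp (dir w) p).

Let mG : cmeas (fun q : X * plane R => G q.1 q.2).
Proof.
apply: cmeasM.
  by apply: cmeas_real; exact: (measurableT_comp (@measurable_radw R) measurable_snd).
apply: (cmeas_comp mF (g := fun q : X * plane R => rotp (dir q.2) q.1)).
apply: measurable_rot; last exact: measurable_fst.
exact: (measurableT_comp mdir measurable_snd).
Qed.

Lemma cmeas_rotavg : cmeas rotavg.
Proof. exact: (cmeas_cintegral (f := G) sigma_finite_leb2). Qed.

Let J (p : X) (q : X) : R[i] := G p q.1 * cj (G p q.2).

Let mJ : cmeas (fun r : X * X => J r.1 r.2).
Proof.
apply: cmeasM.
  by apply: (cmeas_comp mG (g := fun r : X * X => (r.1, r.2.1))); measurability.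
apply: cmeasJ.
by apply: (cmeas_comp mG (g := fun r : X * X => (r.1, r.2.2))); measurability.
Qed.

Let J0 (q : X) : (\int[leb4]_p (cmod (J p q))%:E <= (radw q.1 * radw q.2 * (B + B))%:E)%E.
Proof.
have u1 := unitary_dir q.1; have u2 := unitary_dir q.2.
have h := integral_mul_le (cmeas_rot _) (cmeas_rot _) (integral_rot_sq u1) (integral_rot_sq u2).
have r0 : 0 <= radw q.1 * radw q.2 by apply: mulr_ge0; exact: radw_ge0.
rewrite (eq_integral (fun p => (radw q.1 * radw q.2)%:E *
   (cmod (F (rotp (dir q.1) p) * cj (F (rotp (dir q.2) p))))%:E)%E); last first.
  move=> p _; rewrite -EFinM; congr EFin; rewrite /J /G cjM cj_real.
  rewrite !cmodM !cmod_real (ger0_norm (radw_ge0 _)) (ger0_norm (radw_ge0 q.2)); ring.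
rewrite ge0_integralZl//.
- by rewrite [leRHS]EFinM; apply: lee_wpmul2l; rewrite ?lee_fin.
- apply/measurable_EFinP; apply: measurable_cmod; apply: cmeasM; first exact: cmeas_rot.
  by apply: cmeasJ; exact: cmeas_rot.
- by move=> p _; rewrite lee_fin cmod_ge0.
Qed.

Let Jfin : (\int[leb4]_p \int[leb4]_q (cmod (J p q))%:E < +oo)%E.
Proof.
have mw := @measurable_radw R.
have mJn : measurable_fun setT (fun r : X * X => (cmod (J r.1 r.2))%:E).
  by apply/measurable_EFinP; exact: measurable_cmod.
rewrite (tonelli (f := fun p q => (cmod (J p q))%:E) sigma_finite_leb4 sigma_finite_leb4)//; last first.
  by move=> p q; rewrite lee_fin cmod_ge0.
have mb : measurable_fun setT (fun q : X => (radw q.1 * radw q.2 * (B + B))%:E).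
  by apply/measurable_EFinP; measurability.
have b0 (q : X) : (0 <= (radw q.1 * radw q.2 * (B + B))%:E)%E.
  by rewrite lee_fin; apply: mulr_ge0; [apply: mulr_ge0; exact: radw_ge0|exact: addr_ge0].
apply: (@le_lt_trans _ _ (\int[leb4]_q (radw q.1 * radw q.2 * (B + B))%:E)%E).
  apply: ge0_le_integral => //.
  - by move=> q _; apply: integral_ge0 => p _; rewrite lee_fin cmod_ge0.
  - apply: (measurable_integral (f := fun q p => (cmod (J p q))%:E) sigma_finite_leb4).
      apply: (measurableT_comp mJn (g := fun r : X * X => (r.2, r.1))).
      by measurability.
    by move=> p q; rewrite lee_fin cmod_ge0.
rewrite (integral_prodm _ _ mb b0).
have nb w v : 0 <= radw w * radw v * (B + B).
  by apply: mulr_ge0; [apply: mulr_ge0; exact: radw_ge0|exact: addr_ge0].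
have : (\int[leb2]_w \int[leb2]_v (cmod (radw w * radw v * (B + B))%:C)%:E < +oo)%E.
  apply: (@integral2_radw_lty (fun w v => (radw w * radw v * (B + B))%:C) (B + B)).
  - exact: addr_ge0.
  - by apply: cmeas_real; measurability.
  - by move=> w v; rewrite cmod_real ger0_norm.
apply: le_lt_trans; rewrite le_eqVlt; apply/orP; left; apply/eqP.
apply: eq_integral => w _; apply: eq_integral => v _.
by rewrite cmod_real (ger0_norm (nb _ _)).
Qed.

Let mGp p : cmeas (G p).
Proof. by apply: (cmeas_comp mG (g := fun w => (p, w))); measurability. Qed.

Let I p := (\int[leb2]_w (cmod (G p w))%:E)%E.

Let JI p : (\int[leb4]_q (cmod (J p q))%:E = I p * I p)%E.
Proof.
have mc : measurable_fun setT (fun w => (cmod (G p w))%:E).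
  by apply/measurable_EFinP; exact: measurable_cmod.
have c0 w : (0 <= (cmod (G p w))%:E)%E by rewrite lee_fin cmod_ge0.
rewrite -(integral_prod2 mc mc c0 c0).
rewrite (integral_prodm _ _ (f := fun q => (cmod (J p q))%:E)); last 2 first.
- apply/measurable_EFinP; apply: measurable_cmod.
  by apply: (cmeas_comp mJ (g := fun q => (p, q))); measurability.
- by move=> q; rewrite lee_fin cmod_ge0.
apply: eq_integral => w _; apply: eq_integral => v _.
by rewrite /J cmodM cmodJ EFinM.
Qed.

(** The integral of [|J p|] over both rotation variables is the square of [I p]. Since its integral
    over [p] is finite, so is [I p] for almost every [p]. *)
Let ae_G : {ae leb4, forall p, cL1 leb2 (G p)}.
Proof.
have mJn : measurable_fun setT (fun r : X * X => (cmod (J r.1 r.2))%:E).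
  by apply/measurable_EFinP; exact: measurable_cmod.
have : {ae leb4, forall p, (\int[leb4]_q (cmod (J p q))%:E < +oo)%E}.
  apply: ae_lty => //.
  - apply: (measurable_integral (f := fun p q => (cmod (J p q))%:E) sigma_finite_leb4) => //.
    by move=> p q; rewrite lee_fin cmod_ge0.
  - by move=> p; apply: integral_ge0 => q _; rewrite lee_fin cmod_ge0.
apply: filterS => p; rewrite JI => h; split; first exact: mGp.
have I0 : (0 <= I p)%E by apply: integral_ge0 => w _; rewrite lee_fin cmod_ge0.
rewrite -/(I p) ltNge leye_eq; apply/eqP => E; move: h.
by rewrite E mulyy ltxx.
Qed.

(** Fubini brings the integral over [p] innermost, where undoing the first rotation leaves the
    correlation at the quotient of the two directions. The finiteness is kept because a vanishing
    complex integral alone could be a default value. *)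
Lemma rotavg_sq_mean0 :
  cintegral leb4 (fun p => rotavg p * cj (rotavg p)) = 0 /\
  (\int[leb4]_p (cmod (rotavg p) ^+ 2)%:E < +oo)%E.
Proof.
have mr := cmeas_rotavg; have mw := @measurable_radw R; split; last first.
  apply: le_lt_trans Jfin; apply: ge0_le_integral => //.
  - by move=> p _; rewrite lee_fin sqr_ge0.
  - by apply/measurable_EFinP; apply: measurable_funX; exact: measurable_cmod.
  - apply: (measurable_integral (f := fun p q => (cmod (J p q))%:E) sigma_finite_leb4).
      by apply/measurable_EFinP; exact: measurable_cmod.
    by move=> p q; rewrite lee_fin cmod_ge0.
  move=> p _; rewrite JI expr2 EFinM.
  have h := cmod_cintegral_le leb2 (mGp p).
  by apply: lee_pmul => //; rewrite lee_fin cmod_ge0.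
transitivity (cintegral leb4 (fun p => cintegral leb4 (J p))).
  apply: ae_eq_cintegral.
  - by apply: cmeasM => //; exact: cmeasJ.
  - exact: (cmeas_cintegral (f := J) sigma_finite_leb4).
  apply: filterS ae_G => p lG; rewrite -(cintegralJ lG).
  by rewrite -(cintegral_prodm_tensor sigma_finite_leb2 sigma_finite_leb2 lG (cL1J lG)).
rewrite (cfubini sigma_finite_leb4 sigma_finite_leb4 mJ Jfin).
pose Q (w v : plane R) := (radw w)%:C * ((radw v)%:C * autocorr (cm (cmJ (dir w)) (dir v))).
have mQ : cmeas (fun q : X => Q q.1 q.2).
  apply: cmeasM; first by apply: cmeas_real; measurability.
  apply: cmeasM; first by apply: cmeas_real; measurability.
  apply: (cmeas_comp cmeas_autocorr (g := fun q : X => cm (cmJ (dir q.1)) (dir q.2))).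
  have mJ' := @measurable_cmJ R.
  by apply: measurable_cm; measurability.
have lQ : cL1 leb4 (fun q : X => Q q.1 q.2).
  apply: cL1_prodm => //; apply: (@integral2_radw_lty _ (B + B)) => //; first exact: addr_ge0.
  move=> w v; rewrite /Q; set e := cm _ _; have ue : unitary e.
    by apply: unitary_cm; [apply: unitaryJ; exact: unitary_dir|exact: unitary_dir].
  rewrite 2!cmodM 2!cmod_real (ger0_norm (radw_ge0 w)) (ger0_norm (radw_ge0 v)) mulrA.
  apply: ler_wpM2l; first by apply: mulr_ge0; exact: radw_ge0.
  exact: cmod_autocorr_le.
rewrite -autocorr_dir2_mean0 -[RHS](cintegral_prodm lQ).
apply: eq_cintegral => q.
have u1 := unitary_dir q.1; have u2 := unitary_dir q.2.
set e := cm (cmJ (dir q.1)) (dir q.2).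
have ue : unitary e by apply: unitary_cm => //; exact: unitaryJ.
have l : cL1 leb4 (fun p => F (rotp (dir q.1) p) * cj (F (rotp (dir q.2) p))).
  split; first by apply: cmeasM; [exact: cmeas_rot|apply: cmeasJ; exact: cmeas_rot].
  have := integral_mul_le (cmeas_rot _) (cmeas_rot _) (integral_rot_sq u1) (integral_rot_sq u2).
  by move=> /le_lt_trans; apply; rewrite ltry.
transitivity (cintegral leb4 (fun p => ((radw q.1)%:C * (radw q.2)%:C) *
    (F (rotp (dir q.1) p) * cj (F (rotp (dir q.2) p))))).
  by apply: eq_cintegral => p; rewrite /J /G cjM cj_real; ring.
rewrite (cintegralZl _ l) /Q -mulrA; congr (_ * (_ * _)).
have mH : cmeas (fun p => F p * cj (F (rotp e p))).
  by apply: cmeasM => //; apply: cmeasJ; exact: cmeas_rot.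
rewrite /autocorr -(cintegral_rot u1 mH); apply: eq_cintegral => p; congr (_ * cj (F _)).
rewrite /rotp /=; congr pair; rewrite /e [cm (cmJ _) _]cmC -cmA cmJK//.
Qed.

Lemma rotavg_eq0 : {ae leb4, forall p, rotavg p = 0}.
Proof.
have [h1 h2] := rotavg_sq_mean0; have mr := cmeas_rotavg; have mcr := measurable_cmod mr.
apply: ae_eq0_of_small => // e e0.
rewrite -cmod_cintegral_real//; last by move=> p; exact: sqr_ge0.
- rewrite (@eq_cintegral _ _ _ leb4 _ (fun p => rotavg p * cj (rotavg p))).
    by rewrite h1 cmod0 lee_fin ltW.
  by move=> p; rewrite mul_cj.
- exact: measurable_funX.
Qed.

(** Since [K] does not see rotations, the inner product of [F] with [K], times the mass of [radw],
    equals that of [rotavg] with [K]. *)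
Lemma rotavg_orthogonal (K : X -> R[i]) : cmeas K ->
  (\int[leb4]_p (cmod (K p) ^+ 2)%:E < +oo)%E ->
  (forall e p, unitary e -> K (rotp e p) = K p) ->
  cintegral leb4 (fun p => F p * cj (K p)) = 0.
Proof.
move=> mK K2 rK; have mw := @measurable_radw R.
pose c := fine (\int[leb4]_p (cmod (K p) ^+ 2)%:E).
have cE : (\int[leb4]_p (cmod (K p) ^+ 2)%:E = c%:E)%E.
  by rewrite /c fineK// ge0_fin_numE// integral_ge0// => p _; rewrite lee_fin sqr_ge0.
have c0 : 0 <= c by rewrite fine_ge0// integral_ge0// => p _; rewrite lee_fin sqr_ge0.
pose f (w : plane R) (p : X) := G p w * cj (K p).
have mf : cmeas (fun r : plane R * X => f r.1 r.2).
  apply: cmeasM; last by apply: cmeasJ; exact: (cmeas_comp mK measurable_snd).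
  by apply: (cmeas_comp mG (g := fun r : plane R * X => (r.2, r.1))); measurability.
have lFK e : unitary e -> cL1 leb4 (fun p => F (rotp e p) * cj (K p)).
  move=> ue; split; first by apply: cmeasM; [exact: cmeas_rot|exact: cmeasJ].
  have := integral_mul_le (cmeas_rot _) mK (integral_rot_sq ue) cE.
  by move=> /le_lt_trans; apply; rewrite ltry.
have mFK : cmeas (fun p => F p * cj (K p)) by apply: cmeasM => //; exact: cmeasJ.
suff : radw_mass * cintegral leb4 (fun p => F p * cj (K p)) = 0.
  by move/eqP; rewrite mulf_eq0 (negPf radw_mass_neq0) => /eqP.
transitivity (cintegral leb2 (fun w => cintegral leb4 (f w))).
  rewrite -(cintegralZr _ cL1_radw); apply: eq_cintegral => w.
  have ud := unitary_dir w.
  transitivity (cintegral leb4 (fun p => (radw w)%:C * (F (rotp (dir w) p) * cj (K p)))).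
    rewrite (cintegralZl _ (lFK _ ud)); congr (_ * _).
    by rewrite -(cintegral_rot ud mFK); apply: eq_cintegral => p; rewrite rK.
  by apply: eq_cintegral => p; rewrite /f /G mulrA.
rewrite (cfubini sigma_finite_leb2 sigma_finite_leb4 mf).
  transitivity (cintegral leb4 (fun _ : X => 0 : R[i])); last exact: cintegral0.
  apply: ae_eq_cintegral; last 1 first.
  - apply: filterS2 ae_G rotavg_eq0 => p lG r0.
    by rewrite /f (cintegralZr _ lG) -/(rotavg p) r0 mul0r.
  - apply: (cmeas_cintegral (f := fun p w => f w p) sigma_finite_leb2).
    by apply: (cmeas_comp mf (g := fun r : X * plane R => (r.2, r.1))); measurability.
  - exact: cmeas_cst.
apply: (@le_lt_trans _ _ (\int[leb2]_w ((B + c)%:E * (radw w)%:E))%E).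
  apply: ge0_le_integral => //.
  - by move=> w _; apply: integral_ge0 => p _; rewrite lee_fin cmod_ge0.
  - apply: (measurable_integral (f := fun w p => (cmod (f w p))%:E) sigma_finite_leb4).
      by apply/measurable_EFinP; exact: measurable_cmod.
    by move=> w p; rewrite lee_fin cmod_ge0.
  - by apply: emeasurable_funM => //; exact/measurable_EFinP.
  move=> w _; have ud := unitary_dir w; have [mm _] := lFK _ ud.
  have h := integral_mul_le (cmeas_rot _) mK (integral_rot_sq ud) cE.
  rewrite (eq_integral (fun p => (radw w)%:E * (cmod (F (rotp (dir w) p) * cj (K p)))%:E)%E); last first.
    move=> p _; rewrite -EFinM; congr EFin; rewrite /f /G -mulrA cmodM cmod_real.
    by rewrite (ger0_norm (radw_ge0 _)).
  rewrite ge0_integralZl//.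
  - by rewrite muleC; apply: lee_wpmul2r => //; rewrite lee_fin radw_ge0.
  - by apply/measurable_EFinP; exact: measurable_cmod.
  - by move=> p _; rewrite lee_fin cmod_ge0.
  - by rewrite lee_fin radw_ge0.
rewrite ge0_integralZl//.
- by rewrite lte_mul_pinfty ?integral_radw_lty// lee_fin addr_ge0.
- exact/measurable_EFinP.
- by move=> w _; rewrite lee_fin radw_ge0.
- by rewrite lee_fin addr_ge0.
Qed.


End rotation_average.

(** * Substitutions between measures with densities *)

Section weighted_change.
Context d d' (T : measurableType d) (T' : measurableType d') {R : realType}.
Context (mu : {measure set T -> \bar R}) (nu : {measure set T' -> \bar R}).
Variables (phi : T -> T') (a : T -> R) (b : T' -> R) (c : R).
Hypotheses (c0 : 0 < c) (a0 : forall x, 0 <= a x) (b0 : forall y, 0 <= b y).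
Hypothesis H : forall f : T' -> \bar R, measurable_fun setT f ->
  (forall x, 0 <= f x)%E ->
  (\int[mu]_x ((a x)%:E * f (phi x)) = c%:E * \int[nu]_y ((b y)%:E * f y))%E.

Let funepos_scale (S : Type) (w : S -> R) (f : S -> R) : (forall x, 0 <= w x) ->
  ((fun x => (w x * f x)%:E)^\+ = fun x => ((w x)%:E * (fun x => (f x)%:E)^\+ x))%E.
Proof.
move=> w0; apply/funext => x; rewrite !funeposE -[0%E]/(0%:E) -!EFin_max -EFinM.
by rewrite maxr_pMr// mulr0.
Qed.

Let funeneg_scale (S : Type) (w : S -> R) (f : S -> R) : (forall x, 0 <= w x) ->
  ((fun x => (w x * f x)%:E)^\- = fun x => ((w x)%:E * (fun x => (f x)%:E)^\- x))%E.
Proof.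
move=> w0; apply/funext => x; rewrite !funenegE -[0%E]/(0%:E) -!EFinN -!EFin_max -EFinM.
by rewrite maxr_pMr// mulr0 mulrN.
Qed.

Lemma Rintegral_weighted_change (f : T' -> R) : measurable_fun setT f ->
  Rintegral mu setT (fun x => a x * f (phi x)) = c * Rintegral nu setT (fun y => b y * f y).
Proof.
move=> mf; have mfE : measurable_fun setT (fun x => (f x)%:E) by apply/measurable_EFinP.
rewrite /Rintegral integralE [in RHS]integralE.
rewrite (funepos_scale (fun x => f (phi x)) a0) (funeneg_scale (fun x => f (phi x)) a0).
rewrite (funepos_scale f b0) (funeneg_scale f b0).
have -> : (\int[mu]_x ((a x)%:E * (fun x => (f (phi x))%:E)^\+ x) =
    c%:E * \int[nu]_x ((b x)%:E * (fun x => (f x)%:E)^\+ x))%E.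
  rewrite -(H (measurable_funepos mfE) (funepos_ge0 _)).
  by apply: eq_integral => x _; rewrite !funeposE.
have -> : (\int[mu]_x ((a x)%:E * (fun x => (f (phi x))%:E)^\- x) =
    c%:E * \int[nu]_x ((b x)%:E * (fun x => (f x)%:E)^\- x))%E.
  rewrite -(H (measurable_funeneg mfE) (funeneg_ge0 _)).
  by apply: eq_integral => x _; rewrite !funenegE.
by apply: fine_mulB => //; apply: integral_ge0 => x _; rewrite mule_ge0 ?lee_fin.
Qed.

Lemma cintegral_weighted_change (f : T' -> R[i]) : cmeas f ->
  cintegral mu (fun x => (a x)%:C * f (phi x)) =
  c%:C * cintegral nu (fun y => (b y)%:C * f y).
Proof.
move=> [rf imf].
have re S (w : S -> R) (g : S -> R[i]) :
    (fun x => complex.Re ((w x)%:C * g x)) = (fun x => w x * complex.Re (g x)).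
  by apply/funext => x; case: (g x) => u v; rewrite /= mul0r subr0.
have im S (w : S -> R) (g : S -> R[i]) :
    (fun x => complex.Im ((w x)%:C * g x)) = (fun x => w x * complex.Im (g x)).
  by apply/funext => x; case: (g x) => u v; rewrite /= mul0r addr0.
rewrite /cintegral !re !im; apply: complex_ext; rewrite ?ReM ?ImM /= mul0r ?subr0 ?addr0.
  exact: (Rintegral_weighted_change rf).
exact: (Rintegral_weighted_change imf).
Qed.

End weighted_change.

(** * Polar coordinates with the slope in place of the angle *)

Section polar.
Context {R : realType}.
Local Notation mR := (measurableTypeR R).
Local Notation X := (plane R * plane R)%type.

Definition slope (u : plane R) : R := u.2 / u.1.

Lemma measurable_slope : measurable_fun setT (slope : plane R -> mR).
Proof. by have mi := @measurable_invr R; rewrite /slope; measurability. Qed.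

Let c : \bar R := (\int[leb]_(t in [set: mR]) (t ^+ 2 * expR (- `|t|))%:E)%E.

Lemma radw_line (a l : R) : radw (a, a * l) =
  `|a| * Num.sqrt (1 + l ^+ 2) * expR (- (`|a| * Num.sqrt (1 + l ^+ 2))).
Proof.
rewrite /radw /enorm /= (_ : a ^+ 2 + _ = a ^+ 2 * (1 + l ^+ 2)); last by ring.
by rewrite sqrtrM ?sqr_ge0// sqrtr_sqr.
Qed.

(** Substitute [t = a * Num.sqrt (1 + l ^+ 2)]. The density [radw] and the Jacobian [|a|] of polar
    coordinates contribute one factor [|t|] each, and two inverse square roots make up [kern l]. *)
Lemma integral_radial (l : R) :
  (\int[leb]_(a in [set: mR]) (`|a| * radw (a, a * l))%:E = (kern l)%:E * c)%E.
Proof.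
pose s := Num.sqrt (1 + l ^+ 2).
have d0 : 0 < 1 + l ^+ 2 by rewrite ltr_pwDl// sqr_ge0.
have s0 : 0 < s by rewrite sqrtr_gt0.
have ss : s ^+ 2 = 1 + l ^+ 2 by rewrite sqr_sqrtr// ltW.
have mE : measurable_fun setT (fun t : mR => (t ^+ 2 * expR (- `|t|))%:E).
  apply/measurable_EFinP; apply: measurable_funM; first exact: measurable_funX.
  by apply: measurableT_comp => //; apply: measurableT_comp => //; exact: measurableT_comp.
have E0 (t : R) : (0 <= (t ^+ 2 * expR (- `|t|))%:E)%E by rewrite lee_fin mulr_ge0 ?sqr_ge0 ?expR_ge0.
transitivity (\int[leb]_(a in [set: mR]) (s^-1%:E * ((s * a + 0) ^+ 2 * expR (- `|s * a + 0|)%R)%:E))%E.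
  apply: eq_integral => a _; rewrite -EFinM; congr EFin.
  rewrite radw_line -/s addr0 normrM (gtr0_norm s0) [s * `|a|]mulrC exprMn -(real_normK (num_real a)).
  by have sn := lt0r_neq0 s0; field.
have mEs : measurable_fun setT (fun a : mR => ((s * a + 0) ^+ 2 * expR (- `|s * a + 0|))%:E).
  by apply: (measurableT_comp mE (g := fun a : mR => s * a + 0)); exact: measurable_affine.
have is0 : (0 <= s^-1%:E)%E by rewrite lee_fin invr_ge0 ltW.
rewrite (ge0_integralZl _ measurableT mEs (fun x _ => E0 _) is0)//.
rewrite (integral_affine (f := fun t => (t ^+ 2 * expR (- `|t|))%:E) 0 (lt0r_neq0 s0) mE E0).
by rewrite -/c muleA -EFinM (gtr0_norm s0) -invfM -expr2 ss.
Qed.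

(** For each first coordinate [a] other than 0 the second one is written as [a * l], with Jacobian
    [|a|]; integrating over [a] first leaves [kern l] as density on the slopes. *)
Lemma integral_polar (f : mR -> \bar R) : measurable_fun setT f -> (forall l, 0 <= f l)%E ->
  (\int[leb2]_u ((radw u)%:E * f (slope u)) = c * \int[leb]_l ((kern l)%:E * f l))%E.
Proof.
move=> mf f0; have mw := @measurable_radw R; have ms := measurable_slope.
have mk := @measurable_kern R.
have mrf : measurable_fun setT (fun u : plane R => ((radw u)%:E * f (slope u))%E).
  by apply: emeasurable_funM; [exact/measurable_EFinP|exact: measurableT_comp].
have rf0 (u : plane R) : (0 <= (radw u)%:E * f (slope u))%E by rewrite mule_ge0// lee_fin radw_ge0.
have ml : measurable_fun setT (fun q : plane R => ((`|q.1| * radw (q.1, q.1 * q.2))%:E * f q.2)%E).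
  apply: emeasurable_funM; last by apply: (measurableT_comp mf); measurability.
  apply/measurable_EFinP; apply: measurable_funM.
    by apply: measurableT_comp => //; measurability.
  by measurability.
have l0 a l : (0 <= (`|a| * radw (a, (a * l)%R))%:E * f l)%E.
  by rewrite mule_ge0// lee_fin mulr_ge0 ?radw_ge0.
rewrite (integral_leb2E mrf rf0).
transitivity (\int[leb]_a \int[leb]_l ((`|a| * radw (a, (a * l)%R))%:E * f l))%E.
  apply: ae_eq_integral => //.
  - by apply: (measurable_integral (f := fun a b : mR => ((radw (a, b))%:E * f (slope (a, b)))%E) sigma_finite_leb).
  - by apply: (measurable_integral (f := fun a l : mR => ((`|a| * radw (a, (a * l)%R))%:E * f l)%E) sigma_finite_leb).
  exists [set 0 : R]; split.
  - exact: measurable_set1.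
  - exact: lebesgue_measure_set1.
  move=> a /=; apply: contra_notP => a0 _; have {}a0 : a != 0 by apply/eqP.
  pose h (y : mR) := ((radw (a, y))%:E * f (slope (a, y)))%E.
  have mh : measurable_fun setT h.
    by apply: (measurableT_comp mrf (g := fun y => (a, y))); measurability.
  have h0 y : (0 <= h y)%E by exact: rf0.
  have := integral_affine 0 a0 mh h0; rewrite /leb => E.
  transitivity (`|a|%:E * \int[leb]_l h (a * l + 0)%R)%E.
    by rewrite /leb E muleA -EFinM mulfV ?normr_eq0// mul1e.
  rewrite -ge0_integralZl//.
    apply: eq_integral => l _; rewrite /h addr0 muleA -EFinM /slope /=; congr (_ * f _)%E.
    by rewrite mulrAC divff// mul1r.
  by apply: (measurableT_comp mh (g := fun l : mR => a * l + 0)); exact: measurable_affine.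
rewrite (tonelli (f := fun a l : mR => ((`|a| * radw (a, (a * l)%R))%:E * f l)%E) sigma_finite_leb sigma_finite_leb)//.
have c0 : (0 <= c)%E.
  by apply: integral_ge0 => t _; rewrite lee_fin mulr_ge0 ?sqr_ge0 ?expR_ge0.
rewrite -ge0_integralZl//.
- apply: eq_integral => l _; rewrite ge0_integralZr//.
  + by rewrite integral_radial muleA [(c * _)%E]muleC.
  + apply/measurable_EFinP; apply: (measurable_funM (f := fun x : mR => `|x|)).
      by apply: measurableT_comp => //; exact: measurable_id.
    by apply: (measurableT_comp mw (g := fun x : mR => (x, x * l))); measurability.
  + by move=> a _; rewrite lee_fin mulr_ge0 ?radw_ge0.
- by apply: emeasurable_funM => //; exact/measurable_EFinP.
- by move=> l _; rewrite mule_ge0// lee_fin ltW// kern_gt0.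
Qed.

Lemma cintegral_polar0 (g : mR -> R[i]) : cmeas g ->
  cintegral leb (fun l => (kern l)%:C * g l) = 0 ->
  cintegral leb2 (fun u => (radw u)%:C * g (slope u)) = 0.
Proof.
move=> mg h.
(* The constant function 1 identifies the mass of [radw] as [c * pi], so [c] is positive and
   finite. *)
have cpi : (\int[leb2]_(u in [set: plane R]) (radw u)%:E = c * (pi : R)%:E)%E.
  rewrite -integral_kernT; have := @integral_polar (fun _ => 1%E) (measurable_cst _) (fun=> lee01).
  under eq_integral do rewrite mule1; move=> ->.
  by under eq_integral do rewrite mule1.
have := @integral_radw_lty R; have := @integral_radw_gt0 R; rewrite cpi => cgt clt.
have [r r0 cr] : exists2 r, 0 < r & c = r%:E.
  move: cgt clt; case: c => [r| |].
  - by rewrite -EFinM lte_fin pmulr_lgt0 ?pi_gt0// => r0 _; exists r.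
  - by rewrite gt0_mulye ?lte_fin ?pi_gt0.
  - by rewrite gt0_mulNye ?lte_fin ?pi_gt0.
rewrite (@cintegral_weighted_change _ _ (plane R) mR R leb2 leb slope radw kern r)//.
- by rewrite h mulr0.
- by move=> x; exact: radw_ge0.
- by move=> x; rewrite ltW// kern_gt0.
- by move=> f mf f0; rewrite integral_polar// cr.
Qed.

Lemma integral_shear (a b a' b' : R) (H : X -> \bar R) :
  a' ^+ 2 + b' ^+ 2 != 0 -> measurable_fun setT H -> (forall p, 0 <= H p)%E ->
  (\int[leb4]_p H (conf a b p.2 + p.1, conf a' b' p.2)%R =
   (a' ^+ 2 + b' ^+ 2)^-1%:E * \int[leb4]_p H p)%E.
Proof.
move=> d0 mH H0.
have mc (e1 e2 : R) : measurable_fun setT (fun p : X => conf e1 e2 p.2).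
  by apply: measurable_conf => //; measurability.
have mS : measurable_fun setT (fun p : X => H (conf a b p.2 + p.1, conf a' b' p.2)).
  apply: (measurableT_comp mH); apply: measurable_fun_pair => //.
  by apply: measurable_addV => //; measurability.
rewrite (integral_prodm2 _ _ mS (fun=> H0 _)) (integral_prodm2 _ _ mH H0).
have mx x : measurable_fun setT (fun z => H (z, x)).
  by apply: (measurableT_comp mH (g := fun z => (z, x))); measurability.
transitivity (\int[leb2]_x \int[leb2]_z H (z, conf a' b' x))%E.
  apply: eq_integral => x _ /=; under eq_integral do rewrite addrC.
  by rewrite (integral_shift (conf a b x) (f := fun z => H (z, conf a' b' x))).
have mi : measurable_fun setT (fun x : plane R => \int[leb2]_z H (z, x))%E.
  apply: (measurable_integral (f := fun x z : plane R => H (z, x)) sigma_finite_leb2) => //.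
  by apply: (measurableT_comp mH (g := fun q : X => (q.2, q.1))); measurability.
have i0 x : (0 <= \int[leb2]_z H (z, x))%E by exact: integral_ge0.
rewrite -(integral_conf 0 d0 mi i0); apply: eq_integral => x _.
by rewrite addr0.
Qed.

Lemma cintegral_shear (a b a' b' : R) (H : X -> R[i]) :
  0 < a' ^+ 2 + b' ^+ 2 -> cmeas H ->
  cintegral leb4 (fun p => H (conf a b p.2 + p.1, conf a' b' p.2)) =
  (a' ^+ 2 + b' ^+ 2)^-1%:C * cintegral leb4 H.
Proof.
move=> d0 mH.
apply: (@cintegral_change _ _ X X R leb4 leb4 (fun p => (conf a b p.2 + p.1, conf a' b' p.2))) => //.
  by rewrite invr_gt0.
by move=> f mf f0; rewrite integral_shear// gt_eqF.
Qed.

End polar.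

(** * The case [omega = 0] *)

Section zero_frequency.
Context {R : realType}.
Local Notation mR := (measurableTypeR R).
Local Notation X := (plane R * plane R)%type.
Variables (phi : plane R -> R[i]) (n : R).
Hypothesis phi_L2 : L2le phi n.
Hypothesis phi_eq : {ae @leb2 R, forall z : R * R, (0 : R)%:C * phi z = trilinear phi phi phi z}.

Let mphi : cmeas phi. Proof. by have [] := phi_L2. Qed.

(** Takes midpoint and half diagonal [(m, r)] to the end points [(m + r, m - r)]. *)
Definition diagonals (p : X) : X := conf_pair 1 0 (- 1) 0 p.

Definition tensor2 (f : plane R -> R[i]) (p : X) : R[i] := f p.1 * f p.2.

Let F (p : X) : R[i] := tensor2 phi (diagonals p).

Lemma cmeas_tensor2 f : cmeas f -> cmeas (tensor2 f).
Proof.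
by move=> mf; apply: cmeasM; [exact: (cmeas_comp mf measurable_fst)|exact: (cmeas_comp mf measurable_snd)].
Qed.

Let mF : cmeas F.
Proof. exact: (cmeas_comp (cmeas_tensor2 mphi) (measurable_pairmap _ _ _ _)). Qed.

Lemma integral_diagonals_lty (H : X -> R) : measurable_fun setT H -> (forall p, 0 <= H p) ->
  (\int[leb4]_p (H p)%:E < +oo)%E -> (\int[leb4]_p (H (diagonals p))%:E < +oo)%E.
Proof.
move=> mH H0 Hi.
rewrite (integral_prodm _ _ (f := fun p => (H (diagonals p))%:E)); last 2 first.
- by apply/measurable_EFinP; exact: (measurableT_comp mH (measurable_pairmap _ _ _ _)).
- by move=> p; rewrite lee_fin.
have mHE : measurable_fun setT (fun p => (H p)%:E) by exact/measurable_EFinP.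
have HE0 p : (0 <= (H p)%:E)%E by rewrite lee_fin.
have d0 : (-1 - 1) ^+ 2 + (0 - 0) ^+ 2 != 0 :> R.
  by rewrite (_ : _ + _ = 4) ?pnatr_eq0//; ring.
rewrite (integral_pair d0 mHE HE0) -(integral_prodm sigma_finite_leb2 sigma_finite_leb2 mHE HE0).
by rewrite lte_mul_pinfty// lee_fin invr_ge0 addr_ge0// sqr_ge0.
Qed.

Let F2 : (\int[leb4]_p (cmod (F p) ^+ 2)%:E < +oo)%E.
Proof.
have mT := cmeas_tensor2 mphi.
apply: (@integral_diagonals_lty (fun p => cmod (tensor2 phi p) ^+ 2)).
- by apply: measurable_funX; exact: measurable_cmod.
- by move=> p; exact: sqr_ge0.
have mp : measurable_fun setT (fun x => (cmod (phi x) ^+ 2)%:E).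
  by apply/measurable_EFinP; apply: measurable_funX; exact: measurable_cmod.
have p0 x : (0 <= (cmod (phi x) ^+ 2)%:E)%E by rewrite lee_fin sqr_ge0.
rewrite (integral_prodm _ _ (f := fun p => (cmod (tensor2 phi p) ^+ 2)%:E)); last 2 first.
- by apply/measurable_EFinP; apply: measurable_funX; exact: measurable_cmod.
- by move=> p; rewrite lee_fin sqr_ge0.
have [_ _ fi] := phi_L2.
rewrite (eq_integral (fun x => \int[leb2]_y ((cmod (phi x) ^+ 2)%:E * (cmod (phi y) ^+ 2)%:E))%E); last first.
  by move=> x _; apply: eq_integral => y _; rewrite cmodM exprMn EFinM.
rewrite (integral_prod2 mp mp p0 p0).
have ilt := le_lt_trans fi (ltry _).
apply: lte_mul_pinfty => //; first exact: integral_ge0.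
by rewrite ge0_fin_numE// integral_ge0.
Qed.

(** The point [(1 + i l) / (1 - i l)] of the circle, of argument [2 * atan l]: the rotation between
    the half diagonals of a rectangle of shape [l], and the square of any direction of slope [l]. *)
Definition angle (l : R) : plane R := (kern l * (1 - l ^+ 2), kern l * (2 * l)).

Lemma measurable_angle : measurable_fun setT (angle : mR -> plane R).
Proof.
by have mk := @measurable_kern R; rewrite /angle; measurability.
Qed.

Lemma unitary_angle l : unitary (angle l).
Proof.
rewrite /unitary /angle /= !exprMn -mulrDr (_ : _ + _ = (1 + l ^+ 2) ^+ 2); last by ring.
by rewrite -exprMn kernK expr1n.
Qed.

Lemma cm_angle l (x : plane R) :
  cm (angle l) (conf 2^-1 (- (2^-1 * l)) x) = conf 2^-1 (2^-1 * l) x.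
Proof.
rewrite /angle /kern /cm /conf /=; have := kern_neq0 l => h; case: x => a b /=.
by congr pair; field.
Qed.

Lemma dir_sq (u : plane R) : u.1 != 0 -> cm (dir u) (dir u) = angle (slope u).
Proof.
move=> u1; have h : u.1 ^+ 2 + u.2 ^+ 2 != 0.
  by rewrite gt_eqF// ltr_pwDl ?sqr_ge0// lt_neqAle sqr_ge0 eq_sym sqrf_eq0 u1.
have e0 : enorm u != 0 by rewrite -sqrf_eq0 enorm_sq.
rewrite /dir (negPf e0) /cm /conf /smul /angle /slope /kern /=.
congr pair.
  transitivity ((u.1 ^+ 2 - u.2 ^+ 2) / enorm u ^+ 2); first by field.
  by rewrite enorm_sq; field; rewrite u1 h.
transitivity ((2 * u.1 * u.2) / enorm u ^+ 2); first by field.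
by rewrite enorm_sq; field; rewrite u1 h.
Qed.

(** Both diagonals have the midpoint [s + z]; [r] is half of the diagonal from [b] to [a] and [s]
    half of the one from [d] to [c]. By [cm_angle] they differ by the rotation [angle l]. *)
Lemma rect_diagonals (l : R) (x z : plane R) :
  let r := conf 2^-1 (- (2^-1 * l)) x in let s := conf 2^-1 (2^-1 * l) x in
  [/\ x + z = conf 1 0 r + (s + z), smul l (perp x) + z = conf (- 1) 0 r + (s + z),
      x + smul l (perp x) + z = conf 1 0 s + (s + z) & z = conf (- 1) 0 s + (s + z)].
Proof.
by case: x z => [a b] [c d]; rewrite /conf /smul /perp /=; split;
  congr pair; rewrite /=; field.
Qed.

(** Midpoint and half diagonal [(s + z, r)] replace [(z, x)]. The Jacobian is [|(1 - i l) / 2|^2],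
    whose inverse is [4 * kern l]. *)
Lemma cform_autocorr l : cform l phi phi phi phi =
  4%:C * ((kern l)%:C * autocorr F (angle l)).
Proof.
pose H (p : X) := F p * cj (F (rotp (angle l) p)).
have mH : cmeas H by apply: cmeasM => //; apply: cmeasJ; exact: cmeas_rot.
have d0 : 0 < 2^-1 ^+ 2 + (- (2^-1 * l)) ^+ 2 :> R.
  by rewrite ltr_pwDl ?sqr_ge0// exprn_gt0.
have := cintegral_shear 2^-1 (2^-1 * l) d0 mH.
rewrite -/(autocorr F (angle l)).
have -> : (2^-1 ^+ 2 + (- (2^-1 * l)) ^+ 2)^-1 = 4 * kern l.
  by rewrite /kern; have := kern_neq0 l => h; field.
rewrite rmorphM -mulrA => <-; apply: eq_cintegral => -[z x].
rewrite /H /F /tensor2 /diagonals /conf_pair /rotp /= cm_angle cjM /cquad /=.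
have [e1 e2 e3 e4] := rect_diagonals l x z.
by rewrite -e1 -e2 -e3 -e4 !mulrA.
Qed.

(** Testing the equation with [phi] itself makes the mean of [autocorr F (angle l)] against [kern l]
    vanish. Polar coordinates carry this mean from the slopes to the plane. *)
Lemma autocorr_dirsq_mean0 :
  cintegral leb2 (fun u => (radw u)%:C * autocorr F (cm (dir u) (dir u))) = 0.
Proof.
have mA := cmeas_autocorr mF; have mang := measurable_angle; have ms := @measurable_slope R.
have mg : cmeas (fun l : mR => autocorr F (angle l)) by exact: (cmeas_comp mA mang).
have mdir := @measurable_dir R.
have lk : cL1 leb (fun l : mR => (kern l)%:C * autocorr F (angle l)).
  have mk := @measurable_kern R; set b := fine (\int[leb4]_p (cmod (F p) ^+ 2)%:E).
  apply: (@cL1_le _ _ _ leb _ (fun l => (b + b) * kern l)).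
  - by apply: cmeasM => //; exact: cmeas_real.
  - exact: measurable_funM.
  - move=> l; have k0 := kern_gt0 l; rewrite cmodM cmod_real (gtr0_norm k0) mulrC.
    by rewrite (ler_pM2r k0); apply: (cmod_autocorr_le mF F2); exact: unitary_angle.
  under eq_integral do rewrite EFinM.
  have b0 : 0 <= b by rewrite fine_ge0// integral_ge0// => p _; rewrite lee_fin sqr_ge0.
  rewrite ge0_integralZl//.
  - by rewrite integral_kernT -EFinM ltry.
  - exact/measurable_EFinP.
  - by move=> l _; rewrite lee_fin ltW// kern_gt0.
  - by rewrite lee_fin addr_ge0.
have h : cintegral leb (fun l : mR => (kern l)%:C * autocorr F (angle l)) = 0.
  have := pairing phi_L2 phi_eq phi_L2; rewrite mul0r => /esym.
  under eq_cintegral do rewrite cform_autocorr.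
  rewrite (cintegralZl _ lk) => /eqP; rewrite mulf_eq0 => /orP[/eqP h4|/eqP//].
  by have := congr1 (@complex.Re R) h4; rewrite /= => /eqP; rewrite pnatr_eq0.
rewrite -(cintegral_polar0 mg h); apply: ae_eq_cintegral.
- by apply: cmeas_radw_autocorr => //; exact: measurable_cm.
- by apply: cmeasM; [apply: cmeas_real; exact: measurable_radw|exact: (cmeas_comp mg ms)].
(* On the vertical axis the slope is a default value; the axis is a null set. *)
exists ([set (0 : R)] `*` [set: R]); split.
- by apply: measurableX => //; exact: measurable_set1.
- transitivity (leb [set (0%R : R)] * leb [set: R])%E; first exact: product_measure1E.
  have -> : leb [set (0%R : R)] = 0%E by exact: lebesgue_measure_set1.
  by rewrite mul0e.
move=> u /=; apply: contra_notP => hu; rewrite dir_sq//.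
by apply/eqP => u1; apply: hu; split.
Qed.

Lemma integral_gauss_lty (k : R) : 1 <= k ->
  (\int[leb2]_(x in [set: plane R]) (expR (- (k * enorm x ^+ 2)))%:E < +oo)%E.
Proof.
move=> k1; have me := @measurable_enorm R.
have mE : measurable_fun setT (fun x : plane R => (expR (- (1 * enorm x)))%:E).
  apply/measurable_EFinP; apply: measurableT_comp => //; apply: measurableT_comp => //.
  exact: measurable_funM.
have mG : measurable_fun setT (fun x : plane R => (expR (- (k * enorm x ^+ 2)))%:E).
  apply/measurable_EFinP; apply: measurableT_comp => //; apply: measurableT_comp => //.
  by apply: measurable_funM => //; exact: measurable_funX.
apply: (@le_lt_trans _ _ ((expR 1)%:E * \int[leb2]_(x in [set: plane R]) (expR (- (1 * enorm x)))%:E)%E); last first.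
  by rewrite lte_mul_pinfty// ?lee_fin ?expR_ge0//; exact: integral_expRN_enorm.
rewrite -ge0_integralZl//.
apply: ge0_le_integral => //; first exact: emeasurable_funM.
move=> x _; rewrite -EFinM lee_fin -expRD ler_expR.
by have := sqr_ge0 (enorm x - 1); have := sqr_ge0 (enorm x); have := enorm_ge0 x; nra.
Qed.

Definition gauss (x : plane R) : R := expR (- (1 * enorm x ^+ 2)).

Lemma measurable_gauss : measurable_fun setT gauss.
Proof.
have me := @measurable_enorm R; apply: measurableT_comp => //; apply: measurableT_comp => //.
by apply: measurable_funM => //; exact: measurable_funX.
Qed.

Lemma gauss01 x : 0 <= gauss x <= 1.
Proof. by rewrite expR_ge0/= -[leRHS]expR0 ler_expR oppr_le0 mul1r sqr_ge0. Qed.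

Let psi (x : plane R) : R[i] := (gauss x)%:C * phi x.

Let psi_L2 : L2le psi (1 * n).
Proof. exact: (L2le_mul_bounded phi_L2 measurable_gauss gauss01 ltr01). Qed.

Let psi_L1 : cL1 leb2 psi.
Proof.
have mg : cmeas (fun x => (gauss x)%:C) by apply: cmeas_real; exact: measurable_gauss.
have [m Lg] : exists m, L2le (fun x => (gauss x)%:C) m.
  apply: L2leP => //; apply: le_lt_trans (integral_gauss_lty (lexx 1)).
  apply: ge0_le_integral => //.
  - by move=> x _; rewrite lee_fin sqr_ge0.
  - by apply/measurable_EFinP; apply: measurable_funX; exact: measurable_cmod.
  - by apply/measurable_EFinP; exact: measurable_gauss.
  move=> x _; have /andP[g0 g1] := gauss01 x.
  by rewrite lee_fin cmod_real ger0_norm// expr2 ler_piMr.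
have := cL1_mulJ phi_L2 Lg; congr cL1; apply/funext => x.
by rewrite cj_real mulrC.
Qed.

(** By the parallelogram law the Gaussian in [(m, r)] is [gauss a * gauss b] at the end points
    [a = m + r] and [b = m - r], and [2 m = a + b] splits the phase. The inner product of [F] with
    [K] is thus a positive multiple of the square of an integral proportional to the transform of
    [psi] at [eta], while [K] depends on [r] through its length only. *)
Lemma fourier1_gauss_eq0 eta : fourier1 psi eta = 0.
Proof.
pose f (x : plane R) := psi x * expi (- edot x eta).
have lf : cL1 leb2 f by apply: cL1_expi => //; exact: measurable_edotN.
have [mf _] := lf; have me := @measurable_enorm R.
pose w (x : plane R) : R := expR (- (2 * enorm x ^+ 2)).
have mw : measurable_fun setT w.
  apply: measurableT_comp => //; apply: measurableT_comp => //.
  by apply: measurable_funM => //; exact: measurable_funX.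
pose K (p : X) : R[i] := (w p.1 * w p.2)%:C * expi (2 * edot p.1 eta).
have mK : cmeas K.
  apply: cmeasM; first by apply: cmeas_real; measurability.
  apply: cmeas_expi; apply: measurable_funM => //.
  by apply: measurable_edot; [exact: measurable_fst|exact: measurable_cst].
have K2 : (\int[leb4]_p (cmod (K p) ^+ 2)%:E < +oo)%E.
  have cK p : cmod (K p) ^+ 2 = expR (- (4 * enorm p.1 ^+ 2)) * expR (- (4 * enorm p.2 ^+ 2)).
    rewrite cmodM cmod_expi mulr1 cmod_real ger0_norm; last by rewrite mulr_ge0 ?expR_ge0.
    by rewrite exprMn -!expRM_natl; congr (expR _ * expR _); ring.
  rewrite (integral_prodm _ _ (f := fun p => (cmod (K p) ^+ 2)%:E)); last 2 first.
  - by apply/measurable_EFinP; apply: measurable_funX; exact: measurable_cmod.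
  - by move=> p; rewrite lee_fin sqr_ge0.
  pose e4 (x : plane R) := (expR (- (4 * enorm x ^+ 2)))%:E.
  have m4 : measurable_fun setT e4.
    apply/measurable_EFinP; apply: measurableT_comp => //; apply: measurableT_comp => //.
    by apply: measurable_funM => //; exact: measurable_funX.
  have e40 x : (0 <= e4 x)%E by rewrite lee_fin expR_ge0.
  rewrite (eq_integral (fun x => \int[leb2]_y (e4 x * e4 y))%E); last first.
    by move=> x _; apply: eq_integral => y _; rewrite cK EFinM.
  rewrite (integral_prod2 m4 m4 e40 e40).
  have ilt : (\int[leb2]_x e4 x < +oo)%E by apply: integral_gauss_lty; rewrite ler1n.
  apply: lte_mul_pinfty => //; first exact: integral_ge0.
  by rewrite ge0_fin_numE// integral_ge0.
have rK e p : unitary e -> K (rotp e p) = K p.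
  by move=> ue; rewrite /K /rotp /w /= enorm_cm.
have := rotavg_orthogonal mF F2 autocorr_dirsq_mean0 mK K2 rK.
have -> : cintegral leb4 (fun p => F p * cj (K p)) =
    cintegral leb4 (fun p => tensor2 f (diagonals p)).
  apply: eq_cintegral => p; rewrite /F /tensor2 /K /f /psi cjM cj_real -expiN.
  set a := (diagonals p).1; set b := (diagonals p).2.
  have -> : - (2 * edot p.1 eta) = - edot a eta + - edot b eta.
    by rewrite /a /b /diagonals /conf_pair /conf /edot /=; ring.
  have -> : w p.1 * w p.2 = gauss a * gauss b.
    rewrite /w /gauss -!expRD !enorm_sq /a /b /diagonals /conf_pair /conf /=; congr expR; ring.
  by rewrite expiD rmorphM /=; ring.
have d0 : 0 < (- 1 - 1) ^+ 2 + (0 - 0) ^+ 2 :> R.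
  by rewrite (_ : _ + _ = 4) ?ltr0n//; ring.
rewrite (cintegral_pairmap d0 (cmeas_tensor2 mf)).
rewrite (cintegral_prodm_tensor sigma_finite_leb2 sigma_finite_leb2 lf lf).
move/eqP; rewrite !mulf_eq0 orbb => /orP[/eqP h|/eqP h].
  have := congr1 (@complex.Re R) h; rewrite /= => /eqP; rewrite invr_eq0.
  by rewrite gt_eqF.
by rewrite fourier1E -/f h mulr0.
Qed.

Lemma zero_frequency : {ae leb2, forall x, phi x = 0}.
Proof.
have := fourier1_eq0 psi_L1 psi_L2 fourier1_gauss_eq0.
apply: filterS => x /eqP; rewrite /psi mulf_eq0 => /orP[/eqP h|/eqP//].
have := congr1 (@complex.Re R) h; rewrite /= => /eqP.
by rewrite gt_eqF ?expR_gt0.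
Qed.

End zero_frequency.

Lemma decay_ae0 (R : realType) (phi : plane R -> R[i]) n : L2le phi n ->
  {ae leb2, forall x, phi x = 0} ->
  exists mu : R, 0 < mu /\
    cLp leb2 +oo%E (exp_weight mu phi) /\
    exists fhat : R * R -> R[i],
      is_fourier phi fhat /\ cLp leb2 +oo%E (exp_weight mu fhat).
Proof.
move=> Lphi phi0; have [_ mphi _] := Lphi.
have lphi : cL1 leb2 phi.
  split => //; rewrite (@ae_eq_integral _ _ _ leb2 setT (fun=> 0%E))//.
  - by rewrite integral0.
  - by apply/measurable_EFinP; exact: measurable_cmod.
  - by apply: filterS phi0 => x -> _; rewrite cmod0.
apply: (@decay_conclusion R phi n 1 0) => //.
- by apply: filterS phi0 => x ->; rewrite cmod0 mulr0.
move=> xi; rewrite (_ : fourier1 phi xi = 0) ?cmod0 ?mulr0//.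
rewrite fourier1E (_ : cintegral _ _ = 0) ?mulr0// -[RHS](cintegral0 leb2).
apply: ae_eq_cintegral.
- by apply: cmeasM => //; apply: cmeas_expi; exact: measurable_edotN.
- exact: cmeas_cst.
- by apply: filterS phi0 => x ->; rewrite mul0r.
Qed.

Theorem theorem4p4 (R : realType) (omega : R) (phi : R * R -> R[i])
    (phi_L2 : cLp leb2 2%:E phi)
    (phi_eq : {ae @leb2 R, forall z : R * R,
                omega%:C * phi z = trilinear phi phi phi z}) :
  exists mu : R, 0 < mu /\
    cLp leb2 +oo%E (exp_weight mu phi) /\
    exists phihat : R * R -> R[i],
      is_fourier phi phihat /\ cLp leb2 +oo%E (exp_weight mu phihat).
Proof.
have [n Lphi] := cLp2_L2le phi_L2.
have [w0|w0] := eqVneq omega 0; last exact: (decay_omega_neq0 Lphi phi_eq w0).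
by apply: (decay_ae0 Lphi); rewrite w0 in phi_eq; exact: (zero_frequency Lphi phi_eq).
Qed.
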